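(* Let $n>1$ and let $\gamma$ be a Lie series in $\mathcal{D}$ such that $\gamma_m\in\mathcal{P}_m$ for all odd $m$. For each partition $p$ of $n$ put $\Lambda^p:=\mathcal{D}_n\gamma_p$ and $M^p:=\Lambda^p/\mathsf{Rad}_{\mathcal{D}_n}\Lambda^p$. For odd partitions $p,q$ of $n$ let $c_{qp}:=[\Lambda^q,M^p]_{\mathcal{P}_n}$ be the multiplicity of $M^p$ in a $\mathcal{P}_n$-composition series of $\Lambda^q$. Then the Cartan matrix of $\mathcal{P}_n$ is given by $$c_{qp}=[\Lambda^q,M^p]_{\mathcal{D}_n}=\#\{r\mid r\text{ a composition of }n,\ r\approx q,\ \mathsf{LSC}(r)\approx p\}$$ for all odd partitions $p,q$ of $n$, where $[\Lambda^q,M^p]_{\mathcal{D}_n}$ is the multiplicity of $M^p$ in a $\mathcal{D}_n$-composition series of $\Lambda^q$.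
   Context: $K$ is a field of characteristic $0$. Permutations act on the right ($i\pi$ is the image of $i$) and products in $S_n$ are read from left to right. For $\pi\in S_n$: $\mathrm{Des}(\pi)=\{1\le i\le n-1\mid i\pi>(i+1)\pi\}$, $\mathrm{Peak}(\pi)=\{2\le i\le n-1\mid (i-1)\pi<i\pi>(i+1)\pi\}$. For $D\subseteq\{1,\ldots,n-1\}$ let $\Delta^D=\sum_{\mathrm{Des}(\pi)=D}\pi$ and $\Xi^D=\sum_{E\subseteq D}\Delta^E$; $\mathcal{D}_n$ is the span of the $\Delta^D$ (a subalgebra of $KS_n$), $\mathcal{D}=\bigoplus_{n\ge0}\mathcal{D}_n$. A composition of $n$ is a word $q=q_1.\cdots.q_k$ of positive integers with sum $n$; $D(q)=\{q_1,q_1+q_2,\ldots,q_1+\cdots+q_{k-1}\}$, $\Delta^q=\Delta^{D(q)}$, $\Xi^q=\Xi^{D(q)}$; $q\approx r$ means $q$ is a rearrangement of $r$. The outer product on $\mathcal{D}$ is $\Xi^r\star\Xi^q=\Xi^{r.q}$ (concatenation). $\mathcal{P}_n\subseteq\mathcal{D}_n$ is the span of the elements $\sum_{\mathrm{Peak}(\pi)=P}\pi$, $P\subseteq\{2,\ldots,n-1\}$; it is a left ideal of $\mathcal{D}_n$, hence an algebra (in general without identity; irreducible modules may have zero action). Let $\omega_n=\sum_{k=0}^{n-1}(-1)^k\Delta^{1^{.k}.(n-k)}$, where $1^{.k}$ is the word of $k$ letters $1$. An idempotent $\alpha\in KS_n$ is a Lie idempotent if $\alpha KS_n=\omega_nKS_n$.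 A Lie series in $\mathcal{D}$ is a map $\gamma:\mathbb{N}\to\mathcal{D}$, $m\mapsto\gamma_m\in\mathcal{D}_m$, such that $\frac1m\gamma_m$ is a Lie idempotent for all $m\in\mathbb{N}$; for $q=q_1.\cdots.q_k$, $\gamma_q=\gamma_{q_1}\star\cdots\star\gamma_{q_k}$. A partition of $n$ is a weakly decreasing composition of $n$; it is odd if all parts are odd. $\mathsf{Rad}_AM$ is the intersection of all maximal $A$-submodules of $M$; each $M^p$ is a one-dimensional irreducible $\mathcal{D}_n$-module, also regarded as a $\mathcal{P}_n$-module. A Lyndon word is a nonempty word over the positive integers that is lexicographically strictly smaller than each of its proper nonempty suffixes. Every word $r$ has a unique factorization $r=r^{(1)}.\cdots.r^{(l)}$ into Lyndon words with $r^{(1)}\ge_{lex}\cdots\ge_{lex}r^{(l)}$; $\mathsf{LSC}(r)$ is the word $s_1.\cdots.s_l$, where $s_i$ is the sum of the letters of $r^{(i)}$. *)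

(* Defs.v *)
From HB Require Import structures.
From mathcomp Require Import all_boot all_order all_algebra all_fingroup all_field.
From mathcomp Require Import boolp.

Set Implicit Arguments.
Unset Strict Implicit.
Unset Printing Implicit Defensive.

Import GRing.Theory.
Local Open Scope ring_scope.

Definition grpalg (K : fieldType) (gT : finGroupType) := {ffun gT -> K^o}.

Section GroupAlgebra.
Variables (K : fieldType) (gT : finGroupType).
Local Notation KG := (grpalg K gT).

HB.instance Definition _ := Vector.on KG.

Definition gelt (g : gT) : KG := [ffun h => (h == g)%:R].

Definition gmul (a b : KG) : KG :=
  [ffun g => \sum_(h : gT) (a h : K) * (b (h^-1 * g)%g : K)].

Fact gmulA : associative gmul.
Proof.
move=> a b c; apply/ffunP=> g; rewrite !ffunE.
under [RHS]eq_bigr => h _ do rewrite ffunE mulr_suml.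
rewrite exchange_big; apply: eq_bigr => h _; rewrite ffunE mulr_sumr.
rewrite [RHS](reindex_inj (mulgI h)); apply: eq_bigr => k _.
by rewrite mulrA mulKg invMg mulgA.
Qed.

Fact gmul1l : left_id (gelt 1%g) gmul.
Proof.
move=> a; apply/ffunP=> g; rewrite !ffunE (bigD1 1%g) //= ffunE eqxx mul1r.
by rewrite invg1 mul1g big1 ?addr0 // => h /negPf h1; rewrite ffunE h1 mul0r.
Qed.

Fact gmul1r : right_id (gelt 1%g) gmul.
Proof.
move=> a; apply/ffunP=> g; rewrite !ffunE (bigD1 g) //= ffunE mulVg eqxx mulr1.
rewrite big1 ?addr0 // => h hg.
by rewrite ffunE -eq_mulVg1 (negPf hg) mulr0.
Qed.

Fact gmulDl : left_distributive gmul +%R.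
Proof.
move=> a b c; apply/ffunP=> g; rewrite !ffunE -big_split.
by apply: eq_bigr => h _; rewrite ffunE mulrDl.
Qed.

Fact gmulDr : right_distributive gmul +%R.
Proof.
move=> a b c; apply/ffunP=> g; rewrite !ffunE -big_split.
by apply: eq_bigr => h _; rewrite ffunE mulrDr.
Qed.

Fact gelt1_neq0 : gelt 1%g != 0 :> KG.
Proof. by apply/eqP=> /ffunP/(_ 1%g)/eqP; rewrite !ffunE eqxx oner_eq0. Qed.

HB.instance Definition _ := GRing.Zmodule_isNzRing.Build KG
  gmulA gmul1l gmul1r gmulDl gmulDr gelt1_neq0.

Fact gscaleAl (c : K) (a b : KG) : c *: (a * b) = (c *: a) * b.
Proof.
apply/ffunP=> g; rewrite !ffunE scaler_sumr.
by apply: eq_bigr => h _; rewrite ffunE -mulrA.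
Qed.

HB.instance Definition _ := GRing.Lmodule_isLalgebra.Build K KG gscaleAl.

Fact gscaleAr (c : K) (a b : KG) : c *: (a * b) = a * (c *: b).
Proof.
apply/ffunP=> g; rewrite !ffunE scaler_sumr.
by apply: eq_bigr => h _; rewrite ffunE mulrCA.
Qed.

HB.instance Definition _ := GRing.Lalgebra_isAlgebra.Build K KG gscaleAr.
HB.instance Definition _ := Algebra_isFalgebra.Build K KG.

Lemma geltM (g h : gT) : gelt g * gelt h = gelt (g * h)%g.
Proof.
apply/ffunP=> k; rewrite !ffunE (bigD1 g) //= !ffunE eqxx mul1r.
rewrite big1 ?addr0 => [|l /negPf lg]; last by rewrite ffunE lg mul0r.
by congr (_%:R); rewrite (can2_eq (mulKVg g) (mulKg g)).
Qed.

End GroupAlgebra.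

(* All modules considered are subquotients of aT, acted on by left
   multiplication.  A is a subspace of aT (a subalgebra, possibly without
   identity), and a module on which A acts by zero is allowed. *)

Section Modules.
Variables (K : fieldType) (aT : falgType K) (A : {vspace aT}).
Implicit Types (L M N U V : {vspace aT}) (s : seq {vspace aT}).

Definition submodule U := (A * U <= U)%VS.

Definition max_submodule N M : Prop :=
  [/\ submodule N, (N <= M)%VS, N <> M
    & forall U, submodule U -> (N <= U <= M)%VS -> U = N \/ U = M].

Lemma ex_radical M : exists R : {vspace aT},
  forall v, v \in R <-> v \in M /\ forall N, max_submodule N M -> v \in N.
Proof.
suff H d (F : {vspace aT} -> Prop) V : (\dim V <= d)%N ->
    exists R : {vspace aT},
      forall v, v \in R <-> v \in V /\ forall N, F N -> v \in N.
  exact: (H _ (max_submodule^~ M) _ (leqnn _)).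
elim: d V => [|d IHd] V dV.
  exists 0%VS => v; move: dV; rewrite leqn0 dimv_eq0 => /eqP->.
  by rewrite memv0; split=> [/eqP-> | []//]; split=> // N _; apply: mem0v.
have [[N [FN VN]] | VF] := pselect (exists N, F N /\ ~~ (V <= N)%VS).
  have [|R RP] := IHd (V :&: N)%VS.
    rewrite -ltnS (leq_trans _ dV) // ltn_neqAle dimvS ?capvSl // andbT.
    apply: contra VN => /eqP dVN; apply/capv_idPl/eqP.
    by rewrite eqEdim capvSl dVN leqnn.
  exists R => v; rewrite RP memv_cap; split=> [[/andP[vV _] vF]//|[vV vF]].
  by rewrite vV vF.
exists V => v; split=> [vV | []//]; split=> // N FN.
by have [/subvP->//|VN] := boolP (V <= N)%VS; case: VF; exists N.
Qed.

(* The intersection of all maximal submodules of M (M itself if there are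
   none). *)
Definition radical M : {vspace aT} := sval (cid (ex_radical M)).

Lemma radicalP M v :
  v \in radical M <-> v \in M /\ forall N, max_submodule N M -> v \in N.
Proof. exact: (svalP (cid (ex_radical M)) v). Qed.

(* U / U' and M / M' are isomorphic as A-modules: the isomorphism is the map
   induced by a linear f, whose values outside U are irrelevant. *)
Definition quot_iso U U' M M' : Prop :=
  exists f : 'End(aT),
    [/\ (f @: U <= M)%VS,
        (f @: U + M' = M)%VS,
        (U :&: f @^-1: M' = U')%VS
      & forall a u, a \in A -> u \in U -> f (a * u) - a * f u \in M'].

(* s lists the successive submodules 0 < V_1 < ... < V_k = L. *)
Definition comp_series L s :=
  path (fun U V => `[< max_submodule U V >]) 0%VS s && (last 0%VS s == L).

Definition series_mult s M M' : nat :=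
  count (fun VU => `[< quot_iso VU.2 VU.1 M M' >]) (zip (0%VS :: s) s).

(* [L, M / M']_A = c.  As the multiplicity does not depend on the composition
   series, all of them are required to give c. *)
Definition multiplicity L M M' (c : nat) : Prop :=
  (exists s, comp_series L s)
  /\ forall s, comp_series L s -> series_mult s M M' = c.

End Modules.

Definition is_composition (n : nat) (q : seq nat) :=
  all (leq 1) q && (sumn q == n).

Fixpoint compositions (n : nat) : seq (seq nat) :=
  if n is n'.+1 then
    [seq 1%N :: r | r <- compositions n']
    ++ [seq (head 0%N r).+1 :: behead r | r <- compositions n' & r != [::]]
  else [:: [::]].

Lemma mem_compositions n q : (q \in compositions n) = is_composition n q.
Proof.
elim: n q => [|n IHn] q /=.
  by rewrite inE /is_composition; case: q => [|[|x] q] //=; rewrite addSn andbF.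
rewrite mem_cat; case: q => [|x q].
  by rewrite /is_composition /=; apply/negbTE; rewrite negb_or;
    apply/andP; split; apply/mapP=> [[]].
have -> : (x :: q \in [seq 1%N :: r | r <- compositions n])
          = (x == 1%N) && is_composition n q.
  apply/mapP/andP=> [[r rn [-> ->]]|[/eqP-> qn]]; first by rewrite -IHn.
  by exists q; rewrite ?IHn.
case: x => [|[|x]]; rewrite /is_composition /=.
- by apply/mapP=> [[]].
- rewrite add1n eqSS; case: (boolP (_ && _)) => //= qn; apply/mapP=> [[[|y r]]]; rewrite mem_filter //.
  by rewrite IHn /is_composition => /= /andP[/andP[y0 _] _] [y1]; rewrite -y1 in y0.
- apply/mapP/idP=> [[r] | qn].
    rewrite mem_filter IHn; case: r => [|y r] //.
    by rewrite /is_composition /= => /andP[/andP[_ rn] yn] [xy ->]; rewrite rn addSn xy.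
  by exists (x.+1 :: q); rewrite // mem_filter IHn.
Qed.

Lemma compositions_uniq n : uniq (compositions n).
Proof.
elim: n => //= n IHn; rewrite cat_uniq map_inj_uniq ?IHn /=; last by move=> ? ? [].
rewrite map_inj_in_uniq ?filter_uniq // ?andbT.
  apply/hasPn=> w /mapP[r]; rewrite mem_filter mem_compositions.
  case: r => [|x r] //= /andP[x0 _] ->.
  by apply/mapP=> [[t _ [x1]]]; rewrite x1 in x0.
by case=> [|x r] [|y t]; rewrite !mem_filter //= => _ _ [-> ->].
Qed.

Definition is_partition (n : nat) (p : seq nat) :=
  is_composition n p && sorted geq p.

Definition odd_partition (n : nat) (p : seq nat) :=
  is_partition n p && all odd p.

(* seqlexi is the lexicographic order in which a proper prefix is smaller. *)
Definition lyndon (w : seq nat) :=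
  (w != [::]) &&
  all (fun i => ((w : seqlexi nat) < (drop i w : seqlexi nat))%O)
      (iota 1 (size w).-1).

Definition lyndon_factorization (r : seq nat) (ss : seq (seq nat)) :=
  [&& flatten ss == r, all lyndon ss
    & sorted (fun v w => ((w : seqlexi nat) <= (v : seqlexi nat))%O) ss].

(* The words of letter sums of the Lyndon factorization of r, which is searched
   for among all the ways to cut r into nonempty words. *)
Definition LSC (r : seq nat) : seq nat :=
  map sumn (head [::]
    [seq ss <- [seq reshape sh r | sh <- compositions (size r)]
       | lyndon_factorization r ss]).

(* A permutation in 'S_n acts on the 0-based positions and values 0, ..., n-1,
   and (s * t) i = t (s i).  Sets of descents and peaks keep their usual
   1-based numbering: they are subsets of {1, ..., n-1}, embedded in 'I_n.  So
   i is a descent of s if the values of s at the 0-based positions i-1 and i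
   decrease. *)

Definition Des n (s : 'S_n) : {set 'I_n} :=
  [set i : 'I_n | [exists j : 'I_n, (j.+1 == i :> nat) && (s i < s j)%N]].

Definition Peak n (s : 'S_n) : {set 'I_n} :=
  [set i : 'I_n | [exists j : 'I_n, [exists k : 'I_n,
    [&& j.+1 == i :> nat, k.+1 == j :> nat, (s k < s j)%N & (s i < s j)%N]]]].

(* The last partial sum n of a composition of n is not in 'I_n. *)
Definition comp_set n (q : seq nat) : {set 'I_n} :=
  [set i : 'I_n | val i \in scanl addn 0%N q].

Lemma comp_set_inj n : {in compositions n &, injective (comp_set n)}.
Proof.
have Spos q : all (leq 1) q -> forall x, path ltn x (scanl addn x q).
  elim: q => //= y q IHq /andP[y0 qP] x.
  by rewrite -addn1 leq_add2l y0 IHq.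
have Sle q : forall x i, i \in scanl addn x q -> (i <= x + sumn q)%N.
  elim: q => //= y q IHq x i; rewrite inE => /orP[/eqP->|/IHq].
    by rewrite leq_add2l leq_addr.
  by rewrite addnA.
have Slast q : q != [::] -> forall x, (x + sumn q)%N \in scanl addn x q.
  elim: q => //= y q IHq _ x; rewrite inE addnA; case: q IHq => [|z q] IHq.
    by rewrite addn0 eqxx.
  by rewrite IHq ?orbT.
move=> q r; rewrite !mem_compositions => /andP[q0 /eqP qn] /andP[r0 /eqP rn] qr.
have eq_lt i : (i < n)%N -> (i \in scanl addn 0%N q) = (i \in scanl addn 0%N r).
  by move=> i_n; have /setP/(_ (Ordinal i_n)) := qr; rewrite !inE.
apply: (can_inj (scanlK (f := fun x y => (y - x)%N) addKn 0%N)).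
apply: (irr_sorted_eq ltn_trans ltnn).
- by apply: path_sorted (Spos q q0 0%N).
- by apply: path_sorted (Spos r r0 0%N).
move=> i; have [/eq_lt// | n_i | ->] := ltngtP i n.
  by apply/idP/idP=> /Sle; rewrite ?qn ?rn add0n leqNgt n_i.
have [q_nil | q_nnil] := eqVneq q [::].
  by move: r0 rn; rewrite -qn q_nil; case: r {qr eq_lt} => //= -[].
have [r_nil | r_nnil] := eqVneq r [::].
  by move: q0 qn; rewrite -rn r_nil; case: q {qr eq_lt q_nnil} => //= -[].
by move: (Slast q q_nnil 0%N) (Slast r r_nnil 0%N); rewrite qn rn add0n => -> ->.
Qed.

Lemma comp_set_gt0 n q (i : 'I_n) : q \in compositions n ->
  i \in comp_set n q -> (0 < i)%N.
Proof.
rewrite mem_compositions inE => /andP[q0 _].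
suff H x : val i \in scanl addn x q -> (0 < i)%N by apply: H.
elim: q q0 x => //= y q IHq /andP[y0 q0] x.
by rewrite inE => /orP[/eqP-> | /(IHq q0)//]; rewrite addn_gt0 y0 orbT.
Qed.

Lemma Des_surj n (D : {set 'I_n}) : {in D, forall i : 'I_n, (0 < i)%N} ->
  exists s : 'S_n, Des s = D.
Proof.
move=> D0.
pose key (i : 'I_n) := (#|[set d in D | (i < d)%N]| * n + i)%N.
have key_inj : injective key.
  move=> i j /(congr1 (modn^~ n)); rewrite !modnMDl !modn_small //.
  exact: val_inj.
have rank_lt i : (#|[set j | (key j < key i)%N]| < n)%N.
  rewrite -[X in (_ < X)%N]card_ord -cardsT; apply/proper_card/properP.
  by split; [apply: subsetT | exists i; rewrite ?inE ?ltnn].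
pose rank i := Ordinal (rank_lt i).
have rank_mono i j : (key i < key j)%N -> (rank i < rank j)%N.
  move=> ij; apply/proper_card/properP; split.
    by apply/subsetP=> k; rewrite !inE => /ltn_trans; apply.
  by exists i; rewrite !inE ?ltnn.
have rank_ltE i j : (rank i < rank j)%N = (key i < key j)%N.
  apply/idP/idP=> [|/rank_mono//]; rewrite !ltnNge; apply: contra.
  rewrite leq_eqVlt => /orP[/eqP/key_inj-> // | /rank_mono/ltnW //].
have rank_inj : injective rank.
  move=> i j ij; apply: key_inj; move: (rank_ltE i j) (rank_ltE j i).
  by rewrite ij ltnn; case: ltngtP.
have keyS (i j : 'I_n) : j.+1 = i :> nat -> (key i < key j)%N = (i \in D).
  move=> ji; rewrite /key.
  have -> : #|[set d in D | (j < d)%N]|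
            = ((i \in D) + #|[set d in D | (i < d)%N]|)%N.
    rewrite (cardsD1 i) !inE ji leqnn andbT; congr (_ + _)%N.
    apply: eq_card => d; rewrite !inE -val_eqE /= -ji andbCA; congr (_ && _).
    by rewrite [RHS]ltn_neqAle eq_sym.
  have i_n := ltn_ord i; case: (i \in D); last by rewrite add0n ltn_add2l -ji ltnNge leqnSn.
  rewrite mulnDl mul1n addnAC addnC ltn_add2r -ji in i_n *.
  by rewrite (leq_trans i_n) // leq_addr.
exists (perm rank_inj); apply/setP=> i; rewrite inE.
apply/existsP/idP=> [[j /andP[/eqP ji]]|iD].
  by rewrite !permE rank_ltE keyS.
have i1 : (i.-1 < n)%N by rewrite (leq_ltn_trans (leq_pred i)).
by exists (Ordinal i1); rewrite !permE rank_ltE keyS /= prednK ?D0 ?eqxx.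
Qed.

Section Descent.
Variable K : fieldType.

Definition Delta_set n (D : {set 'I_n}) : grpalg K 'S_n :=
  \sum_(s : 'S_n | Des s == D) gelt K s.

Definition Xi_set n (D : {set 'I_n}) : grpalg K 'S_n :=
  \sum_(E : {set 'I_n} | E \subset D) Delta_set E.

Definition Peak_sum n (P : {set 'I_n}) : grpalg K 'S_n :=
  \sum_(s : 'S_n | Peak s == P) gelt K s.

Definition Delta n (q : seq nat) := Delta_set (comp_set n q).
Definition Xi n (q : seq nat) := Xi_set (comp_set n q).

(* Delta_set D = 0 if D contains 0, so that D may range over all subsets of
   'I_n; likewise for sets which are not the set of peaks of any permutation. *)
Definition descent_alg n : {vspace grpalg K 'S_n} :=
  <<[seq Delta_set D | D : {set 'I_n}]>>%VS.

Definition peak_alg n : {vspace grpalg K 'S_n} :=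
  <<[seq Peak_sum P | P : {set 'I_n}]>>%VS.

(* The elements Xi n q, for q a composition of n, form a basis of
   descent_alg n (see Xi_free). *)
Definition Xi_basis n := map_tuple (Xi n) (in_tuple (compositions n)).

Lemma Xi_setE n (D : {set 'I_n}) s : Xi_set D s = (Des s \subset D)%:R :> K.
Proof.
have DeltaE E : Delta_set E s = (Des s == E)%:R :> K.
  rewrite sum_ffunE; case: eqP => [sE | sE].
    rewrite (bigD1 s) ?sE //= ffunE eqxx big1 ?addr0 // => u /andP[_ us].
    by rewrite ffunE eq_sym (negPf us).
  by rewrite big1 // => u /eqP uE; rewrite ffunE; case: eqP => // su; case: sE; rewrite su.
rewrite sum_ffunE; under eq_bigr do rewrite DeltaE.
case: (boolP (_ \subset _)) => sD.
  rewrite (bigD1 (Des s)) //= eqxx big1 ?addr0 // => E /andP[_ Es].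
  by rewrite eq_sym (negPf Es).
by rewrite big1 // => E ED; case: eqP => // sE; rewrite sE ED in sD.
Qed.

Lemma Xi_free n : free (Xi_basis n).
Proof.
set X := Xi_basis n; set N := size (compositions n).
pose q (i : 'I_N) := nth [::] (compositions n) i.
have qP i : q i \in compositions n by apply: mem_nth.
have XE (i : 'I_N) : X`_i = Xi n (q i) by rewrite (nth_map [::]).
apply/freeP=> c; under eq_bigr do rewrite XE; move=> c0.
suff H d i : (n - #|comp_set n (q i)| < d)%N -> c i = 0 by move=> i; apply: H (leqnn _).
elim: d i => // d IHd i id.
have [s sE] := Des_surj (fun j => comp_set_gt0 (qP i) (i := j)).
move/ffunP/(_ s): c0; rewrite sum_ffunE ffunE (bigD1 i) //= big1 => [|j ji].
  by rewrite addr0 ffunE Xi_setE sE subxx [_ *: _]mulr1.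
rewrite ffunE Xi_setE sE; case: (boolP (_ \subset _)) => [ij|]; last by rewrite scaler0.
rewrite IHd ?scale0r //.
have ltij : (#|comp_set n (q i)| < #|comp_set n (q j)|)%N.
  rewrite proper_card // properEneq ij andbT; apply: contra ji => /eqP/esym.
  move/(comp_set_inj (qP j) (qP i))/eqP.
  by rewrite nth_uniq ?compositions_uniq // => /eqP/val_inj->.
have := max_card (mem (comp_set n (q j))); rewrite card_ord => jn.
by rewrite -ltnS (leq_trans _ id) // ltnS ltn_sub2l // (leq_trans ltij).
Qed.

(* The outer product descent_alg m x descent_alg k -> descent_alg (m + k),
   bilinear with Xi r x Xi q |-> Xi (r ++ q) (see outer_Xi).  The degree n of
   the result, to be taken equal to m + k, is a separate argument in order to
   avoid casts. *)
Definition outer m k n (a : grpalg K 'S_m) (b : grpalg K 'S_k) :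
    grpalg K 'S_n :=
  \sum_(i < size (compositions m)) \sum_(j < size (compositions k))
    (coord (Xi_basis m) i a * coord (Xi_basis k) j b) *:
      Xi n (nth [::] (compositions m) i ++ nth [::] (compositions k) j).

Lemma outer_Xi m k n r q : r \in compositions m -> q \in compositions k ->
  outer n (Xi m r) (Xi k q) = Xi n (r ++ q).
Proof.
move=> rm qk.
have coordXi l u (ul : u \in compositions l) (i : 'I_(size (compositions l))) :
    coord (Xi_basis l) i (Xi l u) = (i == index u (compositions l) :> nat)%:R.
  have ul' : (index u (compositions l) < size (compositions l))%N by rewrite index_mem.
  have -> : Xi l u = (Xi_basis l)`_(Ordinal ul').
    by rewrite (nth_map [::]) ?nth_index.
  by rewrite coord_free ?Xi_free // eq_sym -val_eqE.
have rm' : (index r (compositions m) < size (compositions m))%N by rewrite index_mem.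
have qk' : (index q (compositions k) < size (compositions k))%N by rewrite index_mem.
rewrite /outer (bigD1 (Ordinal rm')) //= (bigD1 (Ordinal qk')) //=.
rewrite !coordXi // !eqxx mulr1 scale1r !nth_index // !big1 ?addr0 // => [i ir|j jq].
  by rewrite big1 // => j _; rewrite coordXi // [_ == _](negPf ir) mul0r scale0r.
by rewrite coordXi // [_ == _](negPf jq) mulr0 scale0r.
Qed.

Definition omega n : grpalg K 'S_n :=
  \sum_(k < n) (-1) ^+ k *: Delta n (rcons (nseq k 1%N) (n - k)%N).

Definition Lie_idempotent n (a : grpalg K 'S_n) : Prop :=
  a * a = a /\ (<[a]> * fullv = <[omega n]> * fullv)%VS.

(* gamma is indexed by the positive integers: its value at m = 0 is never
   used. *)
Definition Lie_series (gamma : forall m, grpalg K 'S_m) : Prop :=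
  forall m, (0 < m)%N ->
    gamma m \in descent_alg m /\ Lie_idempotent (m%:R^-1 *: gamma m).

(* gamma_q as an element of degree n, to be taken equal to sumn q. *)
Fixpoint gamma_word (gamma : forall m, grpalg K 'S_m) n (q : seq nat) :
    grpalg K 'S_n :=
  if q is x :: q' then outer n (gamma x) (gamma_word gamma (sumn q') q')
  else Xi n [::].

Definition Lam (gamma : forall m, grpalg K 'S_m) n (p : seq nat) :
    {vspace grpalg K 'S_n} :=
  (descent_alg n * <[gamma_word gamma n p]>)%VS.

Definition RadLam (gamma : forall m, grpalg K 'S_m) n (p : seq nat) :
    {vspace grpalg K 'S_n} :=
  radical (descent_alg n) (Lam gamma n p).

End Descent.

(* Main.v *)
(* Proof idea.  The group algebra of S_n acts on words by places, and an element
   of degree m is viewed as a function on words with m distinct letters; then the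
   outer product is concatenation and Xi^s sums a function over the shuffles of
   the blocks of a word.  Each gamma_m is primitive (it vanishes on proper
   shuffles), so Xi^s acts on a product of primitives, in particular on gamma_t,
   by distributing its factors over the parts of s.  Hence Lambda^p has basis
   gamma_r, r ~ p, and gamma_p = (prod p_i) Xi^p + (terms with more parts).
   Filtering by the vanishing of all Xi^s with many parts, D_n acts on the layers
   by characters chi_s, which depend on s up to rearrangement only and satisfy
   chi_s(gamma_p) <> 0 iff s ~ p.  So e_p = gamma_p / chi_p(gamma_p) is an
   idempotent and, for any subspace A with gamma_p in A <= D_n, the A-composition
   factors not annihilated by e_p are the copies of M^p, each being a line fixed
   by e_p: the multiplicity of M^p in Lambda^q is dim(e_p Lambda^q).  For odd p
   this applies to A = P_n and to A = D_n, since P is closed under the outer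
   product.  Finally, the products of the Lie polynomials attached to the Lyndon
   factors of the r ~ q with LSC(r) ~ p have images under e_p with distinct
   leading words, which bounds dim(e_p Lambda^q) below by the number of such r;
   summing over all p gives at most dim Lambda^q on the left and exactly the
   number of r ~ q on the right, so that all the bounds are equalities. *)

From HB Require Import structures.
Require Import Defs.
From mathcomp Require Import all_boot all_order all_algebra all_fingroup all_field.
From mathcomp Require Import boolp.

Set Implicit Arguments.
Unset Strict Implicit.
Unset Printing Implicit Defensive.

Import GRing.Theory.
Local Open Scope ring_scope.

(** * Shuffles *)

Section Shuffles.
Variable T : eqType.
Implicit Types (u v w z : seq T).

(** The factors of an outer product live in different group algebras. Read as functions on words
    with arbitrary distinct letters they share one algebra of formal series, in which concatenation
    is compatible with the unshuffle coproduct. A primitive series F has coproduct F tensor 1 + 1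
    tensor F, and this turns the action of [Xi] on a product into a distribution of its factors.
    Primitivity of [gamma m] comes from [omega], an iterated bracket of letters: left multiplication
    by any two-part [Xi] annihilates [omega], hence the whole right ideal that it generates.

    The peak algebra may lack an identity and may act by zero on simple modules. Multiplicities are
    therefore counted along an arbitrary composition series: the dimension of the image of e_p grows
    by one at each factor isomorphic to M^p and is constant at all others. The resulting number does
    not mention the acting algebra, which is why P_n and D_n give the same multiplicity; oddness of
    p is what places e_p in P_n. *)

Fixpoint cuts w : seq (seq T * seq T) :=
  if w is a :: w' then ([::], w) :: [seq (a :: c.1, c.2) | c <- cuts w']
  else [:: ([::], [::])].

Fixpoint shuf u : seq T -> seq (seq T) :=
  fix shuf_u v :=
    match u, v with
    | [::], _ => [:: v]
    | _, [::] => [:: u]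
    | a :: u', b :: v' =>
        [seq a :: z | z <- shuf u' v] ++ [seq b :: z | z <- shuf_u v']
    end.

Lemma shufNl v : shuf [::] v = [:: v]. Proof. by case: v. Qed.
Lemma shufNr u : shuf u [::] = [:: u]. Proof. by case: u. Qed.

Lemma mem_map_cons (a d : T) z (l : seq (seq T)) :
  (d :: z \in [seq a :: x | x <- l]) = (d == a) && (z \in l).
Proof.
apply/mapP/andP => [[z' zl [-> ->]]//|[/eqP-> zl]]; by exists z.
Qed.

Lemma perm_shuf u v z : z \in shuf u v -> perm_eq z (u ++ v).
Proof.
elim: u v z => [|b u IHu] v z; first by rewrite shufNl inE => /eqP->.
elim: v z => [|c v IHv] z.
  by rewrite shufNr cats0 inE => /eqP->.
rewrite [shuf _ _]/= mem_cat => /orP[] /mapP[z' zz' ->].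
  by rewrite /= perm_cons (IHu _ _ zz').
have := IHv _ zz'; rewrite -(perm_cons c) => /perm_trans; apply.
by rewrite -[X in perm_eq _ X]/((b :: u) ++ [:: c] ++ v) perm_sym perm_catCA.
Qed.

(** When [p] tells the letters of [u] from those of [v], a shuffle is recognised by its two
    subwords. Shuffles of the blocks of a permutation word are of this kind. *)
Lemma mem_shuf (p : pred T) u v z : all p u -> all (predC p) v ->
  (z \in shuf u v) = (filter p z == u) && (filter (predC p) z == v).
Proof.
elim: z u v => [|d z IHz] [|b u] v pu pv.
- by rewrite shufNl inE.
- by case: v pv => [|c v] pv /=; rewrite ?mem_cat; apply/negP => //= /orP[] /mapP[].
- rewrite shufNl inE.
  have filtp l : all (predC p) l -> filter p l = [::].
    by move=> pl; apply/eqP; rewrite -(negbK (_ == _)) -has_filter -all_predC.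
  apply/eqP/andP=> [->|[]]; first by rewrite filtp // (all_filterP pv) !eqxx.
  by rewrite /=; case: (p d) => // /eqP/eqP; rewrite -[_ == _]negbK -has_filter -all_predC => /all_filterP-> /eqP.
case: v pv => [|c v] pv.
  rewrite shufNr inE.
  have filtp l : all p l -> filter (predC p) l = [::].
    move=> pl; apply/eqP; rewrite -(negbK (_ == _)) -has_filter -all_predC.
    by apply: sub_all pl => x /= ->.
  apply/eqP/andP=> [->|[/eqP<-]]; first by rewrite filtp // (all_filterP pu) !eqxx.
  rewrite -[_ == _]negbK -has_filter -all_predC => /all_filterP => h.
  rewrite -[LHS]h; apply: eq_filter => x /=; exact: negbK.
rewrite [shuf _ _]/= mem_cat !mem_map_cons.
case/andP: (pu) => pb pu'; case/andP: (pv) => /= pc pv'.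
rewrite -/(shuf (b :: u) v) (IHz u) // (IHz (b :: u)) //=.
have [->|db] := eqVneq d b.
  have bc : b == c = false by apply/eqP => bc; rewrite -bc pb in pc.
  by rewrite pb bc /= orbF eqseq_cons eqxx.
have [->|dc] := eqVneq d c.
  by rewrite (negPf pc) /= eqseq_cons eqxx.
by case: (p d) => /=; rewrite !eqseq_cons ?(negPf db) ?(negPf dc) //= andbF.
Qed.

Lemma uniq_shuf (p : pred T) u v : all p u -> all (predC p) v -> uniq (shuf u v).
Proof.
elim: u v => [|b u IHu] v; first by rewrite shufNl.
elim: v => [|c v IHv]; first by rewrite shufNr.
move=> pu pv; case/andP: (pu) => pb pu'; case/andP: (pv) => /= pc pv'.
rewrite cat_uniq !map_inj_uniq ?IHu ?IHv //=; try by move=> ? ? [].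
rewrite andbT; apply/hasPn => z /mapP[z' _ ->].
by apply/mapP => -[z'' _ [cb _]]; rewrite cb pb in pc.
Qed.

Lemma map_shuf (f : T -> T) u v :
  shuf (map f u) (map f v) = map (map f) (shuf u v).
Proof.
elim: u v => [|b u IHu] v; first by rewrite !shufNl.
elim: v => [|c v IHv]; first by rewrite !shufNr.
rewrite (_ : shuf (map f (b :: u)) (map f (c :: v)) =
    [seq f b :: z | z <- shuf (map f u) (map f (c :: v))] ++
    [seq f c :: z | z <- shuf (map f (b :: u)) (map f v)]) // IHu IHv.
by rewrite [shuf (b :: u) _]/= map_cat -!map_comp.
Qed.

(* The shuffles of the successive blocks of w of sizes s_1, s_2, ... *)
Fixpoint mshuf (s : seq nat) w : seq (seq T) :=
  if s is m :: s' then
    [seq z | v <- mshuf s' (drop m w), z <- shuf (take m w) v]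
  else [:: w].

End Shuffles.

(** * Distributing the factors of a product *)

Section Unshuf.
Variable X : Type.

Fixpoint unshuf (xs : seq X) : seq (seq X * seq X) :=
  if xs is x :: xs' then
    [seq (x :: c.1, c.2) | c <- unshuf xs'] ++
    [seq (c.1, x :: c.2) | c <- unshuf xs']
  else [:: ([::], [::])].

Variable deg : X -> nat.

(* The products occurring when Xi^s acts on the product of the xs: the factors
   are distributed, in order, into groups of total degrees s_1, s_2, ... *)
Fixpoint act (s : seq nat) (xs : seq X) : seq (seq X) :=
  if s is m :: s' then
    [seq c.1 ++ t | c <- [seq c <- unshuf xs | sumn (map deg c.1) == m],
                    t <- act s' c.2]
  else if xs is [::] then [:: [::]] else [::].

End Unshuf.

(** * Primitive series *)

Section FormalSeries.
Variables (K : comNzRingType) (T : eqType).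
Local Notation fn := (seq T -> K).
Implicit Types (F G H : fn) (u v w : seq T).

(* A function on words is read as a noncommutative formal series.  Its sum over
   shuf u v is the coefficient of u (x) v in its (unshuffle) coproduct. *)
Definition cmul F G : fn := fun w => \sum_(c <- cuts w) F c.1 * G c.2.
Definition cone : fn := fun w => (w == [::])%:R.
Definition prodf (xs : seq fn) : fn := foldr cmul cone xs.
Definition primitive F : Prop :=
  F [::] = 0 /\ forall u v, u != [::] -> v != [::] ->
    \sum_(z <- shuf u v) F z = 0.
Definition homog d F : Prop := forall w, size w != d -> F w = 0.

Lemma big_cuts_cons (A : seq T -> seq T -> K) a w :
  \sum_(c <- cuts (a :: w)) A c.1 c.2
  = A [::] (a :: w) + \sum_(c <- cuts w) A (a :: c.1) c.2.
Proof. by rewrite /= big_cons big_map. Qed.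

Lemma big_shuf_cons (A : seq T -> K) a b u v :
  \sum_(z <- shuf (a :: u) (b :: v)) A z
  = \sum_(z <- shuf u (b :: v)) A (a :: z)
  + \sum_(z <- shuf (a :: u) v) A (b :: z).
Proof. by rewrite [shuf _ _]/= big_cat !big_map. Qed.

(** Cutting a shuffle in two amounts to cutting both words and shuffling the left pieces and the
    right pieces separately: the coproduct is multiplicative for concatenation. *)
Lemma cut_shuf (A : seq T -> seq T -> K) u v :
  \sum_(z <- shuf u v) \sum_(c <- cuts z) A c.1 c.2
  = \sum_(c <- cuts u) \sum_(d <- cuts v)
      \sum_(y <- shuf c.1 d.1) \sum_(z <- shuf c.2 d.2) A y z.
Proof.
elim: u v A => [|a u IHu] v A.
  rewrite shufNl /= !big_seq1; apply: eq_bigr => d _.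
  by rewrite !shufNl !big_seq1.
elim: v A => [|b v IHv] A.
  rewrite shufNr /= !big_seq1; apply: eq_bigr => d _.
  by rewrite !big_seq1 !shufNr !big_seq1.
rewrite (big_shuf_cons (fun z => \sum_(c <- cuts z) A c.1 c.2)).
have cc a' z : \sum_(c <- cuts (a' :: z)) A c.1 c.2
  = A [::] (a' :: z) + \sum_(c <- cuts z) A (a' :: c.1) c.2.
  exact: (big_cuts_cons A).
under eq_bigr do rewrite cc; under [X in _ + X]eq_bigr do rewrite cc.
rewrite !big_split /= (IHu _ (fun x y => A (a :: x) y)).
rewrite (IHv (fun x y => A (b :: x) y)).
rewrite (big_cuts_cons (fun c1 c2 => \sum_(d <- cuts (b :: v))
      \sum_(y <- shuf c1 d.1) \sum_(z <- shuf c2 d.2) A y z)).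
rewrite (big_cuts_cons (fun d1 d2 => \sum_(y <- shuf [::] d1)
   \sum_(z <- shuf (a :: u) d2) A y z)).
rewrite shufNl big_seq1 (big_shuf_cons (A [::])).
rewrite addrACA -!addrA; congr (_ + (_ + _)).
rewrite (big_cuts_cons (fun c1 c2 => \sum_(d <- cuts v)
      \sum_(y <- shuf c1 d.1) \sum_(z <- shuf c2 d.2) A (b :: y) z)).
rewrite addrCA; congr (_ + _).
  by apply: eq_bigr => d _; rewrite !shufNl !big_seq1.
rewrite -big_split; apply: eq_bigr => c _ /=.
rewrite (big_cuts_cons (fun d1 d2 => \sum_(y <- shuf c.1 d1)
   \sum_(z <- shuf c.2 d2) A (a :: y) z)).
rewrite (big_cuts_cons (fun d1 d2 => \sum_(y <- shuf (a :: c.1) d1)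
   \sum_(z <- shuf c.2 d2) A y z)).
rewrite !shufNr !big_seq1 -addrA; congr (_ + _).
rewrite -big_split; apply: eq_bigr => d _ /=.
by rewrite (big_shuf_cons (fun y => \sum_(z <- shuf c.2 d.2) A y z)).
Qed.

(** Coassociativity of deconcatenation: both sides sum over the cuts of [w] into three pieces. *)
Lemma cut_assoc (A : seq T -> seq T -> seq T -> K) w :
  \sum_(c <- cuts w) \sum_(d <- cuts c.1) A d.1 d.2 c.2
  = \sum_(c <- cuts w) \sum_(d <- cuts c.2) A c.1 d.1 d.2.
Proof.
elim: w A => [|a w IHw] A; first by rewrite /= !big_seq1.
rewrite (big_cuts_cons (fun x y => \sum_(d <- cuts x) A d.1 d.2 y)).
rewrite (big_cuts_cons (fun x y => \sum_(d <- cuts y) A x d.1 d.2)).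
under [X in _ + X = _]eq_bigr => c _ do
  rewrite (big_cuts_cons (fun x y => A x y c.2)).
rewrite big_split /= (IHw (fun x y z => A (a :: x) y z)) addrA big_seq1.
by rewrite (big_cuts_cons (A [::])).
Qed.

Lemma cmulA F G H : cmul (cmul F G) H =1 cmul F (cmul G H).
Proof.
move=> w; rewrite /cmul.
under eq_bigr => c _ do rewrite mulr_suml.
rewrite (cut_assoc (fun x y z => F x * G y * H z)).
by apply: eq_bigr => c _; rewrite mulr_sumr; apply: eq_bigr => d _; rewrite mulrA.
Qed.

Lemma cuts_size w c : c \in cuts w -> w = c.1 ++ c.2.
Proof.
elim: w c => [|a w IHw] c; first by rewrite inE => /eqP->.
rewrite /= inE => /orP[/eqP-> //|/mapP[d dw ->]] /=.
by rewrite -(IHw _ dw).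
Qed.

Lemma cuts_nth w : cuts w = [seq (take i w, drop i w) | i <- iota 0 (size w).+1].
Proof.
elim: w => [|a w IHw] //; rewrite [cuts _]/= IHw -map_comp.
rewrite (_ : iota 0 (size (a :: w)).+1 = 0%N :: iota (1 + 0) (size w).+1) //.
by rewrite iotaDl map_cons -map_comp drop0.
Qed.

Lemma eq_cmul F F' G G' : F =1 F' -> G =1 G' -> cmul F G =1 cmul F' G'.
Proof. by move=> FF GG w; apply: eq_bigr => c _; rewrite FF GG. Qed.

Lemma cmul_homogE d F G w : homog d F -> (d <= size w)%N ->
  cmul F G w = F (take d w) * G (drop d w).
Proof.
move=> hF dw; rewrite /cmul cuts_nth big_map.
rewrite (bigD1_seq d) ?iota_uniq ?mem_iota //.
rewrite big_seq_cond big1 => [|i]; first by rewrite /= addr0.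
rewrite mem_iota => /andP[iw id]; rewrite [_.1]/=.
by rewrite hF ?mul0r // size_takel.
Qed.

Lemma cmul_homog d e F G : homog d F -> homog e G -> homog (d + e)%N (cmul F G).
Proof.
move=> hF hG w wde; rewrite /cmul big1_seq // => c /andP[_ /cuts_size wE].
have [e1|] := eqVneq (size c.1) d; last by move/hF->; rewrite mul0r.
by rewrite hG ?mulr0 //; apply: contra wde => /eqP<-; rewrite wE size_cat e1.
Qed.

Lemma cone_homog : homog 0 cone.
Proof. by move=> w; rewrite size_eq0 /cone => /negPf->. Qed.

(** The coproduct is multiplicative and each factor contributes x tensor 1 + 1 tensor x, so each
    factor goes either to the left or to the right. *)
Lemma shuf_prodf (xs : seq fn) u v : (forall i, (i < size xs)%N -> primitive (nth cone xs i)) ->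
  \sum_(z <- shuf u v) prodf xs z
  = \sum_(c <- unshuf xs) prodf c.1 u * prodf c.2 v.
Proof.
elim: xs u v => [|x xs IHxs] u v Px.
  rewrite /= big_seq1 /cone /=; case: u => [|a u]; first by rewrite shufNl big_seq1 mul1r.
  rewrite mul0r big1_seq // => z /andP[_ /perm_shuf /perm_size].
  by case: z.
have [x0 Px0] : primitive x by apply: (Px 0%N).
have {}IHxs u' v' := IHxs u' v' (fun i => Px i.+1).
rewrite /= /cmul (cut_shuf (fun y z => x y * prodf xs z)).
rewrite big_cat !big_map /=.
transitivity (\sum_(c <- cuts u) \sum_(d <- cuts v)
   (\sum_(y <- shuf c.1 d.1) x y) * (\sum_(z <- shuf c.2 d.2) prodf xs z)).
  apply: eq_bigr => c _; apply: eq_bigr => d _; rewrite mulr_suml.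
  by apply: eq_bigr => y _; rewrite mulr_sumr.
(* The shuffle sum of [x] survives only if [c.1] or [d.1] is empty; if both are, both summands
   vanish by [x0]. *)
transitivity (\sum_(c <- cuts u) \sum_(d <- cuts v)
   ((d.1 == [::])%:R * x c.1 + (c.1 == [::])%:R * x d.1) * (\sum_(z <- shuf c.2 d.2) prodf xs z)).
  apply: eq_bigr => c _; apply: eq_bigr => d _; congr (_ * _).
  have [->|c0] := eqVneq c.1 [::].
    by rewrite shufNl big_seq1 x0 mulr0 add0r mul1r.
  rewrite mul0r addr0; have [->|d0] := eqVneq d.1 [::].
    by rewrite shufNr big_seq1 mul1r.
  by rewrite mul0r Px0.
have sumcuts (A : seq T -> seq T -> K) w :
    \sum_(c <- cuts w) (c.1 == [::])%:R * A c.1 c.2 = A [::] w.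
  case: w => [|a w] /=; first by rewrite big_seq1 mul1r.
  by rewrite big_cons big_map /= mul1r big1 ?addr0 // => c _; rewrite mul0r.
transitivity (\sum_(c <- cuts u) x c.1 * (\sum_(z <- shuf c.2 v) prodf xs z) +
    \sum_(d <- cuts v) x d.1 * (\sum_(z <- shuf u d.2) prodf xs z)).
  transitivity (\sum_(c <- cuts u) \sum_(d <- cuts v)
      (d.1 == [::])%:R * (x c.1 * \sum_(z <- shuf c.2 d.2) prodf xs z) +
    \sum_(d <- cuts v) \sum_(c <- cuts u)
      (c.1 == [::])%:R * (x d.1 * \sum_(z <- shuf c.2 d.2) prodf xs z)).
    rewrite [X in _ = _ + X]exchange_big -big_split; apply: eq_bigr => c _ /=.
    by rewrite -big_split; apply: eq_bigr => d _ /=; rewrite mulrDl !mulrA.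
  congr (_ + _); apply: eq_bigr => c _.
    by rewrite (sumcuts (fun _ d2 => x c.1 * \sum_(z <- shuf c.2 d2) prodf xs z)).
  by rewrite (sumcuts (fun _ c2 => x c.1 * \sum_(z <- shuf c2 c.2) prodf xs z)).
congr (_ + _).
  rewrite (eq_bigr (fun c => \sum_(e <- unshuf xs) x c.1 * (prodf e.1 c.2 * prodf e.2 v)));
    last by move=> c _; rewrite IHxs mulr_sumr.
  rewrite exchange_big /=; apply: eq_bigr => e _.
  by rewrite mulr_suml; apply: eq_bigr => c _; rewrite mulrA.
rewrite (eq_bigr (fun c => \sum_(e <- unshuf xs) x c.1 * (prodf e.1 u * prodf e.2 c.2)));
  last by move=> c _; rewrite IHxs mulr_sumr.
rewrite exchange_big /=; apply: eq_bigr => e _.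
by rewrite mulr_sumr; apply: eq_bigr => c _; rewrite mulrCA.
Qed.

End FormalSeries.

Section SeriesProducts.
Variables (K : comNzRingType) (T : eqType).
Local Notation fn := (seq T -> K).
Implicit Types (F G H : fn) (u v w : seq T).

Lemma cmul1 F : cmul F (@cone K T) =1 F.
Proof.
move=> w; rewrite /cmul; elim: w F => [|a w IHw] F.
  by rewrite big_seq1 mulr1.
rewrite (big_cuts_cons (fun x y => F x * cone _ y)) mulr0 add0r.
exact: (IHw (fun x => F (a :: x))).
Qed.

Lemma cmul1l F : cmul (@cone K T) F =1 F.
Proof.
move=> w; rewrite (@cmul_homogE _ _ 0) ?take0 ?drop0 ?mul1r //; exact: cone_homog.
Qed.

Lemma prodf_cat (xs ys : seq fn) : prodf (xs ++ ys) =1 cmul (prodf xs) (prodf ys).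
Proof.
elim: xs => [|x xs IHxs] w /=; first by rewrite cmul1l.
by rewrite cmulA; apply: eq_cmul.
Qed.

(** On two nonempty words the coproduct of FG takes a value symmetric in F and G, so it cancels in
    the commutator. *)
Lemma bracket_primitive F G : primitive F -> primitive G ->
  primitive (fun w => cmul F G w - cmul G F w).
Proof.
move=> PF PG; split.
  by rewrite /cmul /= !big_seq1 PF.1 PG.1 !mulr0 subrr.
have shuf2 F' G' u v : primitive F' -> primitive G' -> u != [::] -> v != [::] ->
   \sum_(z <- shuf u v) cmul F' G' z = F' u * G' v + G' u * F' v.
  move=> PF' PG' /negPf u0 /negPf v0.
  have eP : prodf [:: F'; G'] =1 cmul F' G'.
    by move=> w; apply: eq_cmul => // w'; rewrite cmul1.
  under eq_bigr do rewrite -eP.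
  rewrite (@shuf_prodf _ _ [:: F'; G']); last by case=> [|[|]].
  rewrite /= !big_cons big_nil /= !cmul1 /cone u0 v0 mulr0 mul0r add0r !addr0.
  by rewrite addrC.
move=> u v u0 v0; rewrite big_split sumrN /= !shuf2 //.
by rewrite [X in X - _]addrC subrr.
Qed.

(** * Action of Xi^s on products of homogeneous primitives *)

Section Family.
Variables (X : eqType) (ev : X -> fn) (deg : X -> nat).
Implicit Types (xs ys : seq X).

Definition prode xs := prodf (map ev xs).
Definition prim_family xs : Prop :=
  {in xs, forall x, primitive (ev x) /\ homog (deg x) (ev x)}.

Lemma prode_homog xs : prim_family xs -> homog (sumn (map deg xs)) (prode xs).
Proof.
elim: xs => [|x xs IHxs] Px; first exact: cone_homog.
apply: cmul_homog; first by have [] := Px x (mem_head _ _).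
by apply: IHxs => y yx; apply: Px; rewrite inE yx orbT.
Qed.

Lemma prim_family_sub xs ys : {subset ys <= xs} -> prim_family xs -> prim_family ys.
Proof. by move=> s Px y /s /Px. Qed.

Lemma unshuf_perm xs c : c \in unshuf xs -> perm_eq (c.1 ++ c.2) xs.
Proof.
elim: xs c => [|x xs IHxs] c; first by rewrite inE => /eqP->.
rewrite mem_cat => /orP[] /mapP[d /IHxs dx ->] /=; first by rewrite perm_cons.
by rewrite -[x :: d.2]cat1s perm_catCA /= perm_cons.
Qed.

Lemma unshuf_map (f : X -> fn) xs :
  unshuf (map f xs) = [seq (map f c.1, map f c.2) | c <- unshuf xs].
Proof. by elim: xs => //= x xs ->; rewrite map_cat -!map_comp. Qed.

Lemma shuf_prode xs u v : prim_family xs ->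
  \sum_(z <- shuf u v) prode xs z = \sum_(c <- unshuf xs) prode c.1 u * prode c.2 v.
Proof.
move=> Px; rewrite /prode shuf_prodf ?unshuf_map ?big_map // => i.
rewrite size_map => ix.
case: xs Px ix => // x0 xs Px ix; rewrite (nth_map x0) //.
by have [] := Px _ (mem_nth x0 ix).
Qed.

(** Iterate [shuf_prode] block by block; homogeneity discards every group whose total degree differs
    from the size of its block. *)
Lemma mshuf_act s xs w : prim_family xs -> size w = sumn s ->
  \sum_(z <- mshuf s w) prode xs z = \sum_(t <- act deg s xs) prode t w.
Proof.
elim: s xs w => [|m s IHs] xs w Px /= ws.
  move/size0nil: ws => ->; rewrite big_seq1; case: xs Px => [|x xs] Px.
    by rewrite big_seq1.
  (* No part is left for the remaining factors, and a primitive series vanishes on the empty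
     word. *)
  rewrite big_nil /prode /= /cmul /= big_seq1.
  by have [[-> _] _] := Px x (mem_head _ _); rewrite mul0r.
rewrite big_allpairs_dep /=.
transitivity (\sum_(c <- unshuf xs) prode c.1 (take m w) *
    \sum_(v <- mshuf s (drop m w)) prode c.2 v).
  under eq_bigr do rewrite shuf_prode //.
  by rewrite exchange_big; apply: eq_bigr => c _; rewrite mulr_sumr.
rewrite big_allpairs_dep /= big_filter [RHS]big_mkcond big_seq [RHS]big_seq.
apply: eq_bigr => c /unshuf_perm pc.
have P1 : prim_family c.1.
  by apply: prim_family_sub Px => y yc; rewrite -(perm_mem pc) mem_cat yc.
have P2 : prim_family c.2.
  by apply: prim_family_sub Px => y yc; rewrite -(perm_mem pc) mem_cat yc orbT.
have mw : (m <= size w)%N by rewrite ws leq_addr.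
have [cm|cm] := eqVneq; last first.
  by rewrite (prode_homog P1) ?mul0r // size_takel // eq_sym.
rewrite IHs ?size_drop ?ws ?addKn // mulr_sumr; apply: eq_bigr => t _.
rewrite [in RHS]/prode map_cat prodf_cat (cmul_homogE (d := m)) //.
by rewrite -cm; apply: prode_homog.
Qed.

Lemma act_perm s xs t : t \in act deg s xs -> perm_eq t xs.
Proof.
elim: s xs t => [|m s IHs] xs t /=; first by case: xs; rewrite ?inE // => /eqP->.
case/allpairsPdep=> c [z [+ zc ->]]; rewrite mem_filter => /andP[_ /unshuf_perm].
by apply: perm_trans; rewrite perm_cat2l; apply: IHs.
Qed.

(** A group of positive total degree is nonempty. *)
Lemma act_size s xs t : all (leq 1) s -> t \in act deg s xs -> (size s <= size t)%N.
Proof.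
elim: s xs t => [|m s IHs] xs t //= /andP[m0 s0].
case/allpairsPdep=> c [z [+ zc ->]]; rewrite mem_filter => /andP[/eqP cm _].
rewrite size_cat -add1n leq_add ?(IHs _ _ s0 zc) //.
by case: (c.1) cm => //= cm; rewrite -cm in m0.
Qed.

(** With as many factors as parts, all groups are singletons, so the degrees read [s] in order. *)
Lemma act_deg s xs t : all (leq 1) s -> t \in act deg s xs -> size t = size s ->
  map deg t = s.
Proof.
elim: s xs t => [|m s IHs] xs t /=; first by move=> _ _ /size0nil->.
case/andP=> m0 s0 /allpairsPdep[c [z [+ zc ->]]].
rewrite mem_filter => /andP[/eqP cm _].
have zs := act_size s0 zc.
case: (c.1) cm => [|x [|y c1]] //= cm; rewrite ?cm -?cm in m0 *.
- by [].
- by rewrite addn0 => -[/(IHs _ _ s0 zc) ->].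
by rewrite size_cat => -[zE]; move: zs; rewrite -zE ltnNge -[X in (X <= _)%N]add0n leq_add2r.
Qed.

Lemma unshuf_rem x xs : x \in xs -> exists c, [/\ c \in unshuf xs, c.1 = [:: x]
  & perm_eq xs (x :: c.2)].
Proof.
elim: xs => //= y xs IHxs; have nilxs zs : ([::], zs) \in unshuf zs.
  by elim: zs => //= z zs IHz; rewrite mem_cat; apply/orP; right; apply/mapP; exists ([::], zs).
have [<- _|yx] := eqVneq y x.
  exists ([:: y], xs); split=> //; rewrite mem_cat; apply/orP; left.
  by apply/mapP; exists ([::], xs); first exact: nilxs.
rewrite inE eq_sym (negPf yx) => /IHxs [c [cx c1 cp]].
exists (c.1, y :: c.2); split=> //.
  by rewrite mem_cat; apply/orP; right; apply/mapP; exists c.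
rewrite -(perm_cons y) in cp; apply: perm_trans cp _.
by rewrite (perm_catCA [:: y] [:: x]).
Qed.

(** Give each part in turn one factor of that degree. This later makes the leading scalars
    nonzero. *)
Lemma act_nonempty s xs : perm_eq (map deg xs) s -> exists t, t \in act deg s xs.
Proof.
elim: s xs => [|m s IHs] xs p.
  by case: xs p => [|x xs /perm_size//]; exists [::]; rewrite inE.
have /mapP[x xxs mx] : m \in map deg xs by rewrite (perm_mem p) mem_head.
have [c [cx c1 cp]] := unshuf_rem xxs.
have [|t tc] := IHs c.2.
  rewrite -(perm_cons m); apply: perm_trans p.
  by rewrite perm_sym mx -map_cons; apply: perm_map.
exists (c.1 ++ t); rewrite /=; apply/allpairsPdep; exists c, t; split=> //.
by rewrite mem_filter cx c1 /= addn0 mx eqxx.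
Qed.

End Family.
End SeriesProducts.

(** * Permutations as words *)

(** The condition on one-line words whose indicator function is Xi^s. *)
Fixpoint incr_blocks (s w : seq nat) : bool :=
  if s is m :: s' then sorted ltn (take m w) && incr_blocks s' (drop m w) else true.

Lemma eq_incr_blocks_map (T : eqType) (f g : T -> nat) s (w : seq T) :
  {in w &, forall x y, (f x < f y)%N = (g x < g y)%N} ->
  incr_blocks s (map f w) = incr_blocks s (map g w).
Proof.
elim: s w => //= m s IHs w fg; rewrite -!map_take -!map_drop; congr (_ && _).
  rewrite !sorted_map; apply: (eq_in_sorted (P := mem w)) => [x y xw yw|].
    exact: fg.
  by apply/allP => x /mem_take.
by apply: IHs => x y /mem_drop xw /mem_drop yw; apply: fg.
Qed.

(** Equality of standardizations, for words without repeated letters. *)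
Definition ordeq (w w' : seq nat) := size w = size w' /\
  forall i j, (i < size w)%N -> (j < size w)%N ->
    (nth 0 w i < nth 0 w j)%N = (nth 0 w' i < nth 0 w' j)%N.

Lemma ordeq_incr_blocks s w w' : ordeq w w' -> incr_blocks s w = incr_blocks s w'.
Proof.
case=> ws h; rewrite -(mkseq_nth 0%N w) -(mkseq_nth 0%N w') /mkseq -ws.
by apply: eq_incr_blocks_map => i j; rewrite !mem_iota; apply: h.
Qed.

(** The letters of [u] occur in [z] in the order of [u] iff [u] is the subword of [z] on these
    letters: a list is determined by its elements and a strict order for which it is sorted. *)
Lemma sorted_index (T : eqType) (z u : seq T) : uniq z -> uniq u -> {subset u <= z} ->
  sorted ltn (map (index^~ z) u) = (filter (mem u) z == u).
Proof.
move=> uz uu suz; rewrite sorted_map.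
have sz : sorted (relpre (index^~ z) ltn) (filter (mem u) z).
  apply: sorted_filter; first by move=> x y t /=; apply: ltn_trans.
  have zi : map (index^~ z) z = iota 0 (size z).
    apply: (@eq_from_nth _ 0%N); rewrite size_map ?size_iota // => i iz.
    case: z uz iz {suz} => // x0 z uz iz.
    by rewrite (nth_map x0) // nth_iota // index_uniq.
  by rewrite -sorted_map zi iota_ltn_sorted.
apply/idP/eqP => [su|<-//].
apply: (irr_sorted_eq (leT := relpre (index^~ z) ltn)) => //.
- by move=> x y t /=; apply: ltn_trans.
- by move=> x /=; apply: ltnn.
by move=> x; rewrite mem_filter; apply: andb_idr; apply: suz.
Qed.

Lemma index_filter_lt (T : eqType) (p : pred T) (z : seq T) x y : p x -> p y ->
  (index x (filter p z) < index y (filter p z))%N = (index x z < index y z)%N.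
Proof.
move=> px py; elim: z => //= a z IHz; case: (boolP (p a)) => pa /=.
  by case: (a == x); case: (a == y).
have [ax|_] := eqVneq a x; first by rewrite ax px in pa.
have [ay|_] := eqVneq a y; first by rewrite ay py in pa.
exact: IHz.
Qed.

Lemma perm_mshuf (T : eqType) s (w z : seq T) : z \in mshuf s w -> perm_eq z w.
Proof.
elim: s w z => [|m s IHs] w z /=; first by rewrite inE => /eqP->.
case/allpairsPdep=> v [z' [/IHs vw /perm_shuf zz ->]].
by apply: perm_trans zz _; rewrite -[X in perm_eq _ X](cat_take_drop m) perm_cat2l.
Qed.

Lemma take_pred (T : eqType) m (w : seq T) : uniq w ->
  all (mem (take m w)) (take m w) /\ all (predC (mem (take m w))) (drop m w).
Proof.
move=> uw; split; first exact/allP.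
apply/allP => x xd /=; move: uw; rewrite -{1}(cat_take_drop m w) cat_uniq.
by case/and3P=> _ /hasPn/(_ x xd).
Qed.

Lemma uniq_mshuf (T : eqType) s (w : seq T) : uniq w -> uniq (mshuf s w).
Proof.
elim: s w => [|m s IHs] w uw //=.
have [pu pv] := take_pred m uw.
have pv' v : v \in mshuf s (drop m w) -> all (predC (mem (take m w))) v.
  by move/perm_mshuf/perm_all->.
apply: allpairs_uniq_dep; first exact/IHs/drop_uniq.
  by move=> v /pv' pv'v; apply: (uniq_shuf pu pv'v).
move=> [v1 z1] [v2 z2] /allpairsPdep[v1' [z1' [v1s z1s [e1 e1']]]].
move=> /allpairsPdep[v2' [z2' [v2s z2s [e2 e2']]]] /= zz.
(* Erasing the letters of the first block from a shuffle recovers the shuffle of the remaining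
   blocks. *)
have h v z : v \in mshuf s (drop m w) -> z \in shuf (take m w) v ->
   filter (predC (mem (take m w))) z = v.
  by move=> /pv' pv'v; rewrite (mem_shuf _ pu pv'v) => /andP[_ /eqP].
congr (existT _ _ _); last by [].
by rewrite e1 e2 -(h _ _ v1s z1s) -(h _ _ v2s z2s); congr filter; congruence.
Qed.

(** [z] is a shuffle of the blocks of [w] iff the letters of each block keep their order in [z],
    i.e. their positions in [z] increase along the block. *)
Lemma mem_mshuf (T : eqType) s (w z : seq T) : uniq w -> perm_eq z w ->
  size w = sumn s -> incr_blocks s (map (index^~ z) w) = (z \in mshuf s w).
Proof.
elim: s w z => [|m s IHs] w z uw pz /= ws.
  move/size0nil: ws pz => -> /perm_size/size0nil->; by rewrite inE.
have mw : (m <= size w)%N by rewrite ws leq_addr.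
set u := take m w; set v := drop m w.
have [pu pv] := take_pred m uw; rewrite -/u -/v in pu pv.
have uu : uniq u by apply: take_uniq.
have uv : uniq v by apply: drop_uniq.
have uz : uniq z by rewrite (perm_uniq pz).
have suz : {subset u <= z} by move=> x /mem_take; rewrite (perm_mem pz).
pose z' := filter (predC (mem u)) z.
have pz' : perm_eq z' v.
  apply: uniq_perm => // [|x]; first exact: filter_uniq.
  rewrite mem_filter (perm_mem pz) -(cat_take_drop m w) mem_cat /= -/u -/v.
  have [xu|//] := boolP (x \in u); rewrite /=; apply/esym/negP => /(allP pv) /=.
  by rewrite xu.
rewrite -map_take -map_drop sorted_index // -/u -/v.
have -> : incr_blocks s (map (index^~ z) v) = incr_blocks s (map (index^~ z') v).
  apply: eq_incr_blocks_map => x y /(allP pv) /= xu /(allP pv) /= yu.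
  by rewrite index_filter_lt.
rewrite IHs // ?size_drop ?ws ?addKn //.
apply/andP/allpairsPdep => [[/eqP zu zs]|[v' [z'' [v's zs zE]]]].
  exists z', z; split=> //.
  by rewrite (mem_shuf _ pu) ?zu ?eqxx //= (perm_all _ (perm_mshuf zs)).
have pv' : all (predC (mem u)) v' by rewrite (perm_all _ (perm_mshuf v's)).
by move: zs; rewrite -zE (mem_shuf _ pu pv') => /andP[/eqP-> /eqP zv]; rewrite /z' zv.
Qed.

Section Words.
Variable n : nat.
Implicit Types (g h k : 'S_n).

Definition word g : seq nat := [seq val (g i) | i <- enum 'I_n].

Lemma size_word g : size (word g) = n.
Proof. by rewrite size_map size_enum_ord. Qed.

Lemma nth_word g (i : 'I_n) : nth 0%N (word g) i = g i.
Proof. by rewrite (nth_map i) ?size_enum_ord // nth_ord_enum. Qed.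

Lemma word_inj : injective word.
Proof.
by move=> g h gh; apply/permP => i; apply: val_inj; rewrite /= -!nth_word gh.
Qed.

Lemma word_uniq g : uniq (word g).
Proof. by rewrite map_inj_uniq ?enum_uniq // => i j /val_inj/perm_inj. Qed.

Lemma mem_word g x : (x \in word g) = (x < n)%N.
Proof.
apply/mapP/idP => [[i _ ->]|xn]; first exact: ltn_ord.
exists ((g^-1)%g (Ordinal xn)).
  by rewrite mem_enum.
by rewrite permKV.
Qed.

Lemma index_word g k i : index (val (g i)) (word k) = (g * k^-1)%g i.
Proof.
rewrite permM; set j := (k^-1)%g (g i).
have -> : g i = k j by rewrite permKV.
by rewrite /= -(nth_word k j) index_uniq ?size_word ?word_uniq.
Qed.

Lemma word_mulV g k : word (g * k^-1)%g = map (index^~ (word k)) (word g).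
Proof. by rewrite -map_comp; apply: eq_map => i; rewrite /= index_word. Qed.

Lemma exists_word (z : seq nat) : perm_eq z (iota 0 n) -> exists k, word k = z.
Proof.
move=> pz; have sz : size z = n by rewrite (perm_size pz) size_iota.
have uz : uniq z by rewrite (perm_uniq pz) iota_uniq.
have zn (i : 'I_n) : (nth 0%N z i < n)%N.
  have : nth 0%N z i \in z by rewrite mem_nth // sz.
  by rewrite (perm_mem pz) mem_iota.
have f_inj : injective (fun i => Ordinal (zn i)).
  move=> i j [/eqP]; rewrite nth_uniq ?sz // => /eqP; exact: val_inj.
exists (perm f_inj); apply: (@eq_from_nth _ 0%N); rewrite size_word ?sz // => i i_n.
by rewrite (nth_word _ (Ordinal i_n)) permE.
Qed.

Lemma word_perm_iota g : perm_eq (word g) (iota 0 n).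
Proof.
apply: uniq_perm; rewrite ?word_uniq ?iota_uniq // => x.
by rewrite mem_word mem_iota.
Qed.

Lemma exists_standard (w : seq nat) : uniq w -> size w = n ->
  exists g, ordeq (word g) w.
Proof.
move=> uw sw; have rn (i : 'I_n) : (index (nth 0%N w i) (sort leq w) < n)%N.
  by rewrite -[X in (_ < X)%N]sw -(size_sort leq) index_mem mem_sort mem_nth ?sw.
have iw x : (x < n)%N -> nth 0%N w x \in sort leq w.
  by move=> xn; rewrite mem_sort mem_nth ?sw.
have r_inj : injective (fun i => Ordinal (rn i)).
  move=> i j /(congr1 val) /= e; have {}e := @index_inj _ 0%N _ _ _ (iw _ (ltn_ord i)) (iw _ (ltn_ord j)) e.
  by apply/val_inj/eqP; rewrite -(nth_uniq 0%N _ _ uw) ?sw ?e ?eqxx ?ltn_ord.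
have ile x y : (x < n)%N -> (y < n)%N ->
    (index (nth 0 w x) (sort leq w) <= index (nth 0 w y) (sort leq w))%N ->
    (nth 0 w x <= nth 0 w y)%N.
  move=> xn yn; apply: (sorted_leq_index leq_trans leqnn) (iw _ xn) (iw _ yn).
  exact: (sort_sorted leq_total).
exists (perm r_inj); split; first by rewrite size_word.
move=> i j; rewrite size_word => i_n j_n.
rewrite (nth_word _ (Ordinal i_n)) (nth_word _ (Ordinal j_n)) !permE /=.
rewrite !ltnNge; congr negb; apply/idP/idP => [|ab]; first exact: ile.
rewrite leqNgt; apply/negP => ba.
have /(ile _ _ i_n j_n) ba' := ltnW ba.
have /eqP : nth 0%N w i = nth 0%N w j by apply/eqP; rewrite eqn_leq ba' ab.
by rewrite nth_uniq ?sw // => /eqP ij; rewrite ij ltnn in ba.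
Qed.

Lemma ordeq_sym w w' : ordeq w w' -> ordeq w' w.
Proof. by case=> s h; split=> // i j; rewrite -s => i_n j_n; rewrite h. Qed.

Lemma ordeq_trans w w' w'' : ordeq w w' -> ordeq w' w'' -> ordeq w w''.
Proof.
by case=> s h [s' h']; split=> [|i j i_n j_n]; rewrite ?s // h // h' -?s.
Qed.

Lemma ordeq_word g h : ordeq (word g) (word h) -> g = h.
Proof.
case=> _ gh; apply/permP => i; apply: val_inj.
(* The order of the values recovers the permutation: a value is the number of smaller ones. *)
have valE (f : 'S_n) : val (f i) = #|[set j | (f j < f i)%N]|.
  transitivity #|[set k : 'I_n | (k < f i)%N]|.
    rewrite -sum1dep_card -(big_ord_widen n (fun=> 1%N)) 1?ltnW //.
    by rewrite sum1_card card_ord.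
  rewrite -[LHS](card_preimset _ (@perm_inj _ f)).
  by apply: eq_card => j; rewrite !inE.
rewrite [LHS]valE [RHS]valE; apply: eq_card => j; rewrite !inE.
by have := gh j i; rewrite size_word !nth_word => ->.
Qed.

End Words.

Lemma scanl_ge x q i : i \in scanl addn x q -> (x <= i)%N.
Proof.
elim: q x => //= m q IHq x; rewrite inE => /orP[/eqP->|/IHq]; first exact: leq_addr.
by apply: leq_trans; apply: leq_addr.
Qed.

(** An ascent is required exactly at the places that are not partial sums of [q]; the offset [x]
    makes the induction go through. *)
Lemma incr_blocks_scanl x q w : all (leq 1) q -> size w = sumn q ->
  incr_blocks q w <-> (forall i, (0 < i < size w)%N -> (x + i)%N \notin scanl addn x q ->
    (nth 0 w i.-1 < nth 0 w i)%N).
Proof.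
elim: q x w => [|m q IHq] x w /=.
  by move=> _ ->; split=> // _ i; rewrite ltn0 andbF.
case/andP=> m0 q0 ws; have mw : (m <= size w)%N by rewrite ws leq_addr.
have sd : size (drop m w) = sumn q by rewrite size_drop ws addKn.
have {IHq} IHq := IHq (x + m)%N _ q0 sd.
split=> [/andP[st /IHq bd] i /andP[i0 iw]|H].
  rewrite inE eqn_add2l negb_or => /andP[im ix].
  have [lti|gti|im'] := ltngtP i m; last by rewrite im' eqxx in im.
    have := sortedP 0%N st i.-1; rewrite size_takel // prednK // => /(_ lti).
    by rewrite !nth_take // (leq_ltn_trans (leq_pred i)).
  have := bd (i - m)%N; rewrite size_drop subn_gt0 gti ltn_sub2r //; last exact: ltn_trans iw.
  rewrite -addnA subnKC ?(ltnW gti) // => /(_ isT ix); rewrite !nth_drop subnKC ?(ltnW gti) //.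
  by rewrite -subn1 addnBA ?subn_gt0 // subnKC ?(ltnW gti) // subn1.
apply/andP; split.
  apply/(sortedP 0%N) => i; rewrite size_takel // => im.
  rewrite !nth_take //; last exact: ltnW.
  apply: (H i.+1); first by rewrite /= (leq_trans im).
  rewrite inE eqn_add2l negb_or (ltn_eqF im) /=; apply/negP => /scanl_ge.
  by rewrite leq_add2l leqNgt im.
apply/IHq => i /andP[i0 id] ix; rewrite !nth_drop.
have miw : (0 < m + i < size w)%N.
  by rewrite addn_gt0 i0 orbT -(subnKC mw) ltn_add2l -size_drop.
have nin : (x + (m + i))%N \notin (x + m)%N :: scanl addn (x + m) q.
  rewrite addnA inE negb_or ix andbT -[X in _ == X]addn0 eqn_add2l.
  by rewrite gtn_eqF.
have := H _ miw nin; case: i i0 {id ix miw nin} => // i _.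
by rewrite !addnS.
Qed.

(** * Left multiplication by Xi^s as summation over shuffles *)

Section Action.
Variable K : fieldType.
Variable n : nat.
Implicit Types (g h k : 'S_n) (s q : seq nat).

Definition toKS (F : seq nat -> K) : grpalg K 'S_n := [ffun g => F (word g)].

Lemma comp_sumn q : q \in compositions n -> sumn q = n.
Proof. by rewrite mem_compositions => /andP[_ /eqP]. Qed.

Lemma comp_pos q : q \in compositions n -> all (leq 1) q.
Proof. by rewrite mem_compositions => /andP[]. Qed.

Lemma Xi_incr_blocks q g : q \in compositions n -> Xi K n q g = (incr_blocks q (word g))%:R.
Proof.
move=> qn; rewrite Xi_setE; congr (nat_of_bool _)%:R.
have sw : size (word g) = sumn q by rewrite size_word (comp_sumn qn).
apply/idP/idP => [/subsetP D|/(incr_blocks_scanl 0 (comp_pos qn) sw) B].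
  apply/(incr_blocks_scanl 0 (comp_pos qn) sw) => i; rewrite size_word => /andP[i0 i_n] iq.
  have i1n : (i.-1 < n)%N by apply: leq_ltn_trans i_n; apply: leq_pred.
  rewrite (nth_word g (Ordinal i_n)) (nth_word g (Ordinal i1n)).
  have := D (Ordinal i_n); rewrite !inE (negPf iq) => H.
  rewrite ltnNge leq_eqVlt negb_or; apply/andP; split.
    apply/eqP => /val_inj/perm_inj/(congr1 val) /= ii.
    by move/eqP: ii; rewrite -(prednK i0) eqn_leq ltnn.
  apply/negP => gi; suff: false by [].
  by apply: H; apply/existsP; exists (Ordinal i1n); rewrite /= prednK ?eqxx.
apply/subsetP => i; rewrite !inE => /existsP[j /andP[/eqP ji gij]].
apply: contraLR gij => iq; rewrite -leqNgt ltnW //.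
have i0 : (0 < i)%N by rewrite -ji.
have := B i; rewrite size_word ltn_ord i0 => /(_ isT iq).
by rewrite nth_word -{1}ji /= nth_word.
Qed.

Lemma Xi_mul s F g : s \in compositions n ->
  (Xi K n s * toKS F) g = \sum_(z <- mshuf s (word g)) F z.
Proof.
move=> sn; have sw : size (word g) = sumn s by rewrite size_word (comp_sumn sn).
transitivity (\sum_(k : 'S_n) (word k \in mshuf s (word g))%:R * F (word k)).
  (* With h = g k^-1 the second factor of the convolution is evaluated at k, and [word h] lists the
     positions in [word k] of the letters of [word g]. *)
  rewrite [LHS]ffunE (reindex_inj (h := fun k => (g * k^-1)%g)).
    apply: eq_bigr => k _; rewrite Xi_incr_blocks // ffunE invMg invgK mulgKV word_mulV.
    rewrite mem_mshuf ?word_uniq //.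
    by apply: perm_trans (word_perm_iota _) _; rewrite perm_sym word_perm_iota.
  by move=> k k' /mulgI/invg_inj.
have uL := uniq_mshuf s (word_uniq g).
transitivity (\sum_(z <- mshuf s (word g)) \sum_(k : 'S_n) (word k == z)%:R * F z).
  rewrite exchange_big; apply: eq_bigr => k _ /=.
  have [kL|kL] := boolP (_ \in _).
    rewrite (bigD1_seq (word k)) //= eqxx big1 ?addr0 // => z /negPf.
    by rewrite eq_sym => ->; rewrite mul0r.
  rewrite mul0r big1_seq // => z /andP[_ zL]; case: eqP => [zk|]; last by rewrite mul0r.
  by rewrite zk zL in kL.
apply: eq_big_seq => z zL.
have [k0 <-] : exists k, word k = z.
  by apply: exists_word; apply: perm_trans (perm_mshuf zL) (word_perm_iota g).
rewrite (bigD1 k0) //= eqxx mul1r big1 ?addr0 // => k kk.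
by rewrite (inj_eq (@word_inj n)) (negPf kk) mul0r.
Qed.

Lemma Xi_mul_prode (X : eqType) (ev : X -> seq nat -> K) deg s xs :
  s \in compositions n -> prim_family ev deg xs ->
  Xi K n s * toKS (prode ev xs) = \sum_(t <- act deg s xs) toKS (prode ev t).
Proof.
move=> sn Px; apply/ffunP => g; rewrite Xi_mul // (mshuf_act Px); last first.
  by rewrite size_word (comp_sumn sn).
by rewrite sum_ffunE; apply: eq_bigr => t _; rewrite ffunE.
Qed.

End Action.

(** * The Dynkin operator *)

Section Valley.
Variable K : comNzRingType.
Implicit Types (w A : seq nat).

(* omega_n is, up to relabelling, the bracket of all letters taken in increasing
   order: its signed terms are the words decreasing to the least letter and then
   increasing, i.e. those obtained by adding the letters at either end. *)
Definition valley k w := sorted gtn (take k.+1 w) && sorted ltn (drop k w).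
Definition valley_sign w : K := \sum_(k < size w) (-1) ^+ k * (valley k w)%:R.

Let gtn_trans : transitive gtn. Proof. by move=> x y z /= xy zx; apply: ltn_trans xy. Qed.

(** This lemma and the next two treat the places of the largest letter [x]. At the right end it
    leaves the bottom of the valley in place; at the left end it shifts the bottom by one and flips
    the sign; strictly inside, no valley can contain it. *)
Lemma valley_sign_rcons x w : w != [::] -> all (ltn^~ x) w ->
  valley_sign (rcons w x) = valley_sign w.
Proof.
move=> w0 wx; rewrite /valley_sign size_rcons big_ord_recr /=.
rewrite [X in _ + X](_ : _ = 0) ?addr0.
  apply: eq_bigr => k _; congr (_ * (nat_of_bool _)%:R); congr (_ && _).
    by rewrite -cats1 takel_cat.
  rewrite drop_rcons; last exact: ltnW.
  rewrite !(sorted_pairwise ltn_trans) pairwise_rcons andbC.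
  by rewrite (_ : all _ _ = true) ?andbT //; apply/allP => y /mem_drop /(allP wx).
rewrite /valley take_oversize ?size_rcons // (sorted_pairwise gtn_trans) pairwise_rcons.
case: w w0 wx => //= a w _ /andP[ax _].
by rewrite (ltnNge x) (ltnW ax) /= mulr0.
Qed.

Lemma valley_sign_cons x w : w != [::] -> all (ltn^~ x) w ->
  valley_sign (x :: w) = - valley_sign w.
Proof.
move=> w0 wx; rewrite /valley_sign big_ord_recl /=.
rewrite [X in X + _](_ : _ = 0) ?add0r.
  rewrite -sumrN; apply: eq_bigr => k _; rewrite -mulNr exprS mulN1r.
  congr (_ * (nat_of_bool _)%:R); rewrite /bump add1n /valley /=; congr (_ && _).
  rewrite -[LHS]/(sorted gtn (x :: take k.+1 w)) !(sorted_pairwise gtn_trans) /=.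
  by rewrite (_ : all _ _ = true) //; apply/allP => y /mem_take /(allP wx).
rewrite /valley /=; case: w w0 wx => //= a w _ /andP[ax _].
by rewrite ltnNge (ltnW ax) mulr0.
Qed.

Lemma valley_sign_mid x w1 w2 : w1 != [::] -> w2 != [::] ->
  all (ltn^~ x) w1 -> all (ltn^~ x) w2 -> valley_sign (w1 ++ x :: w2) = 0.
Proof.
move=> w10 w20 w1x w2x; rewrite /valley_sign big1 // => -[k /= _] _.
rewrite (_ : valley k _ = false) ?mulr0 //; apply/negP => /andP[].
rewrite (sorted_pairwise gtn_trans) (sorted_pairwise ltn_trans).
have [kw|kw] := leqP (size w1) k.
  rewrite take_cat ltnNge ltnW ?ltnS //= subSn //=.
  case: w1 w10 w1x {kw} => //= a w1 _ /andP[ax _] /andP[+ _] _.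
  by rewrite all_cat /= andbCA => /andP[+ _]; rewrite ltnNge (ltnW ax).
move=> _; rewrite drop_cat kw pairwise_cat => /and3P[_ _].
case: w2 w20 w2x => //= b w2 _ /andP[bx _] /andP[/andP[+ _] _].
by rewrite ltnNge (ltnW bx).
Qed.

Definition letter (x : nat) (w : seq nat) : K := (w == [:: x])%:R.

(** The left-normed bracket whose outermost entry is the head of [A]: for decreasing [A] the largest
    letter is added last, as in the recursion for valleys. *)
Fixpoint lie_bracket A : seq nat -> K :=
  match A with
  | [::] => fun=> 0
  | [:: x] => letter x
  | x :: A' => fun w => cmul (lie_bracket A') (letter x) w
                        - cmul (letter x) (lie_bracket A') w
  end.

Lemma letter_homog x : homog 1 (letter x).
Proof. by move=> w sw; rewrite /letter; case: (w =P _) sw => // ->. Qed.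

Lemma letter_primitive x : primitive (letter x).
Proof.
split=> // u v u0 v0; rewrite big1_seq // => z /andP[_ /perm_shuf/perm_size].
rewrite size_cat => sz; rewrite letter_homog // sz.
by case: u u0 {sz} => // a u _; case: v v0 => //= b v _; rewrite addnS.
Qed.

Lemma lie_bracket_homog A : homog (size A) (lie_bracket A).
Proof.
elim: A => [|x A IHA]; first by move=> w _.
case: A IHA => [|y A] IHA; first exact: letter_homog.
move=> w sw; rewrite -[lie_bracket _ w]/(cmul (lie_bracket (y :: A)) (letter x) w
                        - cmul (letter x) (lie_bracket (y :: A)) w).
have cl : cmul (lie_bracket (y :: A)) (letter x) w = 0.
  apply: (cmul_homog IHA (@letter_homog x)).
by rewrite addn1.
by rewrite cl (cmul_homog (@letter_homog x) IHA) ?add1n ?subrr.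
Qed.

Lemma lie_bracket_primitive A : primitive (lie_bracket A).
Proof.
elim: A => [|x A IHA]; first by split=> // u v _ _; rewrite big1.
case: A IHA => [|y A] IHA; first exact: letter_primitive.
exact: (bracket_primitive IHA (letter_primitive x)).
Qed.

(** Compare by the place of the largest letter [x]: only the term with [x] on the right sees a final
    [x], only the negative term an initial one, and neither sees an inner one. *)
Lemma valley_sign_bracket A w : sorted gtn A -> A != [::] -> perm_eq w A ->
  valley_sign w = lie_bracket A w.
Proof.
elim: A w => // x [_|y A IHA] w sA _ pw.
  have -> : w = [:: x] by apply: perm_small_eq pw.
  by rewrite /valley_sign big_ord1 /= /letter eqxx mulr1.
set A' := y :: A in IHA sA pw *.
have xA : all (ltn^~ x) A'.
  by move: sA; rewrite (sorted_pairwise gtn_trans) => /andP[].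
have sA' : sorted gtn A' by apply: path_sorted sA.
have {}IHA := IHA _ sA' isT.
have xw : x \in w by rewrite (perm_mem pw) mem_head.
rewrite -[lie_bracket _ w]/(cmul (lie_bracket A') (letter x) w
                        - cmul (letter x) (lie_bracket A') w).
have sw : size w = (size A').+1 by rewrite (perm_size pw).
rewrite (cmul_homogE _ (@lie_bracket_homog A')) ?sw //.
rewrite (cmul_homogE _ (@letter_homog x)) ?sw //.
have uw : uniq w.
  by rewrite (perm_uniq pw); apply: sorted_uniq sA => // z; apply: ltnn.
case/splitPr: xw pw sw uw => w1 w2 pw sw uw.
have pw' : perm_eq (w1 ++ w2) A'.
  rewrite -(perm_cons x); apply: perm_trans pw.
  by rewrite -[x :: w2]cat1s perm_sym perm_catCA.
have w1x : all (ltn^~ x) w1.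
  by apply/allP => z zw; apply: (allP xA); rewrite -(perm_mem pw') mem_cat zw.
have w2x : all (ltn^~ x) w2.
  by apply/allP => z zw; apply: (allP xA); rewrite -(perm_mem pw') mem_cat zw orbT.
have [w20|w20] := eqVneq w2 [::].
  rewrite w20 cats0 in pw' sw *; rewrite cats1 in sw *.
  have sw1 : size w1 = size A' by rewrite (perm_size pw').
  have w10 : w1 != [::] by case: w1 sw1 {w1x uw pw pw' sw}.
  rewrite valley_sign_rcons // -sw1 -cats1 take_size_cat // drop_size_cat //.
  rewrite /letter eqxx mulr1 IHA //; case: w1 w10 w1x {uw pw pw' sw sw1} => //= a w1 _ /andP[ax _].
  by rewrite take0 eqseq_cons (ltn_eqF ax) /= mul0r subr0.
have [w10|w10] := eqVneq w1 [::].
  rewrite w10 /= in pw' *; rewrite valley_sign_cons // take0 drop0 /letter eqxx mul1r.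
  rewrite IHA // (_ : (drop _ _ == _) = false) ?mulr0 ?sub0r //.
  apply/negP => /eqP dx; have := mem_head x [::]; rewrite -dx /A' /=.
  by move/mem_drop/(allP w2x); rewrite /= ltnn.
rewrite valley_sign_mid // /letter.
rewrite (_ : (drop _ _ == _) = false); last first.
  rewrite -(perm_size pw') size_cat.
  apply/negP => /eqP dx.
  have s2 : (0 < size w2)%N by case: w2 w20 {pw sw uw pw' w2x dx}.
  have : x \in drop (size w1 + size w2) (w1 ++ x :: w2) by rewrite dx mem_head.
  rewrite drop_cat ltnNge leq_addr /= addKn; case: (size w2) s2 => // k _ /=.
  by move/mem_drop/(allP w2x); rewrite /= ltnn.
rewrite (_ : (take _ _ == _) = false) ?mul0r ?mulr0 ?subr0 //.
by case: w1 w10 w1x {uw pw pw' sw} => //= a w1 _ /andP[ax _]; rewrite eqseq_cons (ltn_eqF ax).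
Qed.

(** All shuffles rearrange one decreasing word, on whose rearrangements the valley sign is a single
    Lie bracket. *)
Lemma valley_sign_shuf u v : uniq (u ++ v) -> u != [::] -> v != [::] ->
  \sum_(z <- shuf u v) valley_sign z = 0.
Proof.
move=> uuv u0 v0; pose A := rev (sort leq (u ++ v)).
have pA : perm_eq A (u ++ v) by rewrite perm_rev perm_sort.
have sA : sorted gtn A.
  rewrite rev_sorted -[sorted _ _]/(sorted ltn (sort leq (u ++ v))).
  rewrite ltn_sorted_uniq_leq sort_uniq uuv.
  exact: (sort_sorted leq_total).
have A0 : A != [::].
  by rewrite -size_eq0 (perm_size pA) size_cat addn_eq0 size_eq0 (negPf u0).
rewrite (eq_big_seq (lie_bracket A)); first exact: (lie_bracket_primitive A).2.
move=> z /perm_shuf pz; apply: valley_sign_bracket => //.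
by apply: perm_trans pz _; rewrite perm_sym.
Qed.

End Valley.

Lemma mshuf2 (T : eqType) a b (w : seq T) : size w = (a + b)%N ->
  mshuf [:: a; b] w = shuf (take a w) (drop a w).
Proof.
move=> sw; have sd : size (drop a w) = b by rewrite size_drop sw addKn.
rewrite [LHS]/= (drop_oversize (n := b)) ?sd // shufNr /= !cats0.
by rewrite (take_oversize (n := b)) ?sd // map_id.
Qed.

(** * Standardization *)

Section Standardize.
Variable K : fieldType.

Lemma Delta_setE n (D : {set 'I_n}) (g : 'S_n) :
  Delta_set K D g = (Des g == D)%:R.
Proof.
rewrite sum_ffunE; case: eqP => [gE | gE].
  rewrite (bigD1 g) ?gE //= ffunE eqxx big1 ?addr0 // => u /andP[_ ug].
  by rewrite ffunE eq_sym (negPf ug).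
rewrite big1 // => u /eqP uE; rewrite ffunE; case: eqP => // gu.
by case: gE; rewrite gu.
Qed.

Lemma Des_nth n (g : 'S_n) (i : 'I_n) :
  (i \in Des g) = (0 < i)%N && (nth 0 (word g) i < nth 0 (word g) i.-1)%N.
Proof.
rewrite inE; apply/existsP/andP => [[j /andP[/eqP ji gij]]|[i0 gi]].
  by rewrite nth_word -ji /= nth_word.
have i1n : (i.-1 < n)%N by apply: leq_ltn_trans (ltn_ord i); apply: leq_pred.
exists (Ordinal i1n); rewrite /= prednK // eqxx /=.
by move: gi; rewrite nth_word (nth_word g (Ordinal i1n)).
Qed.

(** The partial sums below n are 1, ..., k: the values fall up to the 0-based place k and rise
    afterwards. *)
Lemma Des_valley n k (g : 'S_n) : (k < n)%N ->
  (Des g == comp_set n (rcons (nseq k 1%N) (n - k)%N)) = valley k (word g).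
Proof.
move=> kn; have scE x : scanl addn x (rcons (nseq k 1%N) (n - k)%N)
    = rcons (iota x.+1 k) (x + k + (n - k))%N.
  elim: k {kn} x (n - k)%N => [|k IHk] x d /=; first by rewrite addn0.
  by rewrite addn1 IHk addSnnS.
have csE (i : 'I_n) : (i \in comp_set n (rcons (nseq k 1%N) (n - k)%N)) = (0 < i <= k)%N.
  rewrite inE scE mem_rcons inE mem_iota add0n subnKC ?(ltnW kn) //.
  by rewrite (ltn_eqF (ltn_ord i)) /= add1n ltnS.
have ltN i : (i.+1 < n)%N -> (nth 0 (word g) i < nth 0 (word g) i.+1)%N
    = ~~ (nth 0 (word g) i.+1 < nth 0 (word g) i)%N.
  move=> i_n; have := nth_uniq 0%N (i := i) (j := i.+1) _ _ (word_uniq g).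
  rewrite size_word => /(_ (ltnW i_n) i_n); rewrite (ltn_eqF (ltnSn i)).
  by case: ltngtP.
apply/eqP/andP => [DE|[/(sortedP 0%N) s1 /(sortedP 0%N) s2]].
  have H i : (0 < i < n)%N -> (nth 0 (word g) i < nth 0 (word g) i.-1)%N = (i <= k)%N.
    case/andP=> i0 i_n; have := csE (Ordinal i_n).
    by rewrite -DE Des_nth /= i0.
  split; apply/(sortedP 0%N) => i.
    rewrite size_takel ?size_word // => ik.
    rewrite !nth_take //=; last exact: ltnW.
    by rewrite (H i.+1) // ltn0Sn /= (leq_trans ik).
  rewrite size_drop size_word ltn_subRL => kin; rewrite !nth_drop.
  have := H (k + i.+1)%N; rewrite addnS /= -addnS kin => /(_ isT).
  by rewrite [RHS]leqNgt addnS ltnS leq_addr /= => /negbT; rewrite -ltN // -addnS.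
apply/setP => i; rewrite csE Des_nth; case: (posnP i) => //= i0.
have i1n : (i.-1.+1 < n)%N by rewrite prednK.
have [ik|ki] := leqP i k.
  have := s1 i.-1; rewrite size_takel ?size_word // prednK // => /(_ ik) /=.
  have ik1 : (i.-1 < k.+1)%N by rewrite prednK // ltnW.
  by rewrite (nth_take _ ik1) (nth_take _ (ik : (i < k.+1)%N)).
have := s2 (i.-1 - k)%N; rewrite size_drop size_word !nth_drop.
have ki1 : (k <= i.-1)%N by rewrite -ltnS prednK.
rewrite -subSn // prednK // ltn_sub2r // => /(_ isT).
have := ltN i.-1; rewrite prednK // => /(_ (ltn_ord i)) E.
  by rewrite !subnKC ?(ltnW ki) // /ltn /= E => /negPf.
Qed.

Lemma omegaE n : omega K n = toKS n (valley_sign K).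
Proof.
apply/ffunP => g; rewrite sum_ffunE ffunE /valley_sign size_word.
by apply: eq_bigr => k _; rewrite ffunE Delta_setE Des_valley.
Qed.

Definition ordeqb (w w' : seq nat) := (size w == size w') &&
  all (fun i => all (fun j =>
    (nth 0 w i < nth 0 w j)%N == (nth 0 w' i < nth 0 w' j)%N) (iota 0 (size w)))
    (iota 0 (size w)).

Lemma ordeqP w w' : reflect (ordeq w w') (ordeqb w w').
Proof.
apply: (iffP andP) => [[/eqP ww /allP h]|[ww h]].
  split=> // i j i_n j_n.
  have := h i; rewrite mem_iota => /(_ i_n)/allP/(_ j).
  by rewrite mem_iota => /(_ j_n)/eqP.
split; first exact/eqP.
apply/allP => i; rewrite mem_iota => i_n; apply/allP => j.
by rewrite mem_iota => j_n; rewrite h.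
Qed.

(* The coefficient of the standardization of w, or 0 when w has repeated letters
   or the wrong length. *)
Definition ext n (a : grpalg K 'S_n) (w : seq nat) : K :=
  if uniq w then \sum_(g : 'S_n | ordeqb (word g) w) a g else 0.

Lemma ext_ordeq n (a : grpalg K 'S_n) g w : uniq w -> ordeq (word g) w -> ext a w = a g.
Proof.
move=> uw gw; rewrite /ext uw (big_pred1 g) // => h; apply/ordeqP/eqP => [hw|->//].
by apply: ordeq_word; apply: ordeq_trans hw (ordeq_sym gw).
Qed.

Lemma ordeq_refl w : ordeq w w. Proof. by []. Qed.

Lemma ext_word n (a : grpalg K 'S_n) g : ext a (word g) = a g.
Proof. by apply: ext_ordeq (ordeq_refl _); apply: word_uniq. Qed.

Lemma toKS_ext n (a : grpalg K 'S_n) : toKS n (ext a) = a.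
Proof. by apply/ffunP => g; rewrite ffunE ext_word. Qed.

Lemma ext_homog n (a : grpalg K 'S_n) : homog n (ext a).
Proof.
move=> w sw; rewrite /ext; case: (uniq w) => //; apply: big_pred0 => g.
by apply/negP => /ordeqP[sg _]; move: sw; rewrite -sg size_word eqxx.
Qed.

Lemma ext_map n (a : grpalg K 'S_n) f w :
  {in w &, forall x y, (f x < f y)%N = (x < y)%N} -> ext a (map f w) = ext a w.
Proof.
move=> fw; have f_inj : {in w &, injective f}.
  move=> x y xw yw fxy; have := fw _ _ yw xw; have := fw _ _ xw yw.
  by rewrite fxy ltnn; case: ltngtP.
have ow : ordeq w (map f w).
  split=> [|i j i_n j_n]; first by rewrite size_map.
  by rewrite !(nth_map 0%N) // fw ?mem_nth.
rewrite /ext map_inj_in_uniq //; case: (uniq w) => //.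
apply: eq_bigl => g; apply/ordeqP/ordeqP => h; last exact: ordeq_trans h ow.
exact: ordeq_trans h (ordeq_sym ow).
Qed.

Lemma ext_sum n (I : Type) (r : seq I) (P : pred I) (a : I -> grpalg K 'S_n) w :
  ext (\sum_(i <- r | P i) a i) w = \sum_(i <- r | P i) ext (a i) w.
Proof.
rewrite /ext; case: (uniq w); last by rewrite big1.
by rewrite exchange_big; apply: eq_bigr => g _; rewrite sum_ffunE.
Qed.

Lemma extZ n c (a : grpalg K 'S_n) w : ext (c *: a) w = c * ext a w.
Proof.
rewrite /ext; case: (uniq w); last by rewrite mulr0.
by rewrite mulr_sumr; apply: eq_bigr => g _; rewrite ffunE.
Qed.

Lemma ext_Xi n q w : q \in compositions n -> uniq w -> size w = n ->
  ext (Xi K n q) w = (incr_blocks q w)%:R.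
Proof.
move=> qn uw sw; have [g gw] := exists_standard uw sw.
by rewrite (ext_ordeq _ uw gw) Xi_incr_blocks // (ordeq_incr_blocks _ gw).
Qed.

(** The hypothesis says that shuffle sums vanish on permutation words; standardization carries this
    to all words with distinct letters. A repeated letter or a wrong length persists in every
    shuffle, where [ext] is 0. *)
Lemma ext_primitive m (a : grpalg K 'S_m) : (0 < m)%N ->
  (forall i, (0 < i < m)%N -> Xi K m [:: i; (m - i)%N] * a = 0) -> primitive (ext a).
Proof.
move=> m0 Xa; split; first by apply: ext_homog; rewrite eq_sym -lt0n.
move=> u v u0 v0; have [suv|suv] := eqVneq (size (u ++ v)) m; last first.
  by rewrite big1_seq // => z /andP[_ /perm_shuf/perm_size zs]; rewrite ext_homog ?zs.
have [uuv|uuv] := boolP (uniq (u ++ v)); last first.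
  rewrite big1_seq // => z /andP[_ /perm_shuf/perm_uniq uz].
  by rewrite /ext uz (negPf uuv).
have [g [sg gw]] := exists_standard uuv suv.
(* Order-preserving relabelling that turns the standardization [g] back into u ++ v. *)
pose f x := nth 0%N (u ++ v) (index x (word g)).
have fg : map f (word g) = u ++ v.
  apply: (@eq_from_nth _ 0%N) => [|i]; rewrite size_map // => i_n.
  by rewrite (nth_map 0%N) // /f index_uniq ?word_uniq.
have fmono : {in word g &, forall x y, (f x < f y)%N = (x < y)%N}.
  by move=> x y xg yg; rewrite /f -gw ?index_mem // !nth_index.
set i := size u; have im : (0 < i < m)%N.
  rewrite -suv size_cat /i lt0n size_eq0 u0 -[X in (X < _)%N]addn0 ltn_add2l.
  by rewrite lt0n size_eq0 v0.
have [i0 i_m] := andP im.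
pose u' := take i (word g); pose v' := drop i (word g).
have fu : map f u' = u by rewrite map_take fg take_size_cat.
have fv : map f v' = v by rewrite map_drop fg drop_size_cat.
have sn : [:: i; (m - i)%N] \in compositions m.
  by rewrite mem_compositions /is_composition /= i0 subn_gt0 i_m addn0 subnKC ?eqxx // ltnW.
have H : \sum_(z <- shuf u' v') ext a z = 0.
  have := congr1 (fun x : grpalg K 'S_m => x g) (Xa i im).
  by rewrite /= -{1}(toKS_ext a) Xi_mul // mshuf2 ?size_word ?subnKC 1?ltnW // => ->; rewrite ffunE.
rewrite -fu -fv map_shuf big_map -[RHS]H.
apply: eq_big_seq => z zs; rewrite ext_map // => x y xz yz; apply: fmono.
  by move: xz; rewrite (perm_mem (perm_shuf zs)) cat_take_drop.
by move: yz; rewrite (perm_mem (perm_shuf zs)) cat_take_drop.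
Qed.

Lemma omega_primitive m i : (0 < i < m)%N -> Xi K m [:: i; (m - i)%N] * omega K m = 0.
Proof.
case/andP=> i0 i_m; rewrite omegaE; apply/ffunP => g.
have sn : [:: i; (m - i)%N] \in compositions m.
  by rewrite mem_compositions /is_composition /= i0 subn_gt0 i_m addn0 subnKC ?eqxx // ltnW.
rewrite Xi_mul // ffunE mshuf2 ?size_word ?subnKC 1?ltnW // valley_sign_shuf ?cat_take_drop ?word_uniq //.
  by rewrite -size_eq0 size_takel ?size_word 1?ltnW // -lt0n.
by rewrite -size_eq0 size_drop size_word -lt0n subn_gt0.
Qed.

End Standardize.

(** * Descent and peak algebras *)

Lemma scanl_pairmap_sub x L : path ltn x L ->
  [/\ scanl addn x (pairmap (fun a b => (b - a)%N) x L) = L,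
      all (leq 1) (pairmap (fun a b => (b - a)%N) x L)
    & (x + sumn (pairmap (fun a b => (b - a)%N) x L))%N = last x L].
Proof.
elim: L x => [|y L IHL] x /=; first by rewrite addn0.
case/andP=> xy /IHL[sE aE lE]; rewrite subnKC ?(ltnW xy) // sE aE subn_gt0 xy.
by rewrite addnA subnKC ?(ltnW xy).
Qed.

Lemma comp_set_surj n (D : {set 'I_n}) : (0 < n)%N -> (forall i, i \in D -> (0 < i)%N) ->
  exists2 q, q \in compositions n & comp_set n q = D.
Proof.
move=> n0 D0; pose S := [seq x <- iota 0 n | x \in [seq val i | i in D]].
have sS : sorted ltn S.
  by apply: sorted_filter; [exact: ltn_trans|exact: iota_ltn_sorted].
have memS x : x \in S -> exists2 i, i \in D & x = val i.
  by rewrite mem_filter => /andP[/imageP[i iD ->] _]; exists i.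
have pL : path ltn 0 (rcons S n).
  rewrite -cats1 cat_path /= andbT; apply/andP; split.
    rewrite path_sortedE; last exact: ltn_trans.
    rewrite sS andbT; apply/allP => x /memS[i /D0 i0 ->]. exact: i0.
  by have := mem_last 0%N S; rewrite inE => /orP[/eqP->//|/memS[i _ ->]]; apply: ltn_ord.
have [sE aE lE] := scanl_pairmap_sub pL.
exists (pairmap (fun a b => (b - a)%N) 0%N (rcons S n)).
  by rewrite mem_compositions /is_composition aE -[sumn _]add0n lE last_rcons eqxx.
apply/setP => i; rewrite inE sE mem_rcons inE (ltn_eqF (ltn_ord i)) /=.
rewrite /S mem_filter mem_iota /= ltn_ord andbT.
by apply/imageP/idP => [[j jD /val_inj->]//|iD]; exists i.
Qed.

Section Descents.
Variable K : fieldType.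

Lemma Xi_basis_mem n q : q \in compositions n -> Xi K n q \in <<Xi_basis K n>>%VS.
Proof. by move=> qn; apply: memv_span; apply: map_f. Qed.

(** Triangularity: Delta^D is Xi^D minus the Delta^E with E strictly inside D. If 0 is in D, then
    Delta^D = 0. *)
Lemma Delta_set_span n (D : {set 'I_n}) : (0 < n)%N ->
  Delta_set K D \in <<Xi_basis K n>>%VS.
Proof.
move=> n0; have [m] := ubnP #|D|; elim: m D => // m IHm D /ltnSE Dm.
have [/forall_inP D0|/forall_inPn[i iD]] := boolP [forall i in D, (0 < i)%N]; last first.
  rewrite -eqn0Ngt => i0; suff -> : Delta_set K D = 0 by apply: mem0v.
  apply/ffunP => g; rewrite Delta_setE ffunE; case: eqP => // gD.
  by move: iD; rewrite -gD Des_nth (eqP i0).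
have [q qn qD] := comp_set_surj n0 D0.
have := Xi_basis_mem qn; rewrite /Xi qD /Xi_set (bigD1 D) //= => XD.
rewrite -(addrK (\sum_(E : {set 'I_n} | (E \subset D) && (E != D)) Delta_set K E) (Delta_set K D)).
apply: memvB => //; apply: memv_suml => E /andP[ED nED]; apply: IHm.
apply: leq_trans Dm; apply: proper_card; by rewrite properEneq nED.
Qed.

Lemma descent_algE n : (0 < n)%N -> descent_alg K n = <<Xi_basis K n>>%VS.
Proof.
move=> n0; apply/eqP; rewrite eqEsubv; apply/andP; split; apply/span_subvP => v.
  by case/mapP=> D _ ->; apply: Delta_set_span.
case/mapP=> q _ ->; apply: memv_suml => E _; apply: memv_span.
by apply: map_f; rewrite mem_enum.
Qed.

Lemma ext_span n (a : grpalg K 'S_n) w : a \in <<Xi_basis K n>>%VS ->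
  uniq w -> size w = n -> ext a w = \sum_(i < size (compositions n))
     coord (Xi_basis K n) i a * (incr_blocks (nth [::] (compositions n) i) w)%:R.
Proof.
move=> /coord_span aE uw sw; rewrite {1}aE ext_sum; apply: eq_bigr => i _.
by rewrite extZ (nth_map [::]) // ext_Xi // mem_nth.
Qed.

Lemma incr_blocks_cat q r w : incr_blocks (q ++ r) w = incr_blocks q (take (sumn q) w) && incr_blocks r (drop (sumn q) w).
Proof.
elim: q w => [|m q IHq] w /=; first by rewrite drop0.
rewrite IHq andbA take_takel ?leq_addr //; congr (_ && _ && _).
  by rewrite take_drop addnC.
by rewrite drop_drop addnC.
Qed.

Lemma cat_compositions m k q r : q \in compositions m -> r \in compositions k ->
  q ++ r \in compositions (m + k).
Proof.
rewrite !mem_compositions /is_composition all_cat sumn_cat.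
by case/andP=> -> /eqP-> /andP[-> /eqP->]; rewrite eqxx.
Qed.

(** The outer product as concatenation. [uniq w] matters: on a word with repeated letters the left
    side is 0, but its two halves may have distinct letters and a nonzero product. *)
Lemma ext_outer m k n (a : grpalg K 'S_m) (b : grpalg K 'S_k) w : n = (m + k)%N ->
  a \in <<Xi_basis K m>>%VS -> b \in <<Xi_basis K k>>%VS ->
  uniq w -> size w = n ->
  ext (outer n a b) w = ext a (take m w) * ext b (drop m w).
Proof.
move=> -> aX bX uw sw; have mw : (m <= size w)%N by rewrite sw leq_addr.
rewrite (ext_span aX) ?take_uniq ?size_takel //.
rewrite (ext_span bX) ?drop_uniq ?size_drop ?sw ?addKn //.
rewrite mulr_suml ext_sum; apply: eq_bigr => i _; rewrite mulr_sumr ext_sum.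
apply: eq_bigr => j _; rewrite extZ.
have im := mem_nth [::] (ltn_ord i); have jk := mem_nth [::] (ltn_ord j).
rewrite ext_Xi ?cat_compositions //.
rewrite incr_blocks_cat (comp_sumn im).
by case: (incr_blocks _ (take _ _)); case: (incr_blocks _ _); rewrite ?mulr1 ?mulr0 ?mul0r.
Qed.

Lemma outer_mem m k n (a : grpalg K 'S_m) (b : grpalg K 'S_k) : n = (m + k)%N ->
  outer n a b \in <<Xi_basis K n>>%VS.
Proof.
move=> ->; apply: memv_suml => i _; apply: memv_suml => j _; apply: memvZ.
by apply: Xi_basis_mem; apply: cat_compositions; apply: mem_nth.
Qed.

Lemma peak_algP n (a : grpalg K 'S_n) :
  reflect (forall g h : 'S_n, Peak g = Peak h -> a g = a h) (a \in peak_alg K n).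
Proof.
have PsE P (g : 'S_n) : Peak_sum K P g = (Peak g == P)%:R.
  rewrite sum_ffunE; case: eqP => [gE | gE].
    rewrite (bigD1 g) ?gE //= ffunE eqxx big1 ?addr0 // => u /andP[_ ug].
    by rewrite ffunE eq_sym (negPf ug).
  rewrite big1 // => u /eqP uE; rewrite ffunE; case: eqP => // gu.
  by case: gE; rewrite gu.
apply: (iffP idP) => [|aP].
  move=> /(@coord_span _ _ _ (in_tuple _)) -> g h gh; rewrite !sum_ffunE; apply: eq_bigr => i _.
  rewrite !ffunE; congr (_ * _).
  have : (in_tuple [seq Peak_sum K P | P : {set 'I_n}])`_i \in [seq Peak_sum K P | P : {set 'I_n}].
    by apply: mem_nth; apply: ltn_ord.
  by case/mapP=> P _ ->; rewrite !PsE gh.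
have -> : a = \sum_(P : {set 'I_n}) (if [pick g | Peak g == P] is Some g then a g else 0) *: Peak_sum K P.
  apply/ffunP => g; rewrite sum_ffunE (bigD1 (Peak g)) //= big1 ?addr0 => [|P Pg].
    rewrite !ffunE PsE eqxx; case: pickP => [h /eqP hg|/(_ g)]; last by rewrite eqxx.
    by rewrite (aP _ _ hg) [RHS]mulr1.
  by rewrite ffunE PsE eq_sym (negPf Pg) scaler0.
apply: memv_suml => P _; apply: memvZ; apply: memv_span; apply: map_f.
by rewrite mem_enum.
Qed.

(** The comparisons of truncated predecessors exclude i = 0 and i = 1. The 1-based peak i concerns
    the 0-based places i-2, i-1, i. *)
Definition peak_at (w : seq nat) i := [&& (i.-2 < i.-1)%N, (i.-1 < i)%N,
  (nth 0 w i.-2 < nth 0 w i.-1)%N & (nth 0 w i < nth 0 w i.-1)%N].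

Lemma Peak_nth n (g : 'S_n) (i : 'I_n) : (i \in Peak g) = peak_at (word g) i.
Proof.
rewrite inE; apply/existsP/and4P => [[j /existsP[k /and4P[/eqP ji /eqP kj gkj gij]]]|].
  have ij : i.-1 = j by rewrite -ji.
  have ik : i.-2 = k by rewrite ij -kj.
  by rewrite ik ij !nth_word -kj ltnSn kj -ji ltnSn.
case=> i21 i1 g1 g2.
have i0 : (0 < i)%N by apply: leq_ltn_trans i1.
have i10 : (0 < i.-1)%N by apply: leq_ltn_trans i21.
have i1n : (i.-1 < n)%N by apply: ltn_trans (ltn_ord i).
have i2n : (i.-2 < n)%N by apply: ltn_trans i1n.
exists (Ordinal i1n); apply/existsP; exists (Ordinal i2n).
rewrite /= !prednK // !eqxx /=; apply/andP; split.
  by rewrite -(nth_word g (Ordinal i2n)) -(nth_word g (Ordinal i1n)).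
by rewrite -(nth_word g (Ordinal i1n)) -nth_word.
Qed.

(** A peak at i is a descent at i whose predecessor i-1 is an ascent. *)
Lemma Des_Peak n (g h : 'S_n) : Des g = Des h -> Peak g = Peak h.
Proof.
move=> gh; apply/setP => i; rewrite !Peak_nth /peak_at.
have [i21|] := ltnP i.-2 i.-1; have [i1|] := ltnP i.-1 i => //=.
have i1n : (i.-1 < n)%N by apply: ltn_trans (ltn_ord i).
have D (f : 'S_n) : (nth 0 (word f) i.-2 < nth 0 (word f) i.-1)%N
    && (nth 0 (word f) i < nth 0 (word f) i.-1)%N
    = (Ordinal i1n \notin Des f) && (i \in Des f).
  rewrite !Des_nth /= (leq_ltn_trans _ i1) // (leq_ltn_trans _ i21) //=.
  congr (_ && _); have := nth_uniq 0%N (i := i.-2) (j := i.-1) _ _ (word_uniq f).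
  rewrite size_word => /(_ (ltn_trans i21 i1n) i1n); rewrite (ltn_eqF i21).
  by case: ltngtP.
by rewrite !D gh.
Qed.

Lemma ext_peak n (a : grpalg K 'S_n) w w' : a \in peak_alg K n -> uniq w -> uniq w' ->
  size w = n -> size w' = n -> (forall i, (i < n)%N -> peak_at w i = peak_at w' i) ->
  ext a w = ext a w'.
Proof.
move=> /peak_algP aP uw uw' sw sw' ww.
have [g gw] := exists_standard uw sw; have [g' gw'] := exists_standard uw' sw'.
rewrite (ext_ordeq _ uw gw) (ext_ordeq _ uw' gw'); apply: aP; apply/setP => i.
have pk (h : 'S_n) v : ordeq (word h) v -> peak_at (word h) i = peak_at v i.
  have i0 := ltn_ord i; have i1 := leq_ltn_trans (leq_pred i) i0.
  have i2 := leq_ltn_trans (leq_pred _) i1.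
  case=> _; rewrite size_word => hv; rewrite /peak_at (hv i.-2 i.-1) //. rewrite (hv i i.-1) //.
by rewrite !Peak_nth (pk _ _ gw) (pk _ _ gw') ww.
Qed.

(** The peak set of a word determines the peak sets of its two parts, so concatenation preserves
    constancy on peak classes. *)
Lemma outer_peak m k n (a : grpalg K 'S_m) (b : grpalg K 'S_k) : n = (m + k)%N ->
  a \in <<Xi_basis K m>>%VS -> b \in <<Xi_basis K k>>%VS ->
  a \in peak_alg K m -> b \in peak_alg K k -> outer n a b \in peak_alg K n.
Proof.
move=> nE aX bX aP bP; apply/peak_algP => g h gh.
have mn : (m <= n)%N by rewrite nE leq_addr.
have pk i : (i < n)%N -> peak_at (word g) i = peak_at (word h) i.
  by move=> i_n; rewrite -!(Peak_nth _ (Ordinal i_n)) gh.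
rewrite -!ext_word !(ext_outer nE) ?word_uniq ?size_word //; congr (_ * _).
  apply: ext_peak; rewrite ?take_uniq ?word_uniq ?size_takel ?size_word // => i im.
  have := pk i (leq_trans im mn); rewrite /peak_at.
  have i1 := leq_ltn_trans (leq_pred i) im; have i2 := leq_ltn_trans (leq_pred _) i1.
  by rewrite !(nth_take _ im) !(nth_take _ i1) !(nth_take _ i2).
apply: ext_peak; rewrite ?drop_uniq ?word_uniq ?size_drop ?size_word ?nE ?addKn // => i ik.
have := pk (m + i)%N; rewrite [X in (_ < X)%N]nE ltn_add2l => /(_ ik).
(* For i = 0 and i = 1 a peak of the whole word would straddle the cut, and the second part has none
   there. *)
case: i ik => [|[|i]] ik; rewrite /peak_at //= ?andbF //.
by rewrite !addnS /= !ltnSn !nth_drop !addnS.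
Qed.

Lemma peak_descent n : (0 < n)%N -> (peak_alg K n <= descent_alg K n)%VS.
Proof.
move=> n0; apply/span_subvP => v /mapP[P _ ->].
have -> : Peak_sum K P = \sum_(D : {set 'I_n}) 
   (if [pick g | Des g == D] is Some g then Peak_sum K P g else 0) *: Delta_set K D.
  apply/ffunP => g; rewrite [RHS]sum_ffunE (bigD1 (Des g)) //= big1 ?addr0 => [|D Dg].
    rewrite [RHS]ffunE Delta_setE eqxx [RHS]mulr1; case: pickP => [h /eqP hg|/(_ g)]; last by rewrite eqxx.
    apply: (peak_algP (Peak_sum K P) _) => //; first by apply: memv_span; apply: map_f; rewrite mem_enum.
    exact: Des_Peak.
  by rewrite ffunE Delta_setE eq_sym (negPf Dg) scaler0.
apply: memv_suml => D _; apply: memvZ; apply: memv_span; apply: map_f.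
by rewrite mem_enum.
Qed.

End Descents.

(** * Lie series *)

Section Gamma.
Variables (K : fieldType) (charK : [pchar K] =i pred0).
Variables (gamma : forall m : nat, grpalg K 'S_m) (gammaL : Lie_series gamma).
Implicit Types (s t q r : seq nat).

Lemma char0_natf_neq0 m : (0 < m)%N -> m%:R != 0 :> K.
Proof. by move=> m0; rewrite ((pcharf0P K).1 charK) -lt0n. Qed.

Lemma gamma_span m : (0 < m)%N -> gamma m \in <<Xi_basis K m>>%VS.
Proof. by move=> m0; rewrite -descent_algE //; case: (gammaL m0). Qed.

Lemma gamma_omega m : (0 < m)%N -> exists b, gamma m = omega K m * b.
Proof.
move=> m0; have [_ [_ lie]] := gammaL m0.
have : m%:R^-1 *: gamma m \in (<[omega K m]> * fullv)%VS.
  by rewrite -lie -[X in X \in _]mulr1; apply: memv_mul; rewrite ?memv_line ?memvf.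
have /subvP sub : (<[omega K m]> * fullv <= limg (amull (omega K m)))%VS.
  apply/prodvP => u v /vlineP[c ->] _; apply/memv_imgP; exists (c *: v); first exact: memvf.
  by rewrite lfunE /= -scalerAl -scalerAr.
move/sub/memv_imgP => [b _]; rewrite lfunE /= => gE; exists (m%:R *: b).
by rewrite -scalerAr -gE scalerA mulfV ?scale1r // char0_natf_neq0.
Qed.

Lemma gamma_sqr m : (0 < m)%N -> gamma m * gamma m = m%:R *: gamma m.
Proof.
move=> m0; have [_ [idem _]] := gammaL m0.
have m_neq0 := char0_natf_neq0 m0.
have gE : gamma m = m%:R *: (m%:R^-1 *: gamma m) by rewrite scalerA mulfV // scale1r.
by rewrite {1 2}gE -scalerAl -scalerAr idem -gE.
Qed.

Lemma gamma_primitive m : (0 < m)%N -> primitive (ext (gamma m)).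
Proof.
move=> m0; apply: ext_primitive => // i im; have [b ->] := gamma_omega m0.
by rewrite mulrA omega_primitive // mul0r.
Qed.

Lemma omega_neq0 m : (0 < m)%N -> omega K m != 0.
Proof.
case: m => // m _; apply/eqP => /ffunP/(_ 1%g).
have w1 : word (1%g : 'S_m.+1) = iota 0 m.+1.
  by rewrite -val_enum_ord; apply: eq_map => i; rewrite perm1.
have v0 : valley 0 (iota 0 m.+1) by rewrite /valley drop0 iota_ltn_sorted /= take0.
rewrite omegaE ![_ 1%g]ffunE w1 /valley_sign size_iota big_ord_recl v0 mulr1 big1.
  by rewrite addr0 expr0 ffunE => /eqP one0; move: (oner_neq0 K) => /negP; apply; exact: one0.
move=> k _; rewrite (_ : valley _ _ = false) ?mulr0 //.
by rewrite /valley; case: m k {v0 w1} => [[]|m k].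
Qed.

Lemma gamma_neq0 m : (0 < m)%N -> gamma m != 0.
Proof.
move=> m0; apply: contraNneq (omega_neq0 m0) => g0.
have [_ [_]] := gammaL m0; rewrite g0 scaler0 prod0v => lie.
by rewrite -memv0 lie -[X in X \in _]mulr1 memv_mul ?memv_line ?memvf.
Qed.

(** gamma_m as a letter of degree m; by [gamma_wordE], gamma_q is then the product of the letters of
    q. *)
Definition letterx m := ext (gamma m).

Lemma gamma_prim_family q : all (leq 1) q -> prim_family letterx id q.
Proof.
by move=> /allP qp m /qp m0; split; [apply: gamma_primitive | apply: ext_homog].
Qed.

Lemma gamma_word_span n q : n = sumn q -> all (leq 1) q ->
  gamma_word gamma n q \in <<Xi_basis K n>>%VS.
Proof.
move=> ->; case: q => [|m q] /=; first by move=> _; apply: Xi_basis_mem.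
by move=> _; apply: outer_mem.
Qed.

Lemma gamma_wordE n q : n = sumn q -> all (leq 1) q ->
  gamma_word gamma n q = toKS n (prode letterx q).
Proof.
move=> nE qp; suff E w : uniq w -> size w = n ->
    ext (gamma_word gamma n q) w = prode letterx q w.
  by apply/ffunP => g; rewrite ffunE -E ?word_uniq ?size_word // ext_word.
elim: q n nE qp w => [|m q IHq] n nE qp w uw sw.
  rewrite nE /= in sw *; have -> := size0nil sw.
  by rewrite (@ext_Xi _ 0) ?inE // /prode /= /cone eqxx.
move: qp => /= /andP[m0 qp].
rewrite ext_outer ?gamma_span ?gamma_word_span //.
have mw : (m <= size w)%N by rewrite sw nE leq_addr.
rewrite IHq ?drop_uniq ?size_drop ?sw ?nE ?addKn //.
by rewrite /prode /= (cmul_homogE _ (@ext_homog _ _ (gamma m))).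
Qed.

Section Degree.
Variable n : nat.
Local Notation G := (gamma_word gamma n).
Local Notation X := (Xi K n).
Local Notation comps := (compositions n).

Lemma Xi_mul_gamma s t : s \in comps -> t \in comps ->
  X s * G t = \sum_(r <- act id s t) G r.
Proof.
move=> sn tn; have tp := comp_pos tn.
rewrite gamma_wordE ?(comp_sumn tn) // (Xi_mul_prode sn (gamma_prim_family tp)).
apply: eq_big_seq => r /act_perm rt.
by rewrite gamma_wordE ?(perm_all _ rt) // (perm_sumn rt) (comp_sumn tn).
Qed.

Definition Xi_ge k : {vspace grpalg K 'S_n} :=
  <<[seq X t | t <- comps & (k <= size t)%N]>>%VS.

Lemma Xi_ge_mem k t : t \in comps -> (k <= size t)%N -> X t \in Xi_ge k.
Proof.
by move=> tn kt; apply: memv_span; apply: map_f; rewrite mem_filter kt.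
Qed.

Lemma Xi_ge_mono k l : (k <= l)%N -> (Xi_ge l <= Xi_ge k)%VS.
Proof.
move=> kl; apply/span_subvP => v /mapP[t]; rewrite mem_filter => /andP[lt tn] ->.
by apply: Xi_ge_mem => //; apply: leq_trans lt.
Qed.

Definition prodn q : K := \prod_(m <- q) m%:R.

Lemma prodn_neq0 q : all (leq 1) q -> prodn q != 0.
Proof.
move=> /allP qp; rewrite /prodn prodf_seq_neq0; apply/allP => m /qp m0.
exact: char0_natf_neq0.
Qed.

End Degree.

Lemma outerBl m k n (a a' : grpalg K 'S_m) (b : grpalg K 'S_k) :
  outer n (a - a') b = outer n a b - outer n a' b.
Proof.
rewrite /outer -sumrB; apply: eq_bigr => i _; rewrite -sumrB; apply: eq_bigr => j _.
by rewrite linearB mulrBl scalerBl.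
Qed.

Lemma outerZl m k n c (a : grpalg K 'S_m) (b : grpalg K 'S_k) :
  outer n (c *: a) b = c *: outer n a b.
Proof.
rewrite /outer scaler_sumr; apply: eq_bigr => i _; rewrite scaler_sumr; apply: eq_bigr => j _.
by rewrite linearZ /= scalerA mulrA.
Qed.

Lemma outerBr m k n (a : grpalg K 'S_m) (b b' : grpalg K 'S_k) :
  outer n a (b - b') = outer n a b - outer n a b'.
Proof.
rewrite /outer -sumrB; apply: eq_bigr => i _; rewrite -sumrB; apply: eq_bigr => j _.
by rewrite linearB mulrBr scalerBl.
Qed.

Lemma outerZr m k n c (a : grpalg K 'S_m) (b : grpalg K 'S_k) :
  outer n a (c *: b) = c *: outer n a b.
Proof.
rewrite /outer scaler_sumr; apply: eq_bigr => i _; rewrite scaler_sumr; apply: eq_bigr => j _.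
by rewrite linearZ /= scalerA mulrCA.
Qed.

Lemma Xi_ge_coord m l (a : grpalg K 'S_m) (i : 'I_(size (compositions m))) :
  a \in Xi_ge m l -> (size (nth [::] (compositions m) i) < l)%N ->
  coord (Xi_basis K m) i a = 0.
Proof.
rewrite /Xi_ge => /(@coord_span _ _ _ (in_tuple _)) -> il.
rewrite linear_sum big1 // => j _; rewrite linearZ /=.
set L := [seq Xi K m t | t <- _ & _].
have : L`_j \in L by apply: mem_nth; rewrite ltn_ord.
case/mapP => t; rewrite mem_filter => /andP[tl tm] /= ->.
have it : (index t (compositions m) < size (compositions m))%N by rewrite index_mem.
have -> : Xi K m t = (Xi_basis K m)`_(Ordinal it) by rewrite (nth_map [::]) //= nth_index.
rewrite coord_free ?Xi_free // -val_eqE /=; case: eqP => [ti|]; last by rewrite mulr0.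
by rewrite -ti nth_index // ltnNge tl in il.
Qed.

Lemma outer_Xi_ge m k n l l' (a : grpalg K 'S_m) (b : grpalg K 'S_k) : n = (m + k)%N ->
  a \in Xi_ge m l -> b \in Xi_ge k l' -> outer n a b \in Xi_ge n (l + l').
Proof.
move=> -> aL bL; apply: memv_suml => i _; apply: memv_suml => j _.
have im := mem_nth [::] (ltn_ord i); have jk := mem_nth [::] (ltn_ord j).
have [il|li] := ltnP (size (nth [::] (compositions m) i)) l.
  by rewrite (Xi_ge_coord aL) // mul0r scale0r mem0v.
have [jl|lj] := ltnP (size (nth [::] (compositions k) j)) l'.
  by rewrite (Xi_ge_coord bL) // mulr0 scale0r mem0v.
apply: memvZ; apply: Xi_ge_mem; first exact: cat_compositions.
by rewrite size_cat leq_add.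
Qed.

Lemma Xi_ge0 n : Xi_ge n 0 = <<Xi_basis K n>>%VS.
Proof. by rewrite /Xi_ge filter_predT. Qed.

Lemma prode_letter m : toKS m (prode letterx [:: m]) = gamma m.
Proof. by apply/ffunP => g; rewrite ffunE /prode /= cmul1 /letterx ext_word. Qed.

Lemma comp1 m : (0 < m)%N -> [:: m] \in compositions m.
Proof. by move=> m0; rewrite mem_compositions /is_composition /= m0 addn0 eqxx. Qed.

Lemma comp_size_gt0 m t : (0 < m)%N -> t \in compositions m -> (0 < size t)%N.
Proof. by case: t => // m0 /comp_sumn /= m00; rewrite -m00 in m0. Qed.

Lemma comp_size_le m t : t \in compositions m -> (size t <= m)%N.
Proof.
rewrite mem_compositions => /andP[tp /eqP <-]; elim: t tp => //= x t IHt /andP[x0 /IHt].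
by rewrite -add1n; apply: leq_add.
Qed.

Lemma comp_size1 m t : t \in compositions m -> size t = 1%N -> t = [:: m].
Proof. by case: t => [|x []] // /comp_sumn /= <- _; rewrite addn0. Qed.

(** Write gamma_m as c Xi^m plus terms with at least two parts. The latter annihilate the single
    primitive gamma_m and Xi^m fixes it, so its square is c gamma_m; since gamma_m / m is
    idempotent, c = m. *)
Lemma gamma_lead1 m : (0 < m)%N -> gamma m - m%:R *: Xi K m [:: m] \in Xi_ge m 2.
Proof.
move=> m0; have mm := comp1 m0.
have [c cE] : exists c, gamma m - c *: Xi K m [:: m] \in Xi_ge m 2.
  have /coord_span gE := gamma_span m0.
  have im : (index [:: m] (compositions m) < size (compositions m))%N by rewrite index_mem.
  exists (coord (Xi_basis K m) (Ordinal im) (gamma m)).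
  rewrite {1}gE (bigD1 (Ordinal im)) //= (nth_map [::]) // nth_index //.
  rewrite addrAC subrr add0r.
  apply: memv_suml => i ii; apply: memvZ; rewrite (nth_map [::]) //.
  have ic := mem_nth [::] (ltn_ord i).
  apply: Xi_ge_mem => //; have := comp_size_gt0 m0 ic.
  rewrite leq_eqVlt => /orP[/eqP s1|//]; case/negP: ii.
  rewrite -val_eqE /=; have i1 := comp_size1 ic (esym s1).
  by rewrite -i1 index_uniq ?compositions_uniq.
have fam := gamma_prim_family (comp_pos mm).
have kill y : y \in Xi_ge m 2 -> y * gamma m = 0.
  move=> /(@coord_span _ _ _ (in_tuple _)) ->; rewrite mulr_suml big1 // => j _.
  rewrite -scalerAl; set L := [seq Xi K m t | t <- _ & _].
  have : L`_j \in L by apply: mem_nth; rewrite ltn_ord.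
  case/mapP => t; rewrite mem_filter => /andP[tl tm] /= ->.
  rewrite -prode_letter (Xi_mul_prode tm fam) big1_seq ?scaler0 // => r /andP[_ rt].
  have := act_size (comp_pos tm) rt; rewrite (perm_size (act_perm rt)) leqNgt.
  by rewrite (leq_trans _ tl).
have X1 : Xi K m [:: m] * gamma m = gamma m.
  rewrite -{1}prode_letter (Xi_mul_prode mm fam) /= addn0 eqxx /=.
  by rewrite (ltn_eqF m0) /= big_seq1 prode_letter.
have := kill _ cE; rewrite mulrBl -scalerAl X1 gamma_sqr // => /eqP.
by rewrite -scalerBl scaler_eq0 (negPf (gamma_neq0 m0)) orbF subr_eq0 => /eqP ->.
Qed.

(** Under the outer product numbers of parts add, so leading terms multiply. *)
Lemma gamma_lead n t : t \in compositions n ->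
  gamma_word gamma n t - prodn t *: Xi K n t \in Xi_ge n (size t).+1.
Proof.
rewrite mem_compositions => /andP[tp /eqP nE]; rewrite -{n}nE.
elim: t tp => [|m t IHt] /=.
  by move=> _; rewrite /prodn big_nil scale1r subrr mem0v.
case/andP=> m0 tp; have {}IHt := IHt tp.
have tc : t \in compositions (sumn t) by rewrite mem_compositions /is_composition tp eqxx.
set G' := gamma_word gamma _ t in IHt *; set n := (m + sumn t)%N.
have XE : Xi K n (m :: t) = outer n (Xi K m [:: m]) (Xi K (sumn t) t).
  exact: esym (outer_Xi K n (comp1 m0) tc).
have -> : outer n (gamma m) G' - prodn (m :: t) *: Xi K n (m :: t) =
    outer n (gamma m - m%:R *: Xi K m [:: m]) G'
    + m%:R *: outer n (Xi K m [:: m]) (G' - prodn t *: Xi K (sumn t) t).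
  rewrite outerBl outerZl outerBr outerZr scalerBr addrA subrK XE scalerA.
  by rewrite /prodn big_cons.
apply: memvD.
  rewrite -[X in Xi_ge _ X]add2n; apply: outer_Xi_ge (gamma_lead1 m0) _ => //.
  rewrite -(subrK (prodn t *: Xi K (sumn t) t) G'); apply: memvD.
    by apply: (subvP (Xi_ge_mono _ (leqnSn _))).
  by apply: memvZ; apply: Xi_ge_mem.
apply: memvZ; rewrite -[X in Xi_ge _ X]add1n; apply: outer_Xi_ge => //.
by apply: Xi_ge_mem; rewrite ?comp1.
Qed.

End Gamma.

Lemma span_ind_prop (K : fieldType) (vT : vectType K) (X : seq vT) (P : vT -> Prop) :
  P 0 -> (forall c u v, P u -> P v -> P (c *: u + v)) ->
  (forall u, u \in X -> P u) -> forall v, v \in <<X>>%VS -> P v.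
Proof.
move=> P0 PD PX v /(@coord_span _ _ _ (in_tuple _)) ->.
apply: big_ind => // [x y Px Py|i _]; first by rewrite -[x]scale1r; apply: PD.
by rewrite -[X in P X]addr0; apply: PD => //; apply: PX; apply: mem_nth; rewrite ltn_ord.
Qed.

(** * Characters of the descent algebra *)

Section GammaBasis.
Variables (K : fieldType) (charK : [pchar K] =i pred0).
Variables (gamma : forall m : nat, grpalg K 'S_m) (gammaL : Lie_series gamma).
Variables (n : nat) (n0 : (0 < n)%N).
Implicit Types (s t q r : seq nat).
Local Notation G := (gamma_word gamma n).
Local Notation X := (Xi K n).
Local Notation comps := (compositions n).
Local Notation D := (descent_alg K n).
Local Notation KS := (grpalg K 'S_n).

Lemma gamma_Xi_ge t : t \in comps -> G t \in Xi_ge K n (size t).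
Proof.
move=> tn; rewrite -(subrK (prodn K t *: X t) (G t)); apply: memvD.
  by apply: (subvP (Xi_ge_mono _ _ (leqnSn _))); apply: gamma_lead.
by apply: memvZ; apply: Xi_ge_mem.
Qed.

(** Inversion of the triangular relation [gamma_lead]; the induction ends because a composition of n
    has at most n parts. *)
Lemma Xi_gamma_span t : t \in comps ->
  X t \in <<[seq G r | r <- comps & (size t <= size r)%N]>>%VS.
Proof.
have [m] := ubnP (n - size t); elim: m t => // m IHm t ltm tn.
have p0 : prodn K t != 0 by apply: prodn_neq0 => //; apply: comp_pos tn.
rewrite -[X t]scale1r -(mulVf p0) -scalerA; apply: memvZ.
rewrite -[prodn K t *: _](subKr (G t)); apply: memvB.
  by apply: memv_span; apply: map_f; rewrite mem_filter leqnn.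
apply: subvP _ (gamma_lead charK gammaL tn); apply/span_subvP => v /mapP[r].
rewrite mem_filter => /andP[tr rn] ->.
have lt : (n - size r < m)%N.
  rewrite -ltnS; apply: leq_trans ltm; rewrite ltnS ltn_sub2l //.
  exact: leq_trans tr (comp_size_le rn).
have := IHm r lt rn; apply: subvP; apply: sub_span => x /mapP[u].
rewrite mem_filter => /andP[ru un] ->; apply: map_f; rewrite mem_filter un andbT.
exact: leq_trans (ltnW tr) ru.
Qed.

Lemma Xi_geE k : Xi_ge K n k = <<[seq G r | r <- comps & (k <= size r)%N]>>%VS.
Proof.
apply/eqP; rewrite eqEsubv; apply/andP; split; apply/span_subvP => v /mapP[t].
  rewrite mem_filter => /andP[kt tn] ->; apply: subvP _ (Xi_gamma_span tn).
  apply: sub_span => x /mapP[u]; rewrite mem_filter => /andP[tu un] ->.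
  by apply: map_f; rewrite mem_filter un (leq_trans kt tu).
rewrite mem_filter => /andP[kt tn] ->.
by apply: subvP (Xi_ge_mono _ _ kt) _ (gamma_Xi_ge tn).
Qed.

Lemma descent_ge : D = Xi_ge K n 0.
Proof. by rewrite descent_algE // Xi_ge0. Qed.

Lemma descent_gamma : D = <<[seq G r | r <- comps]>>%VS.
Proof. by rewrite descent_ge Xi_geE filter_predT. Qed.

(** The gamma_r span D_n and are as many as the elements of the basis [Xi_basis]. *)
Lemma gamma_free : free [seq G r | r <- comps].
Proof.
rewrite /free -descent_gamma descent_algE // size_map.
by have := Xi_free K n; rewrite /free size_map => /eqP->.
Qed.

Definition gamma_basis := map_tuple G (in_tuple comps).

(** The coordinate at gamma_r, indexed by the word itself so that leading words can be compared; it
    is 0 if r is not a composition of n. *)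
Definition gcoord r (x : KS) : K :=
  \sum_(i < size comps | nth [::] comps i == r) coord gamma_basis i x.

Lemma gcoord_is_linear r : linear (gcoord r : KS -> K^o).
Proof.
move=> c x y; rewrite /gcoord scaler_sumr -big_split; apply: eq_bigr => i _.
by rewrite linearP.
Qed.

HB.instance Definition _ r := GRing.isLinear.Build K KS K^o _ (gcoord r : KS -> K^o)
  (gcoord_is_linear r).

Lemma gcoord_gamma r t : t \in comps -> gcoord r (G t) = (r == t)%:R.
Proof.
move=> tn; have it : (index t comps < size comps)%N by rewrite index_mem.
have -> : G t = gamma_basis`_(Ordinal it) by rewrite (nth_map [::]) //= nth_index.
rewrite /gcoord (eq_bigr (fun i => (Ordinal it == i)%:R)); last first.
  by move=> i _; rewrite (coord_free _ _ (gamma_free : free gamma_basis)).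
have [->|rt] := eqVneq r t.
  rewrite (bigD1 (Ordinal it)) /= ?nth_index // eqxx.
  by rewrite big1 ?addr0 // => i /andP[_ /negPf ii]; rewrite eq_sym ii.
rewrite big1 // => i /eqP ir; case: eqP => // ii; case/negP: rt; apply/eqP.
by rewrite -ir -ii /= nth_index.
Qed.

Lemma gamma_desc t : t \in comps -> G t \in D.
Proof. by move=> tn; rewrite descent_gamma memv_span ?map_f. Qed.

Lemma Xi_desc t : t \in comps -> X t \in D.
Proof. by move=> tn; rewrite descent_algE // Xi_basis_mem. Qed.

(* At least size s nonempty groups of factors would be needed. *)
Lemma Xi_mul_gamma_ge s t : s \in comps -> t \in comps -> (size t < size s)%N ->
  X s * G t = 0.
Proof.
move=> sn tn st; rewrite Xi_mul_gamma // big1_seq // => r /andP[_ rt].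
have := act_size (comp_pos sn) rt.
by rewrite (perm_size (act_perm rt)) leqNgt st.
Qed.

Definition act_count s t := size (act id s t).

(** All groups are singletons, so every term is gamma_s and only their number remains. *)
Lemma Xi_mul_gamma_eq s t : s \in comps -> t \in comps -> size t = size s ->
  X s * G t = (act_count s t)%:R *: G s.
Proof.
move=> sn tn ts; rewrite Xi_mul_gamma // scaler_nat.
rewrite (eq_big_seq (fun=> G s)); first by rewrite big_const_seq count_predT iter_addr_0.
move=> r rt; have := act_deg (comp_pos sn) rt.
by rewrite (perm_size (act_perm rt)) ts map_id => ->.
Qed.

Lemma act_count_gt0 s t : perm_eq s t -> (0 < act_count s t)%N.
Proof.
move=> st; have [|r] := @act_nonempty _ id s t; first by rewrite map_id perm_sym.
by rewrite /act_count; case: (act _ _ _).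
Qed.

Lemma act_count_eq0 s t : s \in comps -> size t = size s -> ~~ perm_eq s t ->
  act_count s t = 0%N.
Proof.
move=> sn ts; apply: contraNeq; rewrite /act_count.
case E: (act id s t) => [//|r l] _; have rt : r \in act id s t by rewrite E mem_head.
have := act_deg (comp_pos sn) rt; rewrite map_id (perm_size (act_perm rt)) => /(_ ts) <-.
exact: act_perm rt.
Qed.

(* A filtration: on killed k.+1, the elements Xi^s with k parts only see the layer
   killed k.+1 / killed k, on which the descent algebra acts by characters. *)
Definition killed k : {vspace KS} :=
  (\bigcap_(i < size comps | (k <= size (nth [::] comps i))%N) lker (amull (X (nth [::] comps i))))%VS.

Lemma killedP k (x : KS) :
  reflect (forall s, s \in comps -> (k <= size s)%N -> X s * x = 0) (x \in killed k).
Proof.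
apply: (iffP idP) => [|H].
  rewrite memvE => /subv_bigcapP H s sn ks.
  have it : (index s comps < size comps)%N by rewrite index_mem.
  have := H (Ordinal it); rewrite /= nth_index // => /(_ ks).
  by rewrite -memvE memv_ker lfunE /= => /eqP.
rewrite memvE; apply/subv_bigcapP => i ik.
by rewrite -memvE memv_ker lfunE /= H ?mem_nth.
Qed.

Lemma killed_ge k x y : x \in killed k -> y \in Xi_ge K n k -> y * x = 0.
Proof.
move=> /killedP xk; move: y; apply: (span_ind_prop (P := fun y => y * x = 0)) => [|c u v u0 v0|u].
- by rewrite mul0r.
- by rewrite mulrDl -scalerAl u0 v0 scaler0 addr0.
by case/mapP=> s; rewrite mem_filter => /andP[ks sn] ->; apply: xk.
Qed.

(** Modulo compositions with more parts than s, Xi^s gamma_t is [act_count s t] times gamma_s if t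
    has as many parts as s, and gamma_s is [prodn K s] times Xi^s. Hence the scalar by which a acts
    under Xi^s. *)
Definition chi s (a : KS) : K :=
  \sum_(t <- comps | size t == size s) gcoord t a * ((act_count s t)%:R * prodn K s).

Lemma chi_is_linear s : linear (chi s : KS -> K^o).
Proof.
move=> c x y; rewrite /chi scaler_sumr -big_split; apply: eq_bigr => i _.
by rewrite linearP mulrDl -[in LHS]mulrA.
Qed.

HB.instance Definition _ s := GRing.isLinear.Build K KS K^o _ (chi s : KS -> K^o)
  (chi_is_linear s).

Lemma chi_gamma s t : s \in comps -> t \in comps ->
  chi s (G t) = if perm_eq s t then (act_count s t)%:R * prodn K s else 0.
Proof.
move=> sn tn; rewrite /chi big_mkcond (bigD1_seq t) ?compositions_uniq //=.
rewrite gcoord_gamma // eqxx mul1r big1 ?addr0 => [|u ut]; last first.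
  by rewrite gcoord_gamma // (negPf ut) mul0r if_same.
have [st|st] := boolP (perm_eq s t); first by rewrite (perm_size st) eqxx.
by case: eqP => // ts; rewrite act_count_eq0 // mul0r.
Qed.

Lemma chi_gamma_neq0 s t : s \in comps -> t \in comps ->
  (chi s (G t) != 0) = perm_eq s t.
Proof.
move=> sn tn; rewrite chi_gamma //; case: ifP => [st|]; last by rewrite eqxx.
apply: mulf_neq0;
first by apply: (char0_natf_neq0 charK); apply: act_count_gt0.
by apply: prodn_neq0 => //; apply: comp_pos sn.
Qed.

(** On the basis gamma_t: a shorter t gives 0, a longer one gives longer terms only, and equal
    length gives a multiple of gamma_s. *)
Lemma Xi_mul_desc s a : s \in comps -> a \in D ->
  X s * a - (chi s a / prodn K s) *: G s \in Xi_ge K n (size s).+1.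
Proof.
move=> sn; have p0 : prodn K s != 0 by apply: prodn_neq0 => //; apply: comp_pos sn.
rewrite descent_gamma; move: a; apply: (span_ind_prop (P := fun a =>
    X s * a - (chi s a / prodn K s) *: G s \in Xi_ge K n (size s).+1)) => [|c u v uP vP|v /mapP[t tn ->]].
- by rewrite linear0 mul0r scale0r mulr0 subrr mem0v.
- have -> : chi s (c *: u + v) = c * chi s u + chi s v by exact: linearP.
  rewrite mulrDr -scalerAr mulrDl scalerDl -mulrA -scalerA opprD addrACA -scalerBr.
  by rewrite memvD // memvZ.
have [lt|gt|ts] := ltngtP (size t) (size s).
- rewrite Xi_mul_gamma_ge // chi_gamma //; case: ifP => [/perm_size ts|_].
    by rewrite ts ltnn in lt.
  by rewrite mul0r scale0r subrr mem0v.
- rewrite chi_gamma //; case: ifP => [/perm_size ts|_]; first by rewrite ts ltnn in gt.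
  rewrite mul0r scale0r subr0 Xi_mul_gamma // big_seq; apply: memv_suml => r rt.
  have rtp := act_perm rt.
  have rn : r \in comps.
    rewrite mem_compositions /is_composition (perm_all _ rtp) (perm_sumn rtp).
    by rewrite -[_ && _]/(is_composition n t) -mem_compositions.
  apply: subvP (Xi_ge_mono _ _ _) _ (gamma_Xi_ge rn).
  by rewrite (perm_size rtp).
rewrite Xi_mul_gamma_eq // chi_gamma //; case: ifP => [_|/negbT st].
  by rewrite mulfK // subrr mem0v.
by rewrite act_count_eq0 // mul0r scale0r subrr mem0v.
Qed.

Lemma gamma_mul_killed s x : s \in comps -> x \in killed (size s).+1 ->
  G s * x = prodn K s *: (X s * x).
Proof.
move=> sn xk; have /(killed_ge xk) := gamma_lead charK gammaL sn.
by rewrite mulrBl -scalerAl => /eqP; rewrite subr_eq0 => /eqP.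
Qed.

(** The error term of [Xi_mul_desc] annihilates [x], and so does that of [gamma_lead] used to turn
    gamma_s back into Xi^s; the two factors [prodn K s] cancel. *)
Lemma Xi_mul_killed s a x : s \in comps -> a \in D -> x \in killed (size s).+1 ->
  X s * (a * x) = chi s a *: (X s * x).
Proof.
move=> sn aD xk; have p0 : prodn K s != 0 by apply: prodn_neq0 => //; apply: comp_pos sn.
have /(killed_ge xk) := Xi_mul_desc sn aD.
rewrite mulrBl -scalerAl gamma_mul_killed // scalerA mulfVK // mulrA.
by move/eqP; rewrite subr_eq0 => /eqP.
Qed.

Lemma killed_mono k l : (k <= l)%N -> (killed k <= killed l)%VS.
Proof.
move=> kl; apply/subvP => x /killedP xk; apply/killedP => s sn ls; apply: xk => //.
exact: leq_trans ls.
Qed.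

Lemma killed_stable k a x : a \in D -> x \in killed k -> a * x \in killed k.
Proof.
move=> aD xk; apply/killedP => s sn ks.
have xs : x \in killed (size s).+1 by apply: subvP (killed_mono _) _ xk; rewrite leqW.
by rewrite Xi_mul_killed //; move/killedP: xk => /(_ s sn ks) ->; rewrite scaler0.
Qed.

Lemma killed_top x : x \in killed n.+1.
Proof. by apply/killedP => s sn; rewrite ltnNge comp_size_le. Qed.

Lemma killed_gamma t : t \in comps -> G t \in killed (size t).+1.
Proof. by move=> tn; apply/killedP => s sn ts; apply: Xi_mul_gamma_ge. Qed.

Lemma gamma_mul_gamma p t : p \in comps -> t \in comps -> perm_eq p t ->
  G p * G t = chi p (G t) *: G p.
Proof.
move=> pn tn pt; rewrite gamma_mul_killed //; last by rewrite (perm_size pt) killed_gamma.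
by rewrite Xi_mul_gamma_eq ?(perm_size pt) // scalerA chi_gamma // pt mulrC.
Qed.

Lemma gamma_word_neq0 t : t \in comps -> G t != 0.
Proof.
move=> tn; apply/eqP => t0; have := gcoord_gamma t tn.
by rewrite t0 linear0 eqxx => /esym/eqP; rewrite [_ == _]oner_eq0.
Qed.

(* The characters only depend on the underlying partition: compare the two ways
   of letting gamma_p gamma_t = chi_p (gamma_t) gamma_p act. *)
Lemma chi_perm s p a : s \in comps -> p \in comps -> perm_eq s p -> a \in D ->
  chi s a = chi p a.
Proof.
move=> sn pn sp; rewrite descent_gamma.
move: a; apply: (span_ind_prop (P := fun a => chi s a = chi p a)) => [|c u v uP vP|v /mapP[t tn ->]].
- by rewrite !linear0.
- have chiP r : chi r (c *: u + v) = c * chi r u + chi r v by exact: linearP.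
  by rewrite !chiP uP vP.
have [pt|pt] := boolP (perm_eq p t); last first.
  rewrite !chi_gamma // (negPf pt) (permPl sp) (negPf pt).
  by [].
have sk := killed_gamma sn.
have gp := gamma_desc pn; have gt := gamma_desc tn.
have E1 : X s * (G p * (G t * G s)) = (chi s (G p) * chi s (G t)) *: (X s * G s).
  by rewrite (Xi_mul_killed sn gp (killed_stable gt sk)) Xi_mul_killed // scalerA.
have E2 : X s * (G p * (G t * G s)) = (chi s (G p) * chi p (G t)) *: (X s * G s).
  rewrite (mulrA (G p)) gamma_mul_gamma // -scalerAl -scalerAr Xi_mul_killed //.
  by rewrite scalerA mulrC.
move/eqP: E1; rewrite E2 -subr_eq0 -scalerBl scaler_eq0 Xi_mul_gamma_eq //.
rewrite scaler_eq0 (negPf (gamma_word_neq0 sn)) orbF.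
rewrite (negPf (char0_natf_neq0 charK _)) ?act_count_gt0 // orbF -mulrBr mulf_eq0.
have /negPf-> : chi s (G p) != 0 by rewrite chi_gamma_neq0.
by rewrite /= subr_eq0 => /eqP.
Qed.

Definition idem p : KS := (chi p (G p))^-1 *: G p.

Lemma idem_desc p : p \in comps -> idem p \in D.
Proof. by move=> pn; apply: memvZ; apply: gamma_desc. Qed.

Lemma chi_idem s p : s \in comps -> p \in comps -> chi s (idem p) = (perm_eq s p)%:R.
Proof.
move=> sn pn; rewrite linearZ /= -[_ *: _]/(_ * _).
have [sp|sp] := boolP (perm_eq s p); last by rewrite (chi_gamma sn pn) (negPf sp) mulr0.
by rewrite (chi_perm sn pn) ?gamma_desc // mulVf ?chi_gamma_neq0.
Qed.

Lemma idem_gamma p : p \in comps -> idem p * G p = G p.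
Proof.
move=> pn; rewrite -scalerAl gamma_mul_gamma // scalerA mulVf ?scale1r //.
by rewrite chi_gamma_neq0.
Qed.

Lemma idem_idem p : p \in comps -> idem p * idem p = idem p.
Proof. by move=> pn; rewrite -scalerAr idem_gamma. Qed.

(** For s with j parts, Xi^s sees e_p x only if s ~ p, and then a acts by chi_s(a) = chi_p(a). Here
    the invariance of the characters under rearrangement is essential: one scalar must serve all
    such s at once. *)
Lemma idem_killed p a x j : p \in comps -> a \in D -> x \in killed j.+1 ->
  a * (idem p * x) - chi p a *: (idem p * x) \in killed j.
Proof.
move=> pn aD xk; have ek := killed_stable (idem_desc pn) xk.
apply/killedP => s sn; rewrite leq_eqVlt => /orP[/eqP js|js].
  rewrite js in xk ek; rewrite mulrBr -scalerAr !Xi_mul_killed ?idem_desc //.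
  rewrite chi_idem //; have [sp|sp] := boolP (perm_eq s p); last by rewrite !scale0r !scaler0 subrr.
  by rewrite (chi_perm sn pn) // subrr.
have : a * (idem p * x) - chi p a *: (idem p * x) \in killed j.+1.
  by rewrite memvB ?memvZ // killed_stable.
by move/killedP; apply.
Qed.

End GammaBasis.

(** * Composition series *)

Section Series.
Variables (K : fieldType) (aT : falgType K).
Implicit Types (A L N U V W : {vspace aT}) (s : seq {vspace aT}).

Lemma submoduleP A U : submodule A U <-> (forall a u, a \in A -> u \in U -> a * u \in U).
Proof. by split=> [/prodvP|/prodvP]. Qed.

Lemma submoduleS A B U : (A <= B)%VS -> submodule B U -> submodule A U.
Proof. by move=> AB; apply: subv_trans; apply: prodvSl. Qed.

Lemma submodule0 A : submodule A 0%VS.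
Proof. by rewrite /submodule prodv0. Qed.

Lemma submoduleD A U V : submodule A U -> submodule A V -> submodule A (U + V)%VS.
Proof. by move=> sU sV; rewrite /submodule prodvDr; apply: addvS. Qed.

Lemma submoduleI A U V : submodule A U -> submodule A V -> submodule A (U :&: V)%VS.
Proof.
move=> /submoduleP sU /submoduleP sV; apply/submoduleP => a u aA.
by rewrite !memv_cap => /andP[uU uV]; rewrite sU ?sV.
Qed.

Lemma ex_max_submodule A L : submodule A L -> L != 0%VS -> exists N, max_submodule A N L.
Proof.
move=> sL L0; pose P d := `[< exists N, [/\ submodule A N, (N <= L)%VS, N <> L & \dim N = d] >].
have P0 : P 0%N.
  apply/asboolP; exists 0%VS; split; [exact: submodule0 | exact: sub0v | | exact: dimv0].
  by move=> L0'; rewrite -L0' eqxx in L0.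
have Pb d : P d -> (d <= \dim L)%N.
  by move=> /asboolP[N [_ NL _ <-]]; apply: dimvS.
case: (ex_maxnP (ex_intro P 0%N P0) Pb) => d /asboolP[N [sN NL nNL dN]] dmax.
exists N; split=> // U sU /andP[NU UL].
have [->|nUL] := eqVneq U L; [by right|left].
apply/esym/eqP; rewrite eqEdim NU dN; apply: dmax; apply/asboolP; exists U.
by split=> //; apply/eqP.
Qed.

Lemma ex_comp_series A L : submodule A L -> exists s, comp_series A L s.
Proof.
have [d] := ubnP (\dim L); elim: d L => // d IHd L /ltnSE dL sL.
have [->|L0] := eqVneq L 0%VS; first by exists [::]; rewrite /comp_series /=.
have [N maxN] := ex_max_submodule sL L0; have [sN NL nNL _] := maxN.
have [|s /andP[ps /eqP ls]] := IHd N _ sN.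
  apply: leq_trans dL; rewrite ltn_neqAle dimvS // andbT.
  by apply/eqP => dN; apply: nNL; apply/eqP; rewrite eqEdim NL dN leqnn.
exists (rcons s L); rewrite /comp_series rcons_path ps ls last_rcons eqxx andbT.
exact/asboolP.
Qed.

(** Provides the endomorphism of the whole space that [quot_iso] asks for, by extension from the
    free family [v :: vbasis W]. *)
Lemma ex_lfun_line (v g : aT) W : v \notin W ->
  exists f : 'End(aT), f v = g /\ forall w, w \in W -> f w = 0.
Proof.
move=> vW; have fX : free (v :: vbasis W).
  by rewrite free_cons (span_basis (vbasisP W)) vW (basis_free (vbasisP W)).
have [f fE] := linear_of_free (v :: vbasis W) (g :: nseq (\dim W) 0).
have := fE fX; rewrite /= size_tuple size_nseq => /(_ erefl) [fv fW].
exists (linfun f); split; first by rewrite lfunE.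
move=> w /coord_vbasis ->; rewrite linear_sum big1 // => i _.
rewrite linearZ /= lfunE; have := congr1 (fun l => l`_i) fW.
by rewrite (nth_map 0) ?size_tuple // nth_nseq ltn_ord => ->; rewrite scaler0.
Qed.


(** * Counting the composition factors on which an idempotent acts *)

Section Idempotent.
Variables (A : {vspace aT}) (e : aT) (chi : aT -> K) (F : nat -> {vspace aT}) (top : nat).
Hypothesis eA : e \in A.
Hypothesis e_idem : e * e = e.
Hypothesis F_stable : forall j, submodule A (F j).
Hypothesis F_bot : forall x, x \in F 0 -> e * x = 0.
Hypothesis F_top : forall x, x \in F top.
Hypothesis F_step : forall j a x, a \in A -> x \in F j.+1 ->
  a * (e * x) - chi a *: (e * x) \in F j.

Definition weight U := \dim (amull e @: U).

(* A simple subquotient on which e acts nontrivially occurs in a layer of the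
   filtration F, where the image of e has character chi. *)
Lemma simple_cases V V' : submodule A V -> max_submodule A V' V ->
  (exists v, [/\ v \in V, v \notin V', (<[v]> + V')%VS = V, e * v = v &
     forall a, a \in A -> a * v - chi a *: v \in V'])
  \/ (forall u, u \in V -> e * u \in V').
Proof.
move=> sV [sV' V'V nV'V maxV'].
have [E|/existsNP [u /not_implyP [uV euV']]] := pselect (forall u, u \in V -> e * u \in V'); [by right|left].
(* Each [W j] lies between [V'] and [V], so it is one of them. At the least j with [W j = V],
   applying e and the layer F j yields a line stable modulo [V']. *)
pose W j := (V :&: F j + V')%VS.
have WV j : (W j <= V)%VS by rewrite subv_add V'V capvSl.
have sW j : submodule A (W j) by apply: submoduleD => //; apply: submoduleI.
have ex_j : exists j, W j == V.
  exists top; rewrite eqEsubv WV /=; apply: subv_trans (addvSl _ _).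
  by apply/subvP => x xV; rewrite memv_cap xV F_top.
case: (ex_minnP ex_j) => j /eqP Wj jmin.
have uW : u \in W j by rewrite Wj.
have /memv_addP [k + [w wV' uE]] := uW; rewrite memv_cap => /andP[kV kF].
have /submoduleP mV' := sV'; have /submoduleP mV := sV.
have ek : e * k \notin V'.
  apply/negP => ekV'; apply: euV'; rewrite uE mulrDr memvD //; exact: mV'.
case: j => [|j] in Wj jmin uW kF *.
  by move: ek; rewrite F_bot // mem0v.
have W'V : W j = V'.
  have WI : (V' <= W j <= V)%VS by rewrite addvSr WV.
  have [//|Wj'] := maxV' _ (sW j) WI.
  by have := jmin j; rewrite Wj' eqxx ltnn => /(_ isT).
have ekV : e * k \in V by apply: mV.
have act_ek a : a \in A -> a * (e * k) - chi a *: (e * k) \in V'.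
  move=> aA; rewrite -W'V; apply: (subvP (addvSl _ _)); rewrite memv_cap F_step // andbT.
  by rewrite memvB ?memvZ // mV.
exists (e * k); split=> //; last by rewrite mulrA e_idem.
(* By [act_ek] every a scales e k modulo [V'], so this sum is a submodule and maximality forces it
   to be [V]. *)
have sL : submodule A (<[e * k]> + V')%VS.
  apply/submoduleP => a _ aA /memv_addP[_ /vlineP[c ->] [w' w'V' ->]].
  rewrite mulrDr -scalerAr -(subrK (chi a *: (e * k)) (a * (e * k))) scalerDr addrC addrA.
  rewrite addrC scalerA memv_add ?memvZ ?memv_line //.
  by rewrite memvD ?memvZ ?act_ek ?mV'.
have LI : (V' <= <[e * k]> + V' <= V)%VS by rewrite addvSr subv_add V'V andbT -memvE.
have [LV'|//] := maxV' _ sL LI.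
by case/negP: ek; rewrite -LV'; apply: (subvP (addvSl _ _)); apply: memv_line.
Qed.

Lemma amullE (a b : aT) : amull a b = a * b. Proof. by rewrite lfunE. Qed.

(** The image of e gains the line of v = e v, which meets e V' trivially because e V' lies in
    [V']. *)
Lemma weight_step1 V V' v : submodule A V' -> v \notin V' -> (<[v]> + V')%VS = V ->
  e * v = v -> weight V = (weight V').+1.
Proof.
move=> /submoduleP sV' vV' <- ev; rewrite /weight limgD limg_line amullE ev.
rewrite dimv_disjoint_sum.
  rewrite dim_vline; case: eqP vV' => [->|//]; by rewrite mem0v.
apply/eqP; rewrite -subv0; apply/subvP => x; rewrite memv_cap => /andP[/vlineP[c ->]].
case/memv_imgP => w wV'; rewrite amullE => cv.
have [->|c0] := eqVneq c 0; first by rewrite scale0r mem0v.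
case/negP: vV'; rewrite -[v]scale1r -(mulVf c0) -scalerA cv memvZ //.
exact: sV'.
Qed.

(** As e = e^2, the image e V = e (e V) already lies in e V'. *)
Lemma weight_step0 V V' : (V' <= V)%VS -> (forall u, u \in V -> e * u \in V') ->
  weight V = weight V'.
Proof.
move=> V'V eV; rewrite /weight; congr (\dim _); apply/eqP; rewrite eqEsubv.
apply/andP; split; last exact: limgS.
apply/subvP => x /memv_imgP[u uV ->]; have -> : amull e u = amull e (e * u) by rewrite !amullE mulrA e_idem.
by apply: memv_img; apply: eV.
Qed.

Variables (M M' : {vspace aT}) (g : aT).
Hypothesis gM : g \in M.
Hypothesis gM' : g \notin M'.
Hypothesis ME : (<[g]> + M')%VS = M.
Hypothesis eg : e * g = g.
Hypothesis eM' : forall x, x \in M' -> e * x \in M'.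
Hypothesis chi_g : forall a, a \in A -> a * g - chi a *: g \in M'.

(** Both quotients are lines on which A acts by [chi]; send v to g and [V'] to 0. *)
Lemma quot_iso_step1 V V' v : submodule A V' -> v \notin V' -> (<[v]> + V')%VS = V ->
  (forall a, a \in A -> a * v - chi a *: v \in V') -> quot_iso A V V' M M'.
Proof.
move=> sV' vV' VE av; have [f [fv fV']] := ex_lfun_line g vV'.
exists f; split.
- rewrite -VE limgD limg_line fv subv_add -memvE gM /=.
  by apply/subvP => x /memv_imgP[w /fV' -> ->]; rewrite mem0v.
- apply/eqP; rewrite eqEsubv; apply/andP; split; last first.
    rewrite -{1}ME; apply: addvS => //; rewrite -memvE -fv memv_img // -VE.
    by apply: (subvP (addvSl _ _)); apply: memv_line.
  rewrite subv_add -{2}ME addvSr andbT -VE limgD limg_line fv subv_add -memvE gM /=.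
  by apply/subvP => x /memv_imgP[w /fV' -> ->]; rewrite mem0v.
- apply/eqP; rewrite eqEsubv; apply/andP; split; last first.
    rewrite subv_cap -{1}VE addvSr /=; apply/subvP => x /fV' fx.
    by rewrite -memv_preim fx mem0v.
  apply/subvP => x; rewrite memv_cap -memv_preim -VE.
  case/andP => /memv_addP[_ /vlineP[c ->] [w wV' ->]].
  rewrite linearD linearZ /= fv (fV' _ wV') addr0.
  have [->|c0] := eqVneq c 0; first by rewrite !scale0r add0r.
  move=> cg; case/negP: gM'; rewrite -[g]scale1r -(mulVf c0) -scalerA.
  exact: memvZ.
move=> a x aA; rewrite -VE => /memv_addP[_ /vlineP[c ->] [w wV' ->]].
have /submoduleP mV' := sV'.
have faw : f (a * w) = 0 by apply/fV'/mV'.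
have fav : f (a * v) = chi a *: g.
  have := fV' _ (av a aA); rewrite linearB linearZ /= fv => /eqP.
  by rewrite subr_eq0 => /eqP.
rewrite mulrDr !linearD -scalerAr !linearZ /= fv (fV' _ wV') faw !addr0 fav.
by rewrite -scalerAr -scalerBr -opprB scalerN -scaleNr memvZ // chi_g.
Qed.

(** An isomorphism commutes with e modulo [M'], but e kills V / V' and fixes the class of g, which
    is nonzero. *)
Lemma quot_iso_step0 V V' : (forall u, u \in V -> e * u \in V') ->
  ~ quot_iso A V V' M M'.
Proof.
move=> eV [f [fVM fVM' Vf fA]].
have : g \in (f @: V + M')%VS by rewrite fVM'.
case/memv_addP => _ /memv_imgP[u uV ->] [w wM' gE].
have : e * u \in (V :&: f @^-1: M')%VS by rewrite Vf eV.
rewrite memv_cap -memv_preim => /andP[_ feu].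
case/negP: gM'; rewrite -eg gE mulrDr; apply: memvD; last exact: eM'.
by rewrite -[e * f u](subKr (f (e * u))); apply: memvB => //; apply: fA.
Qed.

Lemma path_mult L U s : submodule A L -> last U s = L ->
  path (fun U V => `[< max_submodule A U V >]) U s ->
  (count (fun VU : {vspace aT} * {vspace aT} => `[< quot_iso A VU.2 VU.1 M M' >]) (zip (U :: s) s)
     + weight U)%N = weight L.
Proof.
move=> sL; elim: s U => [|V s IHs] U /=; first by move=> ->; rewrite add0n.
move=> lE /andP[/asboolP maxU ps]; have {IHs} <- := IHs V lE ps.
(* [V] is either the end [L] of the series or a maximal submodule of the next term. *)
have sV : submodule A V.
  case: s lE ps => [/= VL _|V2 s _ /= /andP[/asboolP[]//]].
  by rewrite VL.
have [sU UV _ _] := maxU.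
have [[v [vV vU VE ev av]]|eV] := simple_cases sV maxU.
  rewrite asboolT; last exact: quot_iso_step1 av.
  by rewrite (weight_step1 sU vU VE ev) addnS add1n addSn.
rewrite asboolF; last exact: quot_iso_step0.
by rewrite (weight_step0 UV eV).
Qed.

Lemma weight0 : weight 0 = 0%N.
Proof. by rewrite /weight limg0 dimv0. Qed.

Lemma multiplicity_weight L : submodule A L -> multiplicity A L M M' (weight L).
Proof.
move=> sL; split; first exact: ex_comp_series.
move=> s /andP[ps /eqP ls]; have := path_mult sL ls ps.
by rewrite weight0 addn0.
Qed.

End Idempotent.
End Series.

(** * The modules Lambda^p *)

Section Modules.
Variables (K : fieldType) (charK : [pchar K] =i pred0).
Variables (gamma : forall m : nat, grpalg K 'S_m) (gammaL : Lie_series gamma).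
Variables (n : nat) (n0 : (0 < n)%N).
Implicit Types (s t q r p : seq nat).
Local Notation G := (gamma_word gamma n).
Local Notation X := (Xi K n).
Local Notation comps := (compositions n).
Local Notation D := (descent_alg K n).
Local Notation KS := (grpalg K 'S_n).
Local Notation killed := (killed K n).
Local Notation idem := (idem gamma n).
Local Notation chi := (chi gamma).

Lemma comp_perm p r : p \in comps -> perm_eq r p -> r \in comps.
Proof.
rewrite !mem_compositions /is_composition => pn rp.
by rewrite (perm_all _ rp) (perm_sumn rp).
Qed.

(** By Xi^s the word p is only rearranged; conversely Xi^r gamma_p is a positive multiple of gamma_r
    for each r ~ p, and characteristic 0 allows the division. *)
Lemma LamE p : p \in comps ->
  Lam gamma n p = <<[seq G r | r <- comps & perm_eq r p]>>%VS.
Proof.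
move=> pn; apply/eqP; rewrite eqEsubv; apply/andP; split.
  apply/prodvP => a _ + /vlineP[c ->]; rewrite descent_algE //; move: a.
  apply: (span_ind_prop (P := fun a => a * (c *: G p) \in _)) => [|d u v uP vP|u].
  - by rewrite mul0r mem0v.
  - by rewrite mulrDl -scalerAl memvD // memvZ.
  case/mapP=> s sn ->; rewrite -scalerAr memvZ // Xi_mul_gamma // big_seq.
  apply: memv_suml => r /act_perm rp; apply: memv_span; apply: map_f.
  by rewrite mem_filter rp (comp_perm pn).
apply/span_subvP => _ /mapP[r + ->]; rewrite mem_filter => /andP[rp rn].
have c0 : (act_count r p)%:R != 0 :> K.
  by apply: (char0_natf_neq0 charK); apply: act_count_gt0.
rewrite -[G r]scale1r -(mulVf c0) -scalerA memvZ //.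
rewrite -Xi_mul_gamma_eq ?(perm_size rp) // memv_mul ?memv_line //.
exact: Xi_desc.
Qed.

Lemma Lam_perm p r : p \in comps -> perm_eq r p -> Lam gamma n r = Lam gamma n p.
Proof.
move=> pn rp; rewrite !LamE ?(comp_perm pn rp) //; congr <<map _ _>>%VS.
by apply: eq_filter => t; apply: (permPr rp).
Qed.

Lemma gamma_Lam p r : p \in comps -> perm_eq r p -> G r \in Lam gamma n p.
Proof.
move=> pn rp; rewrite LamE // memv_span // map_f // mem_filter rp.
exact: comp_perm rp.
Qed.

(** Each spanning element gamma_r generates the same space: D_n gamma_r = Lambda^r = Lambda^p. *)
Lemma Lam_submodule p : p \in comps -> submodule D (Lam gamma n p).
Proof.
move=> pn; apply/submoduleP => a u aD; rewrite {1}LamE //; move: u.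
apply: (span_ind_prop (P := fun u => a * u \in _)) => [|c u v uP vP|_ /mapP[r + ->]].
- by rewrite mulr0 mem0v.
- by rewrite mulrDr -scalerAr memvD // memvZ.
rewrite mem_filter => /andP[rp rn]; rewrite -(Lam_perm pn rp).
by rewrite memv_mul ?memv_line.
Qed.

Lemma dim_Lam p : p \in comps ->
  (\dim (Lam gamma n p) <= count (fun r => perm_eq r p) comps)%N.
Proof. by move=> pn; rewrite LamE // -size_filter -(size_map G) dim_span. Qed.

Lemma Lam_killed p x : p \in comps -> x \in Lam gamma n p -> x \in killed (size p).+1.
Proof.
move=> pn; rewrite LamE //; apply: subvP; apply/span_subvP => _ /mapP[r + ->].
rewrite mem_filter => /andP[rp rn]; rewrite -(perm_size rp).
exact: killed_gamma.
Qed.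

(** The explicit radical: Xi^p maps Lambda^p onto the line of gamma_p, so this kernel is a
    hyperplane. It is described without maximal submodules and so can be used for a smaller acting
    space too. *)
Definition LamRad p : {vspace KS} := (Lam gamma n p :&: lker (amull (X p)))%VS.

Lemma LamRadP p x :
  reflect (x \in Lam gamma n p /\ X p * x = 0) (x \in LamRad p).
Proof. by rewrite memv_cap memv_ker amullE; apply: (iffP andP) => -[? /eqP]. Qed.

Lemma Xi_Lam p x : p \in comps -> x \in Lam gamma n p -> exists c, X p * x = c *: G p.
Proof.
move=> pn; rewrite LamE //; move: x.
apply: (span_ind_prop (P := fun x => exists c, X p * x = c *: G p)) => [|c u v [a aE] [b bE]|_ /mapP[r + ->]].
- by exists 0; rewrite mulr0 scale0r.
- by exists (c * a + b); rewrite mulrDr -scalerAr aE bE scalerDl scalerA.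
rewrite mem_filter => /andP[rp rn]; exists (act_count p r)%:R.
by rewrite Xi_mul_gamma_eq ?(perm_size rp).
Qed.

Lemma Xi_gamma_neq0 p : p \in comps -> X p * G p != 0.
Proof.
move=> pn; rewrite Xi_mul_gamma_eq // scaler_eq0 negb_or (gamma_word_neq0 charK) // andbT.
by apply: (char0_natf_neq0 charK); apply: act_count_gt0.
Qed.

Lemma gamma_LamRad p : p \in comps -> G p \notin LamRad p.
Proof. by move=> pn; apply/LamRadP => -[_ /eqP]; apply/negP/Xi_gamma_neq0. Qed.

Lemma LamRad_decomp p : p \in comps -> (<[G p]> + LamRad p)%VS = Lam gamma n p.
Proof.
move=> pn; apply/eqP; rewrite eqEsubv subv_add -memvE gamma_Lam //= capvSl /=.
apply/subvP => x xL; have [c cE] := Xi_Lam pn xL.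
have [d dE] := Xi_Lam pn (gamma_Lam pn (perm_refl p)).
have d0 : d != 0.
  by apply: contraNneq (Xi_gamma_neq0 pn) => d0; rewrite dE d0 scale0r.
rewrite -(subrKC ((c / d) *: G p) x); apply: memv_add; first by rewrite memvZ ?memv_line.
apply/LamRadP; split; first by rewrite memvB ?memvZ ?gamma_Lam.
by rewrite mulrBr -scalerAr cE dE scalerA mulfVK // subrr.
Qed.

Lemma LamRad_submodule p : p \in comps -> submodule D (LamRad p).
Proof.
move=> pn; apply/submoduleP => a u aD /LamRadP[uL u0]; apply/LamRadP; split.
  by have /submoduleP := Lam_submodule pn; apply.
by rewrite (Xi_mul_killed charK gammaL) ?Lam_killed // u0 scaler0.
Qed.

Lemma submodule_Lam_cases p U : p \in comps -> submodule D U ->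
  (U <= Lam gamma n p)%VS -> (U <= LamRad p)%VS \/ U = Lam gamma n p.
Proof.
move=> pn sU UL; have [UR|/subvPn [u uU uR]] := boolP (U <= LamRad p)%VS; first by left.
right; apply/eqP; rewrite eqEsubv UL /=.
have uL : u \in Lam gamma n p by apply: (subvP UL).
have [c cE] := Xi_Lam pn uL.
have c0 : c != 0.
  by apply: contraNneq uR => c0; apply/LamRadP; rewrite cE c0 scale0r.
have GU : G p \in U.
  rewrite -[G p]scale1r -(mulVf c0) -scalerA -cE memvZ //.
  by have /submoduleP := sU; apply; rewrite ?Xi_desc.
by apply: subv_trans sU; apply: prodvSr; rewrite -memvE.
Qed.

(* A submodule not contained in LamRad p contains a multiple of gamma_p, which
   generates everything. *)
Lemma RadLamE p : p \in comps -> RadLam gamma n p = LamRad p.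
Proof.
move=> pn; have nRL : LamRad p <> Lam gamma n p.
  by move=> RL; have := gamma_LamRad pn; rewrite RL gamma_Lam.
have maxR : max_submodule D (LamRad p) (Lam gamma n p).
  split=> //; [exact: LamRad_submodule | exact: capvSl |].
  move=> U sU /andP[RU UL]; have [UR|] := submodule_Lam_cases pn sU UL; last by right.
  by left; apply/eqP; rewrite eqEsubv UR.
apply/vspaceP => x; apply/idP/idP => [/radicalP[_ xN]|xR]; first exact: xN.
apply/radicalP; split; first by move/LamRadP: xR => [].
move=> N [sN NL nNL maxN]; have [NR|//] := submodule_Lam_cases pn sN NL.
have [|RN|//] := maxN (LamRad p) (LamRad_submodule pn); last by rewrite -RN.
by rewrite NR capvSl.
Qed.

Section Subalgebra.
Variables (A : {vspace KS}) (p : seq nat).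
Hypotheses (pn : p \in comps) (AD : (A <= D)%VS) (GA : G p \in A).

Lemma idem_A : idem p \in A.
Proof. exact: memvZ. Qed.

Lemma killed_submodule j : submodule A (killed j).
Proof.
apply/submoduleP => a x aA xk; apply: (killed_stable charK gammaL n0) => //.
exact: (subvP AD).
Qed.

Lemma idem_killed0 x : x \in killed 0 -> idem p * x = 0.
Proof. by move=> xk; apply: (killed_ge xk); rewrite -descent_ge // idem_desc. Qed.

Lemma idem_layer j a x : a \in A -> x \in killed j.+1 ->
  a * (idem p * x) - chi p a *: (idem p * x) \in killed j.
Proof. by move=> /(subvP AD) aD xk; apply: idem_killed. Qed.

Definition idem_cases V V' := simple_cases idem_A (idem_idem charK gammaL n0 pn)
   killed_submodule idem_killed0 (killed_top (n := n)) idem_layer (V := V) (V' := V').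

Lemma multiplicity_Lam L : submodule A L ->
  multiplicity A L (Lam gamma n p) (RadLam gamma n p) (weight (idem p) L).
Proof.
rewrite RadLamE //; apply: (multiplicity_weight idem_A _ killed_submodule idem_killed0
   (killed_top (n := n)) idem_layer).
- exact: idem_idem.
- exact: gamma_Lam.
- exact: gamma_LamRad.
- exact: LamRad_decomp.
- exact: idem_gamma.
- by move=> x; have /submoduleP := LamRad_submodule pn; apply; rewrite idem_desc.
move=> a /(subvP AD) aD; apply/LamRadP; split.
  rewrite memvB ?memvZ ?gamma_Lam //; have /submoduleP := Lam_submodule pn; apply => //.
  exact: gamma_Lam.
rewrite mulrBr -scalerAr (Xi_mul_killed charK gammaL) ?subrr //.
exact: killed_gamma.
Qed.

End Subalgebra.

(** A factor on which e_p acts nontrivially is a line with character chi_p, which vanishes at e_q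
    for q not a rearrangement of p. So each step of a D_n-composition series raises at most one of
    the weights, and by one only, while the dimension grows. *)
Lemma sum_weight ps L : uniq ps -> {subset ps <= comps} ->
  {in ps &, forall p q, perm_eq p q -> p = q} -> submodule D L ->
  (\sum_(p <- ps) weight (idem p) L <= \dim L)%N.
Proof.
move=> ups psn psP sL; have [s /andP[pths /eqP ls]] := ex_comp_series sL.
suff H (s' : seq {vspace KS}) (U : {vspace KS}) : last U s' = L -> path (fun U V => `[< max_submodule D U V >]) U s' ->
   (\sum_(p <- ps) weight (idem p) U <= \dim U)%N -> (\sum_(p <- ps) weight (idem p) L <= \dim L)%N.
  by apply: H ls pths _; rewrite big1 // => p _; rewrite weight0.
elim: s' U => [|V s' IHs] U /=; first by move=> ->.
move=> lE /andP[/asboolP maxU ps'] HU; apply: (IHs V) => //.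
have sV : submodule D V.
  by case: s' lE ps' {IHs} => [/= ->//|V2 s2 _ /= /andP[/asboolP[]//]].
have [sU UV nUV _] := maxU.
have dUV : (\dim U < \dim V)%N.
  rewrite ltn_neqAle dimvS // andbT; apply/eqP => dUV; apply: nUV.
  by apply/eqP; rewrite eqEdim UV dUV leqnn.
have [E|] := pselect (forall p, p \in ps -> forall u, u \in V -> idem p * u \in U).
  rewrite (eq_big_seq (fun p => weight (idem p) U)); first exact: leq_trans HU (ltnW dUV).
  by move=> p pps; apply: weight_step0 => //; [apply: idem_idem => //; apply: psn | apply: E].
move/existsNP=> [p /not_implyP[pps nE]].
have pn := psn _ pps.
have GD : G p \in D by apply: gamma_desc.
have := idem_cases pn (subvv _) GD sV maxU.
case=> [[v [vV vU VE ev av]]|//].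
rewrite (bigD1_seq p) //= (weight_step1 (idem_A GD) sU vU VE ev) // addSn.
rewrite big_seq_cond (eq_bigr (fun q => weight (idem q) U)) => [|q /andP[qps qp]].
  apply: leq_ltn_trans dUV; apply: leq_trans HU.
  by rewrite [leqRHS](bigD1_seq p) //= [X in (_ <= _ + X)%N]big_seq_cond.
have qn := psn _ qps; apply: (weight_step0 (idem_idem charK gammaL n0 qn)) => // u.
rewrite -VE => /memv_addP[_ /vlineP[c ->] [w wU ->]].
have eD : idem q \in D by apply: idem_desc.
have /submoduleP mU := sU; rewrite mulrDr -scalerAr.
apply: memvD; [apply: memvZ | exact: mU].
have pq : perm_eq p q = false.
  by apply/negbTE/negP => /(psP _ _ pps qps) e; move: qp; rewrite e eqxx.
by have := av _ eD; rewrite chi_idem // pq scale0r subr0.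
Qed.

End Modules.

(** * Lyndon words *)

Section Lex.
Implicit Types (u v w x y : seq nat).

Definition lexlt u v := ((u : seqlexi nat) < (v : seqlexi nat))%O.

Lemma lexlt_cons a u b v :
  lexlt (a :: u) (b :: v) = (a < b)%N || (a == b) && lexlt u v.
Proof.
rewrite /lexlt Order.SeqLexiOrder.Exports.ltxi_cons !leEnat.
by case: ltngtP => //= ->; rewrite leqnn.
Qed.

Lemma lexltnn u : lexlt u u = false.
Proof. exact: Order.POrderTheory.ltxx. Qed.

Lemma lexlt_trans : transitive lexlt.
Proof. by move=> v u w; apply: Order.POrderTheory.lt_trans. Qed.

Lemma lexlt_total u v : [|| lexlt u v, u == v | lexlt v u].
Proof.
by rewrite /lexlt; case: (Order.TotalTheory.ltgtP (u : seqlexi nat) v).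
Qed.

Lemma lexlt_asym u v : lexlt u v -> lexlt v u = false.
Proof. by move=> uv; apply/negP => /(lexlt_trans uv); rewrite lexltnn. Qed.

Lemma lexleE u v : ((u : seqlexi nat) <= (v : seqlexi nat))%O = ~~ lexlt v u.
Proof. by rewrite /lexlt Order.TotalTheory.ltNge negbK. Qed.

Lemma lexlt_nil v : lexlt [::] v = (v != [::]). Proof. by case: v. Qed.
Lemma lexlts0 v : lexlt v [::] = false. Proof. by case: v. Qed.

Lemma lexlt_cat2l w u v : lexlt (w ++ u) (w ++ v) = lexlt u v.
Proof. by elim: w => //= a w IHw; rewrite lexlt_cons ltnn eqxx. Qed.

(** The size condition excludes that u is a proper prefix of v: the two words differ at a place
    inside both. *)
Lemma lexlt_cat u v x y : lexlt u v -> (size v <= size u)%N -> lexlt (u ++ x) (v ++ y).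
Proof.
elim: u v => [|a u IHu] [|b v] //=.
rewrite !lexlt_cons ltnS => /orP[->//|/andP[-> uv] vu].
by rewrite IHu ?orbT.
Qed.

Lemma lexlt_prefix u v : lexlt u v ->
  (exists2 v', v' != [::] & v = u ++ v') \/ (forall x y, lexlt (u ++ x) (v ++ y)).
Proof.
elim: u v => [|a u IHu] [|b v]; rewrite ?lexlts0 // => uv.
  by left; exists (b :: v).
move: uv; rewrite lexlt_cons => /orP[ab|/andP[/eqP-> /IHu[[v' v0 ->]|H]]].
- by right=> x y; rewrite !cat_cons lexlt_cons ab.
- by left; exists v'.
by right=> x y; rewrite !cat_cons lexlt_cons eqxx H orbT.
Qed.

Lemma lexlt_catr u v y : lexlt u v -> lexlt u (v ++ y).
Proof.
move=> /lexlt_prefix [[v' v0 ->]|H]; last by rewrite -[u]cats0.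
rewrite -catA -{1}[u]cats0 lexlt_cat2l lexlt_nil.
by case: v' v0.
Qed.

Lemma lyndonP w : reflect (w != [::] /\ forall a b, a != [::] -> b != [::] ->
   w = a ++ b -> lexlt w b) (lyndon w).
Proof.
apply: (iffP andP) => -[w0 H]; split=> //.
  move=> a b a0 b0 wE; move/allP: H => /(_ (size a)).
  rewrite wE drop_size_cat // mem_iota size_cat; apply.
  rewrite lt0n size_eq0 a0 /= add1n prednK ?addn_gt0 ?[(0 < size a)%N]lt0n ?size_eq0 ?a0 //.
  by rewrite -[X in (X < _)%N]addn0 ltn_add2l lt0n size_eq0.
apply/allP => i; rewrite mem_iota => /andP[i0 iw].
have {}iw : (i < size w)%N by move: iw; rewrite add1n prednK // lt0n size_eq0.
apply: (H (take i w)); rewrite ?cat_take_drop // -size_eq0.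
  by rewrite size_takel ?(ltnW iw) // -lt0n.
by rewrite size_drop -lt0n subn_gt0.
Qed.

Lemma lyndon_nnil w : lyndon w -> w != [::]. Proof. by case/andP. Qed.

Lemma lyndon_lt_cat u v : lyndon u -> lyndon v -> lexlt u v -> lexlt (u ++ v) v.
Proof.
move=> /lyndonP[u0 _] /lyndonP[v0 lv] /lexlt_prefix[[v' v'0 vE]|H].
  by rewrite {2}vE lexlt_cat2l; apply: lv v'0 vE.
by rewrite -[X in lexlt _ X]cats0.
Qed.

(** A proper suffix either starts inside u, and then beats u before v is reached, or is a suffix of
    v, hence at least v, which exceeds uv. *)
Lemma lyndon_cat u v : lyndon u -> lyndon v -> lexlt u v -> lyndon (u ++ v).
Proof.
move=> Lu Lv uv; have uvv := lyndon_lt_cat Lu Lv uv.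
have [u0 lu] := lyndonP _ Lu; have [v0 lv] := lyndonP _ Lv.
apply/lyndonP; split; first by case: (u) u0.
move=> a b a0 b0 abE; have [au|ua] := ltnP (size a) (size u).
  have uE : u = a ++ drop (size a) u.
    have := congr1 (take (size a)) abE; rewrite (take_size_cat b (erefl (size a))) takel_cat ?(ltnW au) //.
    by move=> {1}<-; rewrite cat_take_drop.
  have bE : b = drop (size a) u ++ v.
    by have := congr1 (drop (size a)) abE; rewrite (drop_size_cat b (erefl (size a))) drop_cat au.
  have d0 : drop (size a) u != [::] by rewrite -size_eq0 size_drop -lt0n subn_gt0.
  by rewrite bE lexlt_cat ?(lu _ _ a0 d0 uE) // size_drop leq_subr.
have bE : b = drop (size a - size u) v.
  by have := congr1 (drop (size a)) abE; rewrite (drop_size_cat b (erefl (size a))) drop_cat ltnNge ua.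
have vE : v = take (size a - size u) v ++ b by rewrite bE cat_take_drop.
have [t0|t0] := eqVneq (take (size a - size u) v) [::].
  by rewrite t0 /= in vE; rewrite -vE.
exact: lexlt_trans uvv (lv _ _ t0 b0 vE).
Qed.

End Lex.

(** * Lie polynomials with Lyndon leading words *)

Section LyndonBasis.
Variables (K : comNzRingType) (x : nat -> seq nat -> K).
Hypothesis x_prim : forall m, (0 < m)%N -> primitive (x m) /\ homog m (x m).
Implicit Types (u v w l : seq nat) (P Q : seq nat -> K).

Lemma prode_cat u v : prode x (u ++ v) =1 cmul (prode x u) (prode x v).
Proof. by move=> w; rewrite /prode map_cat prodf_cat. Qed.

Lemma big_cmul (I J : Type) (r : seq I) (s : seq J) (F : I -> seq nat -> K) (H : J -> seq nat -> K) w :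
  cmul (fun z => \sum_(i <- r) F i z) (fun z => \sum_(j <- s) H j z) w =
  \sum_(i <- r) \sum_(j <- s) cmul (F i) (H j) w.
Proof.
rewrite /cmul (eq_bigr (fun c => \sum_(i <- r) \sum_(j <- s) F i c.1 * H j c.2)).
  rewrite exchange_big; apply: eq_bigr => i _; exact: exchange_big.
by move=> c _; rewrite mulr_suml; apply: eq_bigr => i _; rewrite mulr_sumr.
Qed.

(* The leading term of P is the word l, and its least one lexicographically. *)
Definition lead P l := exists2 e : seq (K * seq nat),
  all (fun c => perm_eq c.2 l && lexlt l c.2) e &
  forall w, P w = \sum_(c <- (1, l) :: e) c.1 * prode x c.2 w.

(** The words occurring in P have equal length, being rearrangements of u, so enlarging either
    factor enlarges the concatenation. *)
Lemma lead_mul P Q u v : lead P u -> lead Q v -> lead (cmul P Q) (u ++ v).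
Proof.
case=> e /allP eu PE [f /allP fv QE].
have h (c : K * seq nat) d : c \in (1, u) :: e -> d \in (1, v) :: f ->
    (c == (1, u)) && (d == (1, v)) || perm_eq (c.2 ++ d.2) (u ++ v) && lexlt (u ++ v) (c.2 ++ d.2).
  rewrite !inE => /orP[/eqP-> | /eu /andP[pc lc]].
    move=> /orP[/eqP-> | /fv /andP[pd ld]]; first by rewrite !eqxx.
    by rewrite perm_cat2l pd lexlt_cat2l ld orbT.
  move=> dv; have pd : perm_eq d.2 v by case/orP: dv => [/eqP->|/fv/andP[]].
  by rewrite (perm_cat pc pd) lexlt_cat ?orbT // (perm_size pc).
pose g (c d : K * seq nat) := (c.1 * d.1, c.2 ++ d.2).
exists ([seq g (1, u) d | d <- f] ++ [seq g c d | c <- e, d <- (1, v) :: f]).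
  rewrite all_cat; apply/andP; split.
    apply/allP => _ /mapP[d /fv /andP[pd ld] ->] /=.
    by rewrite perm_cat2l pd lexlt_cat2l ld.
  apply/allP => _ /allpairsP[[c d] /= [/eu /andP[pc lc] dv ->]] /=.
  have pd : perm_eq d.2 v by case/predU1P: dv => [->|/fv/andP[]].
  by rewrite (perm_cat pc pd) lexlt_cat // (perm_size pc).
move=> w; have -> : (1, u ++ v) :: ([seq g (1, u) d | d <- f] ++ [seq g c d | c <- e, d <- (1, v) :: f])
   = [seq g c d | c <- (1, u) :: e, d <- (1, v) :: f] by rewrite /= /g /= mulr1.
rewrite big_allpairs_dep /= (eq_cmul PE QE) big_cmul.
apply: eq_bigr => c _; apply: eq_bigr => d _.
rewrite prode_cat /cmul mulr_sumr; apply: eq_bigr => k _.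
by rewrite mulrACA.
Qed.

Lemma lead_sub P Q l l' : lead P l -> lead Q l' -> perm_eq l' l -> lexlt l l' ->
  lead (fun w => P w - Q w) l.
Proof.
case=> e /allP el PE [f /allP fl QE] pl ll.
exists (e ++ [seq (- c.1, c.2) | c <- (1, l') :: f]).
  rewrite all_cat; apply/andP; split; first exact/allP.
  apply/allP => _ /mapP[c + ->]; rewrite inE /= => /orP[/eqP->|/fl/andP[pc lc]].
    by rewrite pl ll.
  by rewrite (perm_trans pc pl) (lexlt_trans ll lc).
move=> w; rewrite PE QE -cat_cons big_cat big_map -sumrN; congr (_ + _).
by apply: eq_bigr => c _; rewrite mulNr.
Qed.

Definition lie_lead P l := [/\ primitive P, homog (sumn l) P & lead P l].

Lemma lie_lead_bracket P Q u v : lie_lead P u -> lie_lead Q v ->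
  lexlt (u ++ v) (v ++ u) -> lie_lead (fun w => cmul P Q w - cmul Q P w) (u ++ v).
Proof.
move=> [pP hP lP] [pQ hQ lQ] uv; split; first exact: bracket_primitive.
  move=> w; rewrite sumn_cat => sw; rewrite (cmul_homog hP hQ) // (cmul_homog hQ hP) ?subrr //.
  by rewrite addnC.
by apply: lead_sub (lead_mul lP lQ) (lead_mul lQ lP) _ uv; rewrite perm_catC.
Qed.

Lemma lie_lead_letter m : (0 < m)%N -> lie_lead (x m) [:: m].
Proof.
move=> m0; have [px hx] := x_prim m0; split=> //; first by rewrite /= addn0.
by exists [::] => // w; rewrite big_seq1 mul1r /prode /= cmul1.
Qed.

Definition lyndon_lie l := lyndon l /\ exists P, lie_lead P l.

Local Notation lexge := (fun v w : seq nat => ((w : seqlexi nat) <= (v : seqlexi nat))%O).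

(** While u is smaller than the next factor v, merge them: uv is Lyndon, and the bracket of their
    Lie polynomials has leading word uv because uv < v < vu. One insertion procedure thus yields
    both the factorization and the polynomials. *)
Lemma lyndon_lie_insert u ss : lyndon_lie u -> {in ss, forall s, lyndon_lie s} ->
  sorted lexge ss -> exists ss', [/\ flatten ss' = u ++ flatten ss,
    {in ss', forall s, lyndon_lie s} & sorted lexge ss'].
Proof.
elim: ss u => [|v ss IHss] u Lu Lss sss.
  by exists [:: u]; split=> // s; rewrite inE => /eqP->.
have Lv : lyndon_lie v by apply: Lss; rewrite mem_head.
have [uv|uv] := boolP (lexlt u v); last first.
  exists [:: u, v & ss]; split=> //; last by rewrite /= lexleE uv.
  by move=> s; rewrite inE => /predU1P[->|/Lss].
have [||ss' [fE Lss' sss']] := IHss (u ++ v) _ _ (path_sorted sss).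
- case: Lu => Lu [P lP]; case: Lv => Lv [Q lQ]; split; first exact: lyndon_cat.
  exists (fun w => cmul P Q w - cmul Q P w); apply: lie_lead_bracket => //.
  exact/lexlt_catr/lyndon_lt_cat.
- by move=> s sss'; apply: Lss; rewrite inE sss' orbT.
by exists ss'; split=> //; rewrite fE /= catA.
Qed.

Lemma lyndon_lie_factorization w : all (leq 1) w -> exists ss,
  [/\ flatten ss = w, {in ss, forall s, lyndon_lie s} & sorted lexge ss].
Proof.
elim: w => [|m w IHw] /=; first by exists [::].
case/andP=> m0 /IHw [ss [<- Lss sss]].
apply: (@lyndon_lie_insert [:: m]) => //; split=> //.
by exists (x m); apply: lie_lead_letter.
Qed.

(** A factorization of a Lyndon word has one factor only. Otherwise its first factor s is a proper
    prefix and its last factor s' a proper suffix, so s < l < s', against the decreasing order of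
    the factors. *)
Lemma lyndon_lie_lead l : all (leq 1) l -> lyndon l -> exists P, lie_lead P l.
Proof.
move=> l1 Ll; have [ss [fE Lss sss]] := lyndon_lie_factorization l1.
have [l0 ll] := lyndonP _ Ll.
case: ss fE Lss sss => [|s ss]; first by move=> le; rewrite -le in l0.
case/lastP: ss => [|ss s'] /= fE Lss sss.
  by rewrite -fE cats0; case: (Lss s (mem_head _ _)).
have ge_trans : transitive lexge.
  by move=> b a c /= ba cb; apply: Order.POrderTheory.le_trans cb ba.
have ss' : ~~ lexlt s s'.
  rewrite -lexleE; move: sss; rewrite path_sortedE // => /andP[/allP + _].
  by apply; rewrite mem_rcons mem_head.
have s0 : s != [::] by have [/lyndon_nnil] := Lss s (mem_head _ _).
have s'0 : s' != [::].
  by have [|/lyndon_nnil] := Lss s' _; rewrite // inE mem_rcons mem_head orbT.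
rewrite flatten_rcons catA in fE.
have ls' : lexlt l s'.
  by apply: (ll (s ++ flatten ss)) => //; rewrite ?fE //; case: (s) s0.
case/negP: ss'.
apply: lexlt_trans ls'; rewrite -fE -catA -{1}[s]cats0 lexlt_cat2l lexlt_nil.
by case: (flatten ss).
Qed.

Definition lyndon_eval l : seq nat -> K :=
  if pselect (exists P, lie_lead P l) is left H then sval (cid H) else fun=> 0.

Lemma lyndon_evalP l : all (leq 1) l -> lyndon l -> lie_lead (lyndon_eval l) l.
Proof.
move=> l1 Ll; rewrite /lyndon_eval; case: pselect => [H|[]]; first exact: svalP (cid H).
exact: lyndon_lie_lead.
Qed.

Lemma lyndon_prim_family ss : all lyndon ss -> all (leq 1) (flatten ss) ->
  prim_family lyndon_eval sumn ss.
Proof.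
move=> /allP Lss /allP s1 s sss.
have s1' : all (leq 1) s by apply/allP => m ms; apply: s1; apply/flattenP; exists s.
by have [] := lyndon_evalP s1' (Lss s sss).
Qed.

Lemma lyndon_lead ss : all lyndon ss -> all (leq 1) (flatten ss) ->
  lead (prode lyndon_eval ss) (flatten ss).
Proof.
elim: ss => [|s ss IHss] /=.
  by move=> _ _; exists [::] => // w; rewrite big_seq1 mul1r.
case/andP=> Ls Lss; rewrite all_cat => /andP[s1 ss1].
have [_ _ leads] := lyndon_evalP s1 Ls.
exact: lead_mul leads (IHss Lss ss1).
Qed.

End LyndonBasis.

Lemma take_sumn u v a b : all (leq 1) u -> all (leq 1) v -> u ++ a = v ++ b ->
  sumn u = sumn v -> u = v.
Proof.
elim: u v => [|m u IHu] [|k v] //=.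
- by move=> _ /andP[k0 _] _ e; case: k k0 e.
- by move=> /andP[m0 _] _ _ e; case: m m0 e.
by move=> /andP[_ u1] /andP[_ v1] [-> uv] /eqP; rewrite eqn_add2l => /eqP /(IHu _ u1 v1 uv) ->.
Qed.

(** As the letters are positive, a prefix of a word is determined by its sum, so the sums tell where
    to cut. *)
Lemma flatten_sumn_inj ss tt : all (leq 1) (flatten ss) -> all (leq 1) (flatten tt) ->
  flatten ss = flatten tt -> map sumn ss = map sumn tt -> ss = tt.
Proof.
elim: ss tt => [|s ss IHss] [|t tt] //=; rewrite !all_cat.
move=> /andP[s1 ss1] /andP[t1 tt1] fE [st sstt].
have e := take_sumn s1 t1 fE st; rewrite e in fE *; congr (_ :: _).
by apply: IHss => //; apply/eqP; move/eqP: fE; rewrite eqseq_cat // eqxx.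
Qed.

Definition lyndon_fact (r : seq nat) : seq (seq nat) :=
  head [::] [seq ss <- [seq reshape sh r | sh <- compositions (size r)]
       | lyndon_factorization r ss].

Lemma LSCE r : LSC r = map sumn (lyndon_fact r). Proof. by []. Qed.

Lemma lyndon_factP r : (exists ss, lyndon_factorization r ss) ->
  lyndon_factorization r (lyndon_fact r).
Proof.
case=> ss Lss; rewrite /lyndon_fact.
have : ss \in [seq ss <- [seq reshape sh r | sh <- compositions (size r)]
       | lyndon_factorization r ss].
  rewrite mem_filter Lss /=; have /and3P[/eqP fE Ls _] := Lss.
  apply/mapP; exists (shape ss); last by rewrite -fE flattenK.
  rewrite mem_compositions /is_composition -fE size_flatten eqxx andbT.
  apply/allP => _ /mapP[s /(allP Ls) /lyndon_nnil s0 ->].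
  by rewrite lt0n size_eq0.
case E: [seq _ <- _ | _] => [//|s l] _ /=.
by have := mem_head s l; rewrite -E mem_filter => /andP[].
Qed.

(** * Linear independence by leading words *)

Section Independence.
Variables (K : fieldType) (vT : vectType K) (I : eqType) (m : I -> seq nat).
Variables (y : I -> vT) (kappa : seq nat -> {linear vT -> K^o}).

Lemma free_leading (s : seq I) : pairwise (fun i j => lexlt (m i) (m j)) s ->
  {in s, forall i, kappa (m i) (y i) != 0} ->
  {in s, forall i w, lexlt w (m i) -> kappa w (y i) = 0} -> free (map y s).
Proof.
elim: s => [|i s IHs] /=; first by rewrite nil_free.
case/andP=> /allP lt_is ps k1 k2; rewrite free_cons IHs // ?andbT.
- apply/negP => yi; have /negP[] := k1 i (mem_head _ _); apply/eqP.
  move: (y i) yi; apply: (span_ind_prop (P := fun z => kappa (m i) z = 0)).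
  + exact: linear0.
  + by move=> c u v u0 v0; rewrite linearP u0 v0 scaler0 addr0.
  move=> _ /mapP[j js ->]; apply: k2; first by rewrite inE js orbT.
  exact: lt_is.
- by move=> j js; apply: k1; rewrite inE js orbT.
by move=> j js; apply: k2; rewrite inE js orbT.
Qed.

Lemma leading_dim (s : seq I) (U : {vspace vT}) : uniq s -> {in s &, injective m} ->
  {in s, forall i, y i \in U} ->
  {in s, forall i, kappa (m i) (y i) != 0} ->
  {in s, forall i w, lexlt w (m i) -> kappa w (y i) = 0} -> (size s <= \dim U)%N.
Proof.
move=> us m_inj yU k1 k2; pose R i j := ~~ lexlt (m j) (m i).
have R_total : total R.
  move=> i j; rewrite /R -negb_and; apply/negP => /andP[ij ji].
  by rewrite (lexlt_asym ij) in ji.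
have R_trans : transitive R.
  move=> j i k; rewrite /R -!lexleE; exact: Order.POrderTheory.le_trans.
have mem_s := mem_sort R s.
have ps : pairwise (fun i j => lexlt (m i) (m j)) (sort R s).
  have : pairwise R (sort R s) by rewrite -sorted_pairwise ?sort_sorted.
  have : uniq (sort R s) by rewrite sort_uniq.
  have : {subset sort R s <= s} by move=> i; rewrite mem_s.
  elim: (sort R s) => //= i l IHl ls /andP[il ul] /andP[/allP Ril Rl].
  rewrite IHl ?andbT // => [|j jl]; last by apply: ls; rewrite inE jl orbT.
  apply/allP => j jl; have := Ril j jl; rewrite /R.
  have /or3P[//|/eqP mij|->//] := lexlt_total (m i) (m j).
  have jE : i = j by apply: m_inj mij; apply: ls; rewrite inE ?eqxx ?jl ?orbT.
  by rewrite jE jl in il.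
have fy : free (map y (sort R s)).
  by apply: free_leading ps _ _ => i; rewrite mem_s => iS; [apply: k1 | apply: k2].
have /eqP dE := fy; rewrite size_map size_sort in dE; rewrite -dE; apply: dimvS.
by apply/span_subvP => _ /mapP[i + ->]; rewrite mem_s => /yU.
Qed.

End Independence.

Lemma lex_min (l : seq (seq nat)) : l != [::] -> exists2 w, w \in l & forall v, v \in l -> ~~ lexlt v w.
Proof.
elim: l => // w [|w' l] IHl _.
  by exists w; rewrite ?mem_head // => v; rewrite inE => /eqP ->; rewrite lexltnn.
have [//|u ul umin] := IHl _; have [wu|wu] := boolP (lexlt w u).
  exists w; rewrite ?mem_head // => v; rewrite inE => /predU1P[->|vl]; first by rewrite lexltnn.
  by apply/negP => vw; have /negP[] := umin v vl; apply: lexlt_trans vw wu.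
exists u; first by rewrite inE ul orbT.
by move=> v; rewrite inE => /predU1P[->|/umin].
Qed.

(** * Multiplicities *)

Lemma toKS_sum (K : fieldType) n (I : Type) (r : seq I) (c : I -> K) (F : I -> seq nat -> K) P :
  (forall w, P w = \sum_(i <- r) c i * F i w) ->
  toKS n P = \sum_(i <- r) c i *: toKS n (F i).
Proof.
move=> PE; apply/ffunP => g; rewrite sum_ffunE ffunE PE.
by apply: eq_bigr => i _; rewrite !ffunE.
Qed.

Section LowerBound.
Variables (K : fieldType) (charK : [pchar K] =i pred0).
Variables (gamma : forall m : nat, grpalg K 'S_m) (gammaL : Lie_series gamma).
Variables (n : nat) (n0 : (0 < n)%N).
Implicit Types (s t q r p w : seq nat) (ss tt : seq (seq nat)).
Local Notation G := (gamma_word gamma n).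
Local Notation X := (Xi K n).
Local Notation comps := (compositions n).
Local Notation KS := (grpalg K 'S_n).
Local Notation idem := (idem gamma n).
Local Notation x := (letterx gamma).
Local Notation ev := (lyndon_eval x).

Lemma letterx_prim m : (0 < m)%N -> primitive (x m) /\ homog m (x m).
Proof. by move=> m0; split; [apply: gamma_primitive | apply: ext_homog]. Qed.

Lemma lyndon_fact_comp r : r \in comps -> lyndon_factorization r (lyndon_fact r).
Proof.
move=> rn; apply: lyndon_factP.
have [ss [fE Lss sss]] := lyndon_lie_factorization letterx_prim (comp_pos rn).
exists ss; apply/and3P; split=> //; first exact/eqP.
by apply/allP => s /Lss [].
Qed.

(** The factors are sorted, so their multiset determines their list and hence the word. *)
Lemma lyndon_fact_inj : {in comps &, forall r t,
  perm_eq (lyndon_fact r) (lyndon_fact t) -> r = t}.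
Proof.
move=> r t rn tn rt; have /and3P[/eqP fr _ sr] := lyndon_fact_comp rn.
have /and3P[/eqP ft _ st] := lyndon_fact_comp tn; rewrite -fr -ft; congr flatten.
apply: sorted_eq sr st rt => [b a c /= ba cb|a b /andP[ba ab]].
  exact: Order.POrderTheory.le_trans cb ba.
by apply: (Order.POrderTheory.le_anti (x := (a : seqlexi nat)) (y := b)); rewrite ab ba.
Qed.

Lemma LSC_comp r : r \in comps -> LSC r \in comps.
Proof.
move=> rn; have /and3P[/eqP fE Ls _] := lyndon_fact_comp rn.
rewrite LSCE mem_compositions /is_composition -sumn_flatten fE (comp_sumn rn) eqxx andbT.
apply/allP => _ /mapP[s sL ->]; have := lyndon_nnil (allP Ls s sL).
case: s sL => // a s sL _ /=; apply: leq_trans (leq_addr _ _).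
apply: (allP (comp_pos rn)); rewrite -fE; apply/flattenP; exists (a :: s) => //.
exact: mem_head.
Qed.

(** Products of letters over rearrangements of r are the gamma basis vectors of Lambda^r, so a
    leading word becomes a leading coordinate. *)
Lemma lead_coord P r : r \in comps -> lead x P r ->
  toKS n P \in Lam gamma n r /\
  forall w, ~~ lexlt r w -> gcoord gamma w (toKS n P) = (w == r)%:R.
Proof.
move=> rn [e /allP er PE].
have E c : c \in (1, r) :: e -> toKS n (prode x c.2) = G c.2 /\ perm_eq c.2 r.
  move=> ce; have pc : perm_eq c.2 r by case/predU1P: ce => [->|/er/andP[]].
  have cn := comp_perm rn pc.
  by rewrite gamma_wordE ?(comp_sumn cn) ?(comp_pos cn).
rewrite (toKS_sum n PE); split.
  rewrite big_seq; apply: memv_suml => c /E [-> pc]; rewrite memvZ //.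
  exact: gamma_Lam.
move=> w rw; rewrite linear_sum big_cons /= big1_seq ?addr0 => [|c /andP[_ ce]].
  by have [-> _] := E _ (mem_head _ _); rewrite scale1r gcoord_gamma.
have ce' : c \in (1, r) :: e by rewrite inE ce orbT.
have [-> pc] := E _ ce'.
rewrite linearZ /= gcoord_gamma ?(comp_perm rn pc) //.
case: eqP => [wc|]; last by rewrite scaler0.
by move: rw; rewrite wc; have /andP[_ ->] := er c ce.
Qed.

Section Fixed.
Variables (p q : seq nat) (pn : p \in comps) (qn : q \in comps).

Definition lyndon_vec r := toKS n (prode ev (lyndon_fact r)).
(** If LSC(r) ~ p, these are the orders of the Lyndon factors of r in which the letter sums read p;
    see [arrangementsP]. *)
Definition arrangements r := act sumn p (lyndon_fact r).

Lemma arrangementsP r ss : r \in comps -> perm_eq (LSC r) p -> ss \in arrangements r ->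
  [/\ perm_eq ss (lyndon_fact r), map sumn ss = p, flatten ss \in comps & all lyndon ss].
Proof.
move=> rn rp sr; have pss := act_perm sr.
have /and3P[/eqP fE Ls _] := lyndon_fact_comp rn.
split=> //; last by rewrite (perm_all _ pss).
  apply: act_deg (comp_pos pn) sr _.
  by rewrite (perm_size pss) -(perm_size rp) LSCE size_map.
by apply: comp_perm rn _; rewrite -fE; apply: perm_flatten.
Qed.

Lemma lyndon_vec_family r : r \in comps -> prim_family ev sumn (lyndon_fact r).
Proof.
move=> rn; have /and3P[/eqP fE Ls _] := lyndon_fact_comp rn.
by apply: (lyndon_prim_family letterx_prim) => //; rewrite fE; apply: comp_pos rn.
Qed.

Lemma Xi_lyndon_vec r : r \in comps ->
  X p * lyndon_vec r = \sum_(ss <- arrangements r) toKS n (prode ev ss).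
Proof. by move=> rn; rewrite (Xi_mul_prode pn (lyndon_vec_family rn)). Qed.

Lemma lyndon_vec_killed r : r \in comps -> perm_eq (LSC r) p ->
  lyndon_vec r \in killed K n (size p).+1.
Proof.
move=> rn rp; apply/killedP => s sn ps.
rewrite (Xi_mul_prode sn (lyndon_vec_family rn)) big1_seq // => ss /andP[_ sss].
have := act_size (comp_pos sn) sss; rewrite (perm_size (act_perm sss)).
by rewrite leqNgt -[size (lyndon_fact r)](size_map sumn) -LSCE (perm_size rp) ps.
Qed.

Lemma lyndon_vec_Lam r : r \in comps -> perm_eq r q -> lyndon_vec r \in Lam gamma n q.
Proof.
move=> rn rq; rewrite -(Lam_perm charK gammaL n0 qn rq).
have /and3P[/eqP fE Ls _] := lyndon_fact_comp rn.
have := @lyndon_lead _ _ letterx_prim _ Ls; rewrite fE => /(_ (comp_pos rn)).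
by case/(lead_coord rn).
Qed.

(** The vector is a product of as many primitives as p has parts, so longer Xi annihilate it; on it
    e_p is a nonzero multiple of Xi^p, whose action is an explicit sum. *)
Lemma Xi_lyndon_vec_img r : r \in comps -> perm_eq r q -> perm_eq (LSC r) p ->
  X p * lyndon_vec r \in (amull (idem p) @: Lam gamma n q)%VS.
Proof.
move=> rn rq rp; have vL := lyndon_vec_Lam rn rq.
have c0 : (chi gamma p (G p))^-1 * prodn K p != 0.
  rewrite mulf_neq0 ?invr_neq0 ?chi_gamma_neq0 //.
  by apply: prodn_neq0 => //; apply: comp_pos pn.
have -> : X p * lyndon_vec r =
    amull (idem p) (((chi gamma p (G p))^-1 * prodn K p)^-1 *: lyndon_vec r).
  rewrite amullE -scalerAr -scalerAl (gamma_mul_killed charK gammaL) ?lyndon_vec_killed //.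
  by rewrite !scalerA -mulrA mulVf ?scale1r.
by rewrite memv_img ?memvZ.
Qed.

Definition is_least_arrangement r w :=
  w \in map flatten (arrangements r) /\
  forall v, v \in map flatten (arrangements r) -> ~~ lexlt v w.

Definition least_arrangement r : seq nat :=
  if pselect (exists w, is_least_arrangement r w) is left H then sval (cid H) else [::].

Lemma least_arrangementP r : r \in comps -> perm_eq (LSC r) p ->
  is_least_arrangement r (least_arrangement r).
Proof.
move=> rn rp; rewrite /least_arrangement; case: pselect => [H|[]]; first exact: svalP (cid H).
have [|w wl wmin] := @lex_min (map flatten (arrangements r)); last by exists w.
by have [ss] := act_nonempty rp; rewrite /arrangements; case: (act _ _ _).
Qed.

Lemma arrangement_coord r ss w : r \in comps -> perm_eq (LSC r) p -> ss \in arrangements r ->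
  ~~ lexlt (flatten ss) w -> gcoord gamma w (toKS n (prode ev ss)) = (w == flatten ss)%:R.
Proof.
move=> rn rp sr; have [_ _ fn Ls] := arrangementsP rn rp sr.
by have [_] := lead_coord fn (lyndon_lead letterx_prim Ls (comp_pos fn)); apply.
Qed.

(* The leading word of Xi^p * lyndon_vec r is the least arrangement of the Lyndon
   factors of r with degrees p.  Cutting it along p recovers these factors, hence
   r, so the leading words are distinct. *)
Lemma weight_ge : (count (fun r => perm_eq r q && perm_eq (LSC r) p) comps
  <= weight (idem p) (Lam gamma n q))%N.
Proof.
rewrite -size_filter; set R := filter _ _.
have RP r : r \in R -> [/\ r \in comps, perm_eq r q & perm_eq (LSC r) p].
  by rewrite mem_filter => /andP[/andP[? ?] ?].
apply: (@leading_dim K _ _ least_arrangement (fun r => X p * lyndon_vec r)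
   (fun w => gcoord gamma w)).
- by rewrite filter_uniq ?compositions_uniq.
- move=> r t /RP[rn rq rp] /RP[tn tq tp] rt; apply: lyndon_fact_inj => //.
  have [/mapP[ss sr rE] _] := least_arrangementP rn rp.
  have [/mapP[tt st tE] _] := least_arrangementP tn tp.
  have [ps ms fs _] := arrangementsP rn rp sr; have [pt mt ft _] := arrangementsP tn tp st.
  have st' : ss = tt.
    by apply: flatten_sumn_inj; rewrite ?(comp_pos fs) ?(comp_pos ft) ?ms -?rE -?tE.
  by rewrite perm_sym in ps; apply: perm_trans ps _; rewrite st'.
- by move=> r /RP[rn rq rp]; apply: Xi_lyndon_vec_img.
- move=> r /RP[rn rq rp] /=; have [mr mmin] := least_arrangementP rn rp.
  rewrite Xi_lyndon_vec // linear_sum.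
  rewrite (eq_big_seq (fun ss => (least_arrangement r == flatten ss)%:R)) => [|ss sr]; last first.
    by rewrite /= (arrangement_coord rn rp sr) // mmin // map_f.
  (* Repeated Lyndon factors may give the same arrangement several times. The coefficient is this
     positive number, nonzero in characteristic 0. *)
  rewrite -[\sum_(i <- _) _]natr_sum; apply: (char0_natf_neq0 charK).
  have /mapP[ss sr mE] := mr.
  by rewrite (perm_big _ (perm_to_rem sr)) big_cons /= mE eqxx.
move=> r /RP[rn rq rp] w wm /=; have [mr mmin] := least_arrangementP rn rp.
rewrite Xi_lyndon_vec // linear_sum big1_seq // => ss /andP[_ sr] /=.
have ms : ~~ lexlt (flatten ss) (least_arrangement r) by rewrite mmin // map_f.
rewrite (arrangement_coord rn rp sr) //; last by apply: contra ms => /lexlt_trans; apply.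
by case: eqP => // wE; rewrite -wE wm in ms.
Qed.

End Fixed.

(* The lower bounds weight_ge are all equalities, as both sides have the same sum
   over the partitions p. *)
Lemma weight_Lam p q : p \in comps -> sorted geq p -> q \in comps ->
  weight (idem p) (Lam gamma n q) = count (fun r => perm_eq r q && perm_eq (LSC r) p) comps.
Proof.
move=> pn sp qn; pose ps := [seq p <- comps | sorted geq p].
pose L p' := count (fun r => perm_eq r q && perm_eq (LSC r) p') comps.
have ups : uniq ps by rewrite filter_uniq ?compositions_uniq.
have psn : {subset ps <= comps} by move=> r; rewrite mem_filter => /andP[].
have psP : {in ps &, forall p q, perm_eq p q -> p = q}.
  move=> r t; rewrite !mem_filter => /andP[sr _] /andP[st _].
  move=> rt; apply: sorted_eq sr st rt => [b a c /= ba cb|a b /andP[ba ab]].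
    exact: leq_trans cb ba.
  by apply/eqP; rewrite eqn_leq; apply/andP; split.
have pps : p \in ps by rewrite mem_filter sp.
(* Each r ~ q is counted at the weakly decreasing rearrangement of LSC(r). *)
have sumL : (count (fun r => perm_eq r q) comps <= \sum_(p' <- ps) L p')%N.
  have countE (P : pred (seq nat)) : count P comps = (\sum_(r <- comps) P r)%N.
    by rewrite -sum1_count big_mkcond; apply: eq_bigr => r _; case: (P r).
  rewrite countE (eq_bigr _ (fun p' _ => countE (fun r => perm_eq r q && perm_eq (LSC r) p'))).
  rewrite exchange_big big_seq [leqRHS]big_seq; apply: leq_sum => r rn.
  case: (perm_eq r q) => //=; pose t := sort geq (LSC r).
  have tr : perm_eq (LSC r) t by rewrite perm_sym perm_sort.
  have tps : t \in ps.
    rewrite mem_filter (comp_perm (LSC_comp rn)) ?perm_sort // andbT.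
    by apply: sort_sorted => a b; apply: leq_total.
  by rewrite (bigD1_seq t) //= tr.
have sumW := sum_weight charK gammaL n0 ups psn psP (Lam_submodule charK gammaL n0 qn).
have LW p' : p' \in ps -> (L p' <= weight (idem p') (Lam gamma n q))%N.
  by move=> /psn pn'; apply: weight_ge.
apply/eqP; rewrite eqn_leq LW // andbT.
have := leq_trans sumW (leq_trans (dim_Lam charK gammaL n0 qn) sumL).
rewrite (bigD1_seq p) //= [leqRHS](bigD1_seq p) //=.
set A := (\sum_(i <- ps | _) weight _ _)%N; set B := (\sum_(i <- ps | _) L i)%N => AB.
have BA : (B <= A)%N.
  rewrite /A /B big_seq_cond [leqRHS]big_seq_cond.
  by apply: leq_sum => i /andP[ips _]; apply: LW.
by rewrite -(leq_add2r B); apply: leq_trans AB; rewrite leq_add2l.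
Qed.

Hypothesis gammaP : forall m : nat, odd m -> gamma m \in peak_alg K m.

(** Only odd parts occur, so every factor is a peak element, and the outer product keeps the result
    in the peak algebra. *)
Lemma gamma_word_peak k p : k = sumn p -> all odd p ->
  gamma_word gamma k p \in peak_alg K k.
Proof.
move=> ->; elim: p => [|m p IHp] /=.
  by move=> _; apply/peak_algP => g h _; congr (_ _); apply/permP => -[].
case/andP=> mo po; have m0 := odd_gt0 mo.
have p1 : all (leq 1) p by apply: sub_all po => i; apply: odd_gt0.
apply: outer_peak => //; [exact: gamma_span | exact: gamma_word_span | exact: gammaP |].
exact: IHp.
Qed.

End LowerBound.

Theorem corollary10p6 (K : fieldType) (charK : [pchar K] =i pred0)
    (n : nat) (n_gt1 : (1 < n)%N)
    (gamma : forall m : nat, grpalg K 'S_m) (gammaL : Lie_series gamma)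
    (gammaP : forall m : nat, odd m -> gamma m \in peak_alg K m)
    (p q : seq nat) (podd : odd_partition n p) (qodd : odd_partition n q) :
  exists c : nat,
    [/\ multiplicity (peak_alg K n) (Lam gamma n q)
          (Lam gamma n p) (RadLam gamma n p) c,
        multiplicity (descent_alg K n) (Lam gamma n q)
          (Lam gamma n p) (RadLam gamma n p) c
      & c = count (fun r => perm_eq r q && perm_eq (LSC r) p) (compositions n)].
Proof.
have n0 : (0 < n)%N := ltnW n_gt1.
have [/andP[pn sp] po] := andP podd; have [/andP[qn sq] qo] := andP qodd.
rewrite -!mem_compositions in pn qn.
have sL := Lam_submodule charK gammaL n0 qn.
have Gp : gamma_word gamma n p \in peak_alg K n.
  by apply: gamma_word_peak => //; rewrite (comp_sumn pn).
(* The dimension of e_p Lambda^q does not depend on the acting algebra, so it is the witness for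
   both multiplicities. *)
exists (weight (idem gamma n p) (Lam gamma n q)); split; last exact: weight_Lam.
  apply: multiplicity_Lam => //; first exact: peak_descent.
  exact: submoduleS (peak_descent K n0) sL.
by apply: multiplicity_Lam => //; apply: gamma_desc.
Qed.
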